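(* Let $L$ be a finite-dimensional simple Lie algebra over an algebraically closed field $F$ of characteristic zero, and let $P$ be a standard maximal parabolic subalgebra of $L$, determined by the subset $\Sigma_1$ of the simple roots. Then $P$ has an abelian supplement in $L$ if and only if one of the following holds: $L\cong A_n$ and $\Sigma_1=\{\alpha_i\}$ (for any $1\le i\le n$); $L\cong B_n$ and $\Sigma_1=\{\alpha_1\}$; $L\cong C_n$ and $\Sigma_1=\{\alpha_n\}$; $L\cong D_n$ and $\Sigma_1=\{\alpha_1\}$, $\{\alpha_{n-1}\}$ or $\{\alpha_n\}$; $L\cong E_6$ and $\Sigma_1=\{\alpha_1\}$ or $\{\alpha_6\}$; or $L\cong E_7$ and $\Sigma_1=\{\alpha_7\}$.
   Context: For a subalgebra $M$ of $L$, a subalgebra $U$ of $L$ is a supplement to $M$ in $L$ if $L=M+U$; it is an abelian supplement if $U$ is abelian. Let $H$ be a Cartan subalgebra of $L$ and let $\Gamma$, $\Gamma^+$, $\Sigma$ be the systems of roots, positive roots and simple roots of $L$ with respect to $H$, so that $L=H+\sum_{\alpha\in\Gamma}V_\alpha$ with one-dimensional root spaces $V_\alpha$. For a non-empty subset $\Sigma_1\subseteq\Sigma$ put $\Delta_1=\{\gamma\in\Gamma:\gamma=\sum_{\alpha\in\Sigma\setminus\Sigma_1}m_\alpha\alpha\}$ (the roots that are integer combinations of simple roots not in $\Sigma_1$) and $\Delta_2^+=(\Gamma\setminus\Delta_1)\cap\Gamma^+$. The standard parabolic subalgebra determined by $\Sigma_1$ is $P=H+\sum_{\alpha\in\Delta_1}V_\alpha+\sum_{\alpha\in\Delta_2^+}V_\alpha$.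 It is a maximal parabolic subalgebra exactly when $\Sigma_1$ consists of a single simple root. Simple roots $\alpha_1,\alpha_2,\dots$ are numbered as in Bourbaki: in types $A_n,B_n,C_n$ the Dynkin diagram is the chain $\alpha_1-\alpha_2-\cdots-\alpha_n$, with $\alpha_n$ the short simple root in type $B_n$ and the long simple root in type $C_n$ ($n\ge 2$ in both types); in type $D_n$ the diagram is the chain $\alpha_1-\cdots-\alpha_{n-2}$ with both $\alpha_{n-1}$ and $\alpha_n$ attached to $\alpha_{n-2}$; in type $E_6$ (resp. $E_7$) it is the chain $\alpha_1-\alpha_3-\alpha_4-\alpha_5-\alpha_6$ (resp. $\alpha_1-\alpha_3-\alpha_4-\alpha_5-\alpha_6-\alpha_7$) with $\alpha_2$ attached to $\alpha_4$. *)

(* Defs.v *)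
From HB Require Import structures.
From mathcomp Require Import all_boot all_order all_algebra.
From mathcomp Require Import finmap boolp.

Set Implicit Arguments.
Unset Strict Implicit.
Unset Printing Implicit Defensive.

Import GRing.Theory.
Local Open Scope ring_scope.

HB.mixin Record Vector_isLieAlgebra (F : fieldType) L of Vector F L := {
  lie : L -> L -> L;
  lie_linearl : forall (a : F) (x y z : L),
    lie (a *: x + y) z = a *: lie x z + lie y z;
  lie_linearr : forall (a : F) (x y z : L),
    lie z (a *: x + y) = a *: lie z x + lie z y;
  liexx : forall x : L, lie x x = 0;
  lie_jacobi : forall x y z : L,
    lie x (lie y z) + lie y (lie z x) + lie z (lie x y) = 0
}.

#[short(type="lieAlgType")]
HB.structure Definition LieAlgebra (F : fieldType) :=
  { L of Vector F L & Vector_isLieAlgebra F L }.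

Section LieAlgebra.

Variables (F : fieldType) (L : lieAlgType F).
Implicit Types (x y : L) (U M I : {vspace L}).

HB.instance Definition _ x :=
  GRing.isLinear.Build F L L *:%R (lie x) (fun a y z => lie_linearr a y z x).

Definition ad x : 'End(L) := linfun (lie x).

Lemma adE x y : ad x y = lie x y.
Proof. by rewrite lfunE. Qed.

Lemma ad_is_linear : linear ad.
Proof.
move=> a x y; apply/lfunP => z.
by rewrite add_lfunE scale_lfunE !adE lie_linearl.
Qed.

HB.instance Definition _ :=
  GRing.isLinear.Build F L 'End(L) *:%R ad ad_is_linear.

Definition subalgebra U := forall x y, x \in U -> y \in U -> lie x y \in U.

Definition lie_ideal I := forall x y, y \in I -> lie x y \in I.

Definition lie_abelian U := forall x y, x \in U -> y \in U -> lie x y = 0.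

Definition lie_simple :=
  ~ lie_abelian fullv /\
  forall I, lie_ideal I -> I = 0%VS \/ I = fullv.

Definition lie_prod U M : {vspace L} :=
  <<[seq lie x y | x <- vbasis U, y <- vbasis M]>>%VS.

Definition lower_central U n : {vspace L} := iter n (lie_prod U) U.

Definition lie_nilpotent U := exists n, lower_central U n = 0%VS.

Definition cartan_subalgebra U :=
  [/\ subalgebra U, lie_nilpotent U &
      forall x, (forall h, h \in U -> lie x h \in U) -> x \in U].

Definition maximal_subalgebra M :=
  [/\ subalgebra M, M <> fullv &
      forall U, subalgebra U -> (M <= U)%VS -> U = M \/ U = fullv].

Definition supplement M U := subalgebra U /\ fullv = (M + U)%VS.

Definition has_abelian_supplement M :=
  exists U, supplement M U /\ lie_abelian U.

Definition lfun_trace (f : 'End(L)) : F :=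
  \sum_(i < \dim {:L}) coord (vbasis {:L}) i (f (vbasis {:L})`_i).

Definition killing x y : F := lfun_trace (ad x \o ad y)%VF.

Lemma lfun_trace_linear : linear (lfun_trace : 'End(L) -> F^o).
Proof.
move=> a f g; rewrite /lfun_trace scaler_sumr -big_split /=.
by apply: eq_bigr => i _; rewrite add_lfunE scale_lfunE linearD linearZ.
Qed.

Lemma killing_linearr x : linear (killing x : L -> F^o).
Proof.
move=> a y z.
by rewrite /killing linearD linearZ comp_lfunDr -comp_lfunZr lfun_trace_linear.
Qed.

Lemma killing_linearl y : linear (killing^~ y : L -> F^o).
Proof.
move=> a x z.
by rewrite /killing linearD linearZ comp_lfunDl -comp_lfunZl lfun_trace_linear.
Qed.

End LieAlgebra.

Section Roots.

Variables (F : fieldType) (L : lieAlgType F) (H : {vspace L}).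

Definition dual := 'Hom(subvs_of H, F^o).

Implicit Types (a b : dual) (Gamma Sigma : {fset dual}).

(* By linearity the condition ad h v = a h *: v is imposed on a basis of H
   only; see weight_spaceP. *)
Definition weight_space a : {vspace L} :=
  (\bigcap_(i < \dim {: subvs_of H})
     let h := (vbasis {: subvs_of H})`_i in
     lker (ad (vsval h) - (a h : F) *: \1%VF))%VS.

Lemma weight_spaceP a (v : L) :
  (v \in weight_space a) <->
  (forall h : subvs_of H, lie (vsval h) v = (a h : F) *: v).
Proof.
have kerE h : (v \in lker (ad (vsval h) - (a h : F) *: \1%VF)) =
    (lie (vsval h) v == (a h : F) *: v).
  by rewrite memv_ker add_lfunE opp_lfunE scale_lfunE id_lfunE adE subr_eq0.
split=> [va h | va].
  rewrite (coord_vbasis (memvf h)) -adE !linear_sum sum_lfunE scaler_suml.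
  apply: eq_bigr => i _; rewrite !linearZ scale_lfunE adE -scalerA.
  congr (_ *: _); apply/eqP; rewrite -kerE.
  by move: va; rewrite memvE => /subv_bigcapP/(_ i isT); rewrite memvE.
rewrite memvE; apply/subv_bigcapP => i _.
by rewrite -memvE kerE va.
Qed.

Definition is_root a := a <> 0 /\ weight_space a <> 0%VS.

Definition root_system Gamma := forall a, a \in Gamma <-> is_root a.

Definition nat_comb Sigma a :=
  exists m : dual -> nat, a = \sum_(s <- Sigma) s *+ m s.

Definition int_comb Sigma a :=
  exists m : dual -> int, a = \sum_(s <- Sigma) s *~ m s.

Definition simple_system Gamma Sigma :=
  [/\ {subset Sigma <= Gamma}, free Sigma &
      forall a, a \in Gamma -> nat_comb Sigma a \/ nat_comb Sigma (- a)].

Section Parabolic.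

Variables (Gamma Sigma Sigma1 : {fset dual}).
Local Open Scope fset_scope.

Definition positive_roots : {fset dual} :=
  [fset a in Gamma | `[< nat_comb Sigma a >]].

Definition Delta1 : {fset dual} :=
  [fset a in Gamma | `[< int_comb (Sigma `\` Sigma1) a >]].

Definition Delta2_pos : {fset dual} := (Gamma `\` Delta1) `&` positive_roots.

Definition standard_parabolic : {vspace L} :=
  (H + \sum_(a <- Delta1) weight_space a
     + \sum_(a <- Delta2_pos) weight_space a)%VS.

End Parabolic.

Definition killing_dual : 'Hom(subvs_of H, dual) :=
  linfun (fun h : subvs_of H =>
    linfun (fun k : subvs_of H => killing (vsval h) (vsval k) : F^o) : dual).

Lemma killing_dualE (h k : subvs_of H) :
  killing_dual h k = killing (vsval h) (vsval k).
Proof.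
pose f (h : subvs_of H) (k : subvs_of H) : F^o := killing (vsval h) (vsval k).
have f_lin h1 : linear (f h1).
  by move=> a x y; rewrite /f linearP killing_linearr.
pose fM h1 := HB.pack_for {linear subvs_of H -> F^o} (f h1)
  (GRing.isLinear.Build F (subvs_of H) F^o *:%R (f h1) (f_lin h1)).
have fE h1 k1 : linfun (f h1) k1 = f h1 k1 by rewrite (lfunE (fM h1)).
pose g (h : subvs_of H) : dual := linfun (f h).
have g_lin : linear g.
  move=> a x y; apply/lfunP => z.
  by rewrite add_lfunE scale_lfunE !fE /f linearP killing_linearl.
pose gM := HB.pack_for {linear subvs_of H -> dual} g
  (GRing.isLinear.Build F (subvs_of H) dual *:%R g g_lin).
by rewrite /killing_dual (lfunE gM) /= fE.
Qed.

(* For H a Cartan subalgebra of a semisimple L in characteristic 0 the map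
   killing_dual is bijective, so this is the usual element t_a of H with
   killing (t_a) k = a k for k in H. *)
Definition root_vec a : L := vsval ((killing_dual^-1)%VF a).

Definition root_form a b : F := killing (root_vec a) (root_vec b).

Definition cartan_number a b : F := (root_form a b *+ 2) / root_form b b.

End Roots.

(* Type_E is meant for ranks 6 to 8. *)
Variant dynkin_type :=
  Type_A of nat | Type_B of nat | Type_C of nat | Type_D of nat | Type_E of nat.

Definition dynkin_rank (X : dynkin_type) : nat :=
  match X with
  | Type_A n | Type_B n | Type_C n | Type_D n | Type_E n => n
  end.

(* Vertices are 1, ..., dynkin_rank X, as in Bourbaki; each bond i - j is listed
   once, with i < j. *)
Definition bond (X : dynkin_type) (i j : nat) : bool :=
  match X with
  | Type_A _ | Type_B _ | Type_C _ => j == i.+1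
  | Type_D n => (j == i.+1) && (j < n)%N || (j == i.+2) && (j == n)
  | Type_E _ => [|| (i == 1%N) && (j == 3%N), (i == 2%N) && (j == 4%N) |
                    (3 <= i)%N && (j == i.+1)]
  end.

(* The bond i - j is double, and the i-th simple root is the longer one. *)
Definition arrow (X : dynkin_type) (i j : nat) : bool :=
  match X with
  | Type_B n => (i.+1 == n) && (j == n)
  | Type_C n => (i == n) && (j.+1 == n)
  | _ => false
  end.

Definition cartan_matrix (X : dynkin_type) (i j : nat) : int :=
  if i == j then 2
  else if bond X i j || bond X j i then (if arrow X i j then - 2 else - 1)
  else 0.

(* alpha 1, ..., alpha (dynkin_rank X) are the simple roots, without repetition, and
   their Dynkin diagram, encoded by the Cartan integers
   2 (alpha i, alpha j) / (alpha j, alpha j), is the one of type X. *)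
Definition bourbaki_numbering (F : fieldType) (L : lieAlgType F)
    (H : {vspace L}) (Sigma : {fset dual H}) (X : dynkin_type)
    (alpha : nat -> dual H) : Prop :=
  perm_eq [seq alpha i | i <- iota 1 (dynkin_rank X)] Sigma /\
  forall i j, (0 < i <= dynkin_rank X)%N -> (0 < j <= dynkin_rank X)%N ->
    cartan_number (alpha i) (alpha j) = (cartan_matrix X i j)%:~R.

(* L is of type X, in the sense that its Dynkin diagram is that of X, and
   Sigma1 consists of the i-th simple root in the Bourbaki numbering. *)
Definition type_and_node (F : fieldType) (L : lieAlgType F)
    (H : {vspace L}) (Sigma Sigma1 : {fset dual H}) (X : dynkin_type)
    (i : nat) : Prop :=
  exists alpha : nat -> dual H,
    bourbaki_numbering Sigma X alpha /\ Sigma1 = [fset alpha i]%fset.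

(* Main.v *)
(* Fix a simple root alpha_i and grade L by the coefficient of alpha_i, so that P is
   the non-negative part.

   If U is an abelian supplement and e_a, e_b are root vectors of negative degree, then
   e_a = p + u and e_b = q + v with p, q in P and u, v in U; since [u, v] = 0, the
   bracket [e_a, e_b] lies in degrees above its own, hence vanishes. So the negative part
   is abelian, which forces every root to have coefficient at most 1 at alpha_i (a root
   of least height with a larger coefficient is the sum of alpha_i and a root).
   Conversely, if all these coefficients are at most 1, the negative part is an abelian
   supplement. The structure of the root system is obtained from the Killing form by
   trace computations on root strings: a commutator [e, f] has trace 0 on every subspace
   stable under e and f.

   It remains to find the nodes of Dynkin diagrams at which all roots have coefficient at
   most 1. Equivalently, all Weyl conjugates of the fundamental coweight of alpha_i take
   only the values -1, 0, 1 on the simple roots. For the listed nodes the orbit is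
   exhibited. For the converse one plays the numbers game: firing node i of a diagram
   starts the same game in each component of the diagram without i, so the
   possible diagrams are found by induction on the number of nodes, the excluded ones by
   a firing sequence that produces a value greater than 1. *)

Require Import Defs.
From HB Require Import structures.
From mathcomp Require Import all_boot all_order all_algebra.
From mathcomp Require Import finmap boolp.
From mathcomp Require Import zify ring lra.

Set Implicit Arguments.
Unset Strict Implicit.
Unset Printing Implicit Defensive.

Import Order.TTheory GRing.Theory Num.Theory.
Local Open Scope ring_scope.

(** * Linear algebra *)

(** A Cartan subalgebra is only known to be nilpotent and self-normalizing, so at first nothing acts
    diagonally. The weight theory starts with generalized weight spaces [gw]; non-degeneracy of the
    Killing form, commutativity of [H] and one-dimensionality of the root spaces come before [gw]
    can be replaced by [weight_space]. An inner product makes no sense over [F]; its positivity is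
    replaced by sums of squares of integers, which are non-zero in characteristic zero.

    In the numbers game, once the root vertex has been fired, each component of the rest holds 1
    next to the root and 0 elsewhere: a new start of the game. What may be attached above a
    component depends on whether its game can fire its own root twice. If so, the vertex above rises
    by 2, which leaves no room for a multiple bond or a second branch. Only a chain entered at its
    end escapes; this is how interior nodes of A and the last node of C arise. The bound also
    excludes cycles, triple bonds and three branches at the root, so no classification of Dynkin
    diagrams is presupposed. *)

Section LinearAlgebra.

Variables (F : fieldType) (V : vectType F).
Implicit Types (f g : 'End(V)) (U W B : {vspace V}).

(** A subspace of largest dimension inside [P] contains every [x] with [P x], since otherwise the
    line of [x] would enlarge it. *)
Lemma vspace_of_pred (P : V -> Prop) :
  P 0 -> (forall a x y, P x -> P y -> P (a *: x + y)) ->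
  exists U : {vspace V}, forall x, (x \in U) <-> P x.
Proof.
move=> P0 PD.
pose Q n := `[< exists U : {vspace V}, \dim U = n /\ forall x, x \in U -> P x >].
have exQ : exists n, Q n.
  exists 0%N; apply/asboolP; exists 0%VS; rewrite dimv0; split=> // x.
  by rewrite memv0 => /eqP->.
have ubQ n : Q n -> (n <= \dim {:V})%N.
  by move=> /asboolP[U [<- _]]; apply: dimvS; apply: subvf.
case: (ex_maxnP exQ ubQ) => n /asboolP[U [dU PU]] nmax.
exists U => x; split; first exact: PU.
move=> Px; apply: contrapT => xU.
have /nmax : Q (\dim (U + <[x]>)%VS).
  apply/asboolP; exists (U + <[x]>)%VS; split=> // y.
  move=> /memv_addP[u uU [z /vlineP[a ->] ->]].
  by rewrite addrC; apply: PD => //; apply: PU.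
rewrite -dU leqNgt => /negP; apply.
rewrite (ltn_leqif (dimv_leqif_sup (addvSl _ _))).
by rewrite subv_add subvv /= -memvE; apply/negP.
Qed.

Definition nilp_at f x := exists N, iter N f x = 0.

Lemma shiftE f a x : (f - a *: \1%VF) x = f x - a *: x.
Proof. by rewrite add_lfunE opp_lfunE scale_lfunE id_lfunE. Qed.

Lemma iter_linear f N a x y :
  iter N f (a *: x + y) = a *: iter N f x + iter N f y.
Proof. by elim: N => //= N ->; rewrite linearP. Qed.

Lemma iter_lin0 f N : iter N f 0 = 0.
Proof. by elim: N => //= N ->; rewrite linear0. Qed.

Lemma iter_stable f U N x :
  (forall u, u \in U -> f u \in U) -> x \in U -> iter N f x \in U.
Proof. by move=> fU xU; elim: N => //= N; apply: fU. Qed.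

Lemma iter_eq0_leq f N M x : (N <= M)%N -> iter N f x = 0 -> iter M f x = 0.
Proof. by move=> /subnK <- e; rewrite iterD e iter_lin0. Qed.

Lemma nilp_at0 f : nilp_at f 0.
Proof. by exists 0%N. Qed.

Lemma nilp_atP f a x y : nilp_at f x -> nilp_at f y -> nilp_at f (a *: x + y).
Proof.
move=> [N xN] [M yM]; exists (maxn N M); rewrite iter_linear.
rewrite (iter_eq0_leq (leq_maxl _ _) xN) (iter_eq0_leq (leq_maxr _ _) yM).
by rewrite scaler0 addr0.
Qed.

(** The generalized eigenspace of [f] for the eigenvalue [a]. *)
Definition gker f a : {vspace V} := projT1 (cid (@vspace_of_pred
  (nilp_at (f - a *: \1%VF)) (nilp_at0 _) (@nilp_atP _))).

Lemma gkerP f a x : (x \in gker f a) <-> nilp_at (f - a *: \1%VF) x.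
Proof. by rewrite /gker; case: (cid _) => U /=. Qed.

Lemma nilp_at_unif f U : (forall x, x \in U -> nilp_at f x) ->
  exists N, forall x, x \in U -> iter N f x = 0.
Proof.
move=> nU.
have /choice[K KP] (i : 'I_(\dim U)) : exists N, iter N f (vbasis U)`_i = 0.
  by apply: nU; apply: vbasis_mem; rewrite mem_nth // size_tuple.
exists (\max_i K i)%N => x xU; rewrite (coord_vbasis xU).
have : forall i, (K i <= \max_i K i)%N by move=> i; apply: leq_bigmax.
move: (\max_i K i)%N => M leM.
elim/big_ind: _ => [|y z ey ez|i _]; first exact: iter_lin0.
  by rewrite -[y]scale1r iter_linear ey ez scaler0 addr0.
rewrite -[_ *: _]addr0 iter_linear (iter_eq0_leq (leM i) (KP i)).
by rewrite iter_lin0 scaler0 addr0.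
Qed.

(** The images of [U] under the powers of [f] decrease, hence become constant at some [W]. As [f]
    maps [W] onto itself, the [n]-th iterate of [u] is also that of some [w] in [W], and [u - w] is
    killed. *)
Lemma fitting f U : (forall u, u \in U -> f u \in U) ->
  exists W : {vspace V}, [/\ (W <= U)%VS, (f @: W = W)%VS &
    forall u, u \in U -> exists2 w, w \in W & nilp_at f (u - w)].
Proof.
move=> fU.
pose UU n := iter n (fun W => (f @: W)%VS) U.
have UUS n : (UU n.+1 <= UU n)%VS.
  elim: n => [|n IH] /=; last exact: limgS.
  by apply/subvP => _ /memv_imgP[u uU ->]; apply: fU.
have [n en] : exists n, UU n.+1 = UU n.
  apply: contrapT => nen.
  have lt n : (\dim (UU n) + n <= \dim U)%N.
    elim: n => [|n IH]; first by rewrite addn0.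
    apply: leq_trans IH; rewrite addnS -addSn leq_add2r.
    rewrite (ltn_leqif (dimv_leqif_eq (UUS n))).
    by apply/eqP => e; apply: nen; exists n.
  by move: (lt (\dim U).+1); rewrite addnS ltnNge leq_addl.
have itU k u : u \in U -> iter k f u \in UU k.
  by move=> uU; elim: k => //= k IH; apply: memv_img.
have leU m : (UU m <= U)%VS by elim: m => [|m IH] //; apply: subv_trans (UUS m) IH.
exists (UU n); split=> //.
have surj k w : w \in UU n -> exists2 w', w' \in UU n & iter k f w' = w.
  elim: k w => [|k IH] w; first by exists w.
  rewrite -{1}en => /memv_imgP[w1 /IH[w2 w2U <-] ->].
  by exists w2.
move=> u uU; have [w wU ew] := surj n _ (itU n u uU).
exists w => //; exists n.
by rewrite addrC -scaleN1r iter_linear ew scaleN1r addNr.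
Qed.

Lemma surj_inj f U x : (f @: U = U)%VS -> x \in U -> f x = 0 -> x = 0.
Proof.
move=> fU xU fx; have := limg_ker_dim f U; rewrite fU => /eqP.
rewrite -[X in _ == X]add0n eqn_add2r dimv_eq0 => /eqP e0.
by apply/eqP; rewrite -memv0 -e0 memv_cap xU memv_ker fx eqxx.
Qed.

(* Working modulo a subspace [B] covers both simultaneous eigenvectors
   ([B = 0]) and Engel's theorem ([B] a Cartan subalgebra). *)
Lemma commuting_null (fs : seq 'End(V)) U B :
  (forall f, f \in fs -> forall u, u \in U -> f u \in U) ->
  (forall f, f \in fs -> forall u, u \in B -> f u \in B) ->
  (forall f g, f \in fs -> g \in fs -> forall u, u \in U -> f (g u) - g (f u) \in B) ->
  (forall f, f \in fs -> forall u, u \in U -> exists N, iter N f u \in B) ->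
  ~ (U <= B)%VS ->
  exists y, [/\ y \in U, y \notin B & forall f, f \in fs -> f y \in B].
Proof.
move=> fU fB fC fN nUB.
suff [y [yU yB yf]] : exists y, [/\ y \in U, y \notin B &
    forall f, f \in take (size fs) fs -> f y \in B].
  by exists y; split=> // f; rewrite -{1}(take_size fs); apply: yf.
elim: (size fs) => [|n [y [yU yB IH]]].
  have [y yU yB] : exists2 y, y \in U & y \notin B.
    apply: contrapT => ne; apply: nUB; apply/subvP => y yU.
    by apply: contrapT => /negP yB; apply: ne; exists y.
  by exists y; split=> // f; rewrite take0.
have [lt|ge] := ltnP n (size fs); last first.
  by exists y; split=> // f; rewrite take_oversize ?(leq_trans ge) // => ffs; apply: IH; rewrite take_oversize.
pose f := nth 0 fs n; have ffs : f \in fs by rewrite mem_nth.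
(* The last iterate of [y] under [f] outside [B] is sent into [B] by [f], and still by the earlier
   operators, which commute with [f] modulo [B]. *)
have [N NP Nmin] : exists2 N, iter N f y \in B &
    forall M, iter M f y \in B -> (N <= M)%N.
  have [N yN] := fN _ ffs _ yU.
  have ex : exists N, iter N f y \in B by exists N.
  by case: (ex_minnP ex) => N' h1 h2; exists N'.
case: N NP Nmin => [|N] NP Nmin; first by rewrite (negbTE yB) in NP.
have itU M : iter M f y \in U by apply: iter_stable yU => u; apply: fU.
exists (iter N f y); split=> //.
  by apply/negP => /Nmin; rewrite ltnn.
have itg M g : g \in take n fs -> g (iter M f y) \in B.
  move=> gt; have gfs := mem_take gt; elim: M => [|M IHM] /=; first exact: IH.
  rewrite -(subrK (f (g (iter M f y))) (g _)) rpredD //; first exact: fC.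
  exact: fB.
move=> g; rewrite (take_nth 0 lt) mem_rcons inE => /orP[/eqP->//|gt].
exact: itg.
Qed.

(** The coordinates of a vector outside [W] carry no meaning but are linear in it. So [tr U f] is
    always linear in [f], and it is the trace of [f] on [U] when [U] is stable. Vectors are rows,
    hence the order of the product in [mat_comp]. *)
Definition mat U W f : 'M[F]_(\dim U, \dim W) :=
  \matrix_(i, j) coord (vbasis W) j (f (vbasis U)`_i).

Definition tr U f : F := \tr (mat U U f).

Lemma trE f : tr fullv f = \sum_(i < \dim {:V}) coord (vbasis {:V}) i (f (vbasis {:V})`_i).
Proof. by apply: eq_bigr => i _; rewrite mxE. Qed.

Lemma vbasis_in U (i : 'I_(\dim U)) : (vbasis U)`_i \in U.
Proof. by apply: vbasis_mem; rewrite mem_nth // size_tuple. Qed.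

Lemma mat_comp U W X f g : (forall u, u \in U -> f u \in W) ->
  mat U X (g \o f)%VF = mat U W f *m mat W X g.
Proof.
move=> fUW; apply/matrixP => i k; rewrite !mxE comp_lfunE.
rewrite {1}(coord_vbasis (fUW _ (vbasis_in i))) !linear_sum.
by apply: eq_bigr => j _; rewrite !mxE !linearZ.
Qed.

(** Two subspaces are allowed so that [tr_sub] becomes the case of a map from [U] to [W] and the
    inclusion of [W] in [U]. *)
Lemma tr_cyc U W f g : (forall u, u \in U -> f u \in W) ->
  (forall w, w \in W -> g w \in U) -> tr U (g \o f)%VF = tr W (f \o g)%VF.
Proof.
move=> fU gW; rewrite /tr (mat_comp _ _ fU) (mat_comp _ _ gW).
exact: mxtrace_mulC.
Qed.

Lemma eq_tr U f g : (forall u, u \in U -> f u = g u) -> tr U f = tr U g.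
Proof.
move=> e; congr (\tr _); apply/matrixP => i j.
by rewrite !mxE e // vbasis_in.
Qed.

Lemma tr_linear U : linear (tr U : 'End(V) -> F^o).
Proof.
move=> a f g; rewrite /tr /mxtrace scaler_sumr -big_split /=.
apply: eq_bigr => i _; rewrite !mxE add_lfunE scale_lfunE linearD linearZ.
by [].
Qed.

Lemma trD U f g : tr U (f + g) = tr U f + tr U g.
Proof. by rewrite -[f]scale1r tr_linear !scale1r. Qed.

Lemma tr0 U : tr U 0 = 0.
Proof. by have := tr_linear U (-1) 0 0; rewrite scaler0 addr0 scaleN1r addNr. Qed.

Lemma trZ U a f : tr U (a *: f) = a * tr U f.
Proof.
by rewrite -[a *: f]addr0 tr_linear tr0 addr0.
Qed.

Lemma trB U f g : tr U (f - g) = tr U f - tr U g.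
Proof. by rewrite trD -scaleN1r trZ mulN1r. Qed.

Lemma tr_id U : tr U \1%VF = (\dim U)%:R.
Proof.
rewrite /tr (_ : mat _ _ _ = 1%:M) ?mxtrace1 //; apply/matrixP => i j.
rewrite !mxE id_lfunE coord_free; first by rewrite eq_sym.
exact: (basis_free (vbasisP U)).
Qed.

Lemma tr_sub U W f : (W <= U)%VS -> (forall u, u \in U -> f u \in W) ->
  tr U f = tr W f.
Proof.
move=> /subvP WU fU; rewrite -[X in tr U X]comp_lfun1l -[X in tr W X]comp_lfun1r.
by apply: tr_cyc => // w wW; rewrite id_lfunE WU.
Qed.

Lemma tr_add U W f : (U :&: W = 0)%VS -> (forall u, u \in U -> f u \in U) ->
  (forall u, u \in W -> f u \in W) -> tr (U + W)%VS f = tr U f + tr W f.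
Proof.
move=> d fU fW.
pose p := daddv_pi U W; pose q := daddv_pi W U.
have d' : (W :&: U = 0)%VS by rewrite capvC.
have -> : tr (U + W)%VS f = tr (U + W)%VS (f \o p)%VF + tr (U + W)%VS (f \o q)%VF.
  rewrite -trD; apply: eq_tr => u uUW.
  by rewrite add_lfunE !comp_lfunE -linearD /p /q daddv_pi_add.
congr (_ + _).
  rewrite (@tr_sub (U + W)%VS U) ?addvSl //; last first.
    by move=> u _; rewrite comp_lfunE fU // memv_pi.
  by apply: eq_tr => u uU; rewrite comp_lfunE daddv_pi_id.
rewrite (@tr_sub (U + W)%VS W) ?addvSr //; last first.
  by move=> u _; rewrite comp_lfunE fW // memv_pi.
by apply: eq_tr => u uU; rewrite comp_lfunE daddv_pi_id.
Qed.

Lemma tr_comm U f g : (forall u, u \in U -> f u \in U) ->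
  (forall u, u \in U -> g u \in U) -> tr U ((f \o g)%VF - (g \o f)%VF) = 0.
Proof. by move=> fU gU; rewrite trB (tr_cyc gU fU) subrr. Qed.

(** The trace on [U] equals the trace on the image of [U], so induction on the dimension applies
    unless [f] maps [U] onto itself. In that case [f] is injective and nilpotent on [U], which
    forces [U = 0]. *)
Lemma tr_nilp U f : (forall u, u \in U -> f u \in U) ->
  (forall u, u \in U -> nilp_at f u) -> tr U f = 0.
Proof.
have [n] := ubnP (\dim U); elim: n U => // n IH U ltU fU nU.
have fUU : (f @: U <= U)%VS by apply/subvP => _ /memv_imgP[u uU ->]; apply: fU.
have ffU u : u \in U -> f u \in (f @: U)%VS by apply: memv_img.
rewrite (tr_sub fUU ffU).
have [e|ne] := eqVneq (f @: U)%VS U; last first.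
  apply: IH => [|u /(subvP fUU) uU|u /(subvP fUU)]; [|exact: ffU|exact: nU].
  apply: (@leq_trans (\dim U)); last by [].
  by rewrite (ltn_leqif (dimv_leqif_eq fUU)).
have [N NU] := nilp_at_unif nU.
suff -> : (f @: U = 0)%VS.
  by rewrite (@eq_tr 0%VS f 0) ?tr0 // => u; rewrite memv0 => /eqP->; rewrite !linear0.
rewrite e; apply/eqP; rewrite -subv0; apply/subvP => u uU.
elim: N NU => [|N IHN] NU; first by rewrite memv0 -(NU u uU).
apply: IHN => w wU; apply: (surj_inj e); last exact: (NU w wU).
exact: iter_stable.
Qed.

Lemma tr_nilp_shift U f a : (forall u, u \in U -> f u \in U) ->
  (forall u, u \in U -> nilp_at (f - a *: \1%VF) u) -> tr U f = (\dim U)%:R * a.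
Proof.
move=> fU nU; rewrite -[f](subrK (a *: \1%VF)) trD tr_nilp //.
  by rewrite add0r trZ tr_id mulrC.
by move=> u uU; rewrite shiftE rpredB ?rpredZ ?fU.
Qed.

Lemma iter_comm (f g : V -> V) N x : (forall x, f (g x) = g (f x)) ->
  iter N (fun y => f (g y)) x = iter N f (iter N g x).
Proof.
move=> fg; elim: N => //= N ->.
by congr (f _); elim: N (iter N g x) => //= N IH y; rewrite -fg IH.
Qed.

(** The difference of squares factors as [(f + a) (f - a)] with commuting factors. *)
Lemma nilp_sqr f a u : nilp_at (f - a *: \1%VF) u ->
  nilp_at ((f \o f)%VF - (a * a) *: \1%VF) u.
Proof.
move=> [N eN]; exists N.
pose g : V -> V := f + a *: \1%VF; pose h : V -> V := f - a *: \1%VF.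
have gh x : g (h x) = ((f \o f)%VF - (a * a) *: \1%VF) x.
  rewrite /g /h !shiftE add_lfunE scale_lfunE id_lfunE comp_lfunE.
  by rewrite linearB linearZ /= scalerBr scalerA addrA subrK.
have hg x : g (h x) = h (g x).
  rewrite gh /g /h !shiftE add_lfunE scale_lfunE id_lfunE comp_lfunE.
  have -> : f (f x + a *: x) = f (f x) + a *: f x by rewrite linearD linearZ.
  by rewrite scalerDr scalerA opprD addrA addrK.
rewrite -(eq_iter gh) iter_comm // eN.
by elim: (N) => //= M ->; rewrite /g linear0.
Qed.

Lemma nilp_shift_eigen f a b u N : f u = b *: u ->
  iter N (f - a *: \1%VF) u = (b - a) ^+ N *: u.
Proof.
move=> fu; elim: N => [|N IH]; first by rewrite expr0 scale1r.
rewrite iterS IH linearZ /= shiftE fu -scalerBl.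
by rewrite scalerA -exprSr.
Qed.

(** The last non-zero iterate of [u] under [f - a] is an eigenvector for [a] on which [f - b] is
    still nilpotent, so a power of [b - a] vanishes. *)
Lemma nilp_shift_inj f a b u : nilp_at (f - a *: \1%VF) u ->
  nilp_at (f - b *: \1%VF) u -> u != 0 -> a = b.
Proof.
move=> [N aN] [M bM] u0; apply: contrapT => /eqP ab.
have {N aN} [v [v0 fv [K vK]]] : exists v, [/\ v != 0, f v = a *: v &
    nilp_at (f - b *: \1%VF) v].
  elim: N u u0 M bM aN => [|N IH] u u0 M bM; first by move=> /eqP; rewrite (negbTE u0).
  have [e _|ne] := eqVneq ((f - a *: \1%VF) u) 0.
    exists u; split=> //; last by exists M.
    by apply/eqP; rewrite -subr_eq0 -e shiftE.
  rewrite iterSr; apply: (IH _ ne M).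
  have com x : (f - b *: \1%VF) ((f - a *: \1%VF) x) = (f - a *: \1%VF) ((f - b *: \1%VF) x).
    rewrite !shiftE.
    have -> : f (f x - a *: x) = f (f x) - a *: f x by rewrite linearB linearZ.
    have -> : f (f x - b *: x) = f (f x) - b *: f x by rewrite linearB linearZ.
    rewrite !scalerBr !scalerA [b * a]mulrC !opprB !addrA.
    by rewrite addrAC [RHS]addrAC -!addrA; congr (_ + _); rewrite addrCA.
  have -> : iter M (f - b *: \1%VF) ((f - a *: \1%VF) u) = (f - a *: \1%VF) (iter M (f - b *: \1%VF) u).
    by elim: (M) => //= K ->; rewrite com.
  by rewrite bM linear0.
move: vK; rewrite (nilp_shift_eigen _ _ fv) => /eqP.
by rewrite scaler_eq0 (negbTE v0) orbF expf_eq0 subr_eq0 (negbTE ab) andbF.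
Qed.

Lemma memv_seq_sum (I : eqType) (r : seq I) (A : I -> {vspace V}) (v : V) :
  uniq r -> v \in (\sum_(i <- r) A i)%VS ->
  exists2 c : I -> V, forall i, c i \in A i & v = \sum_(i <- r) c i.
Proof.
elim: r v => [|j r IH] v /=.
  by rewrite big_nil memv0 => _ /eqP->; exists (fun=> 0); rewrite ?big_nil // => i; apply: mem0v.
move=> /andP[jr ur]; rewrite big_cons => /memv_addP[x xA [y /(IH _ ur)[c cA ->] ->]].
exists (fun i => if i == j then x else c i) => [i|]; first by case: eqP => [->|].
rewrite big_cons eqxx; congr (_ + _); rewrite !big_seq; apply: eq_bigr => i ir.
by case: eqP => // eij; rewrite -eij ir in jr.
Qed.

Lemma seq_sum_sup (I : eqType) (r : seq I) (A : I -> {vspace V}) i :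
  i \in r -> (A i <= \sum_(i <- r) A i)%VS.
Proof.
elim: r => // j r IH; rewrite inE big_cons => /orP[/eqP->|/IH h].
  exact: addvSl.
exact: subv_trans h (addvSr _ _).
Qed.

Lemma seq_sum_subP (I : eqType) (r : seq I) (A : I -> {vspace V}) U :
  (forall i, i \in r -> (A i <= U)%VS) -> (\sum_(i <- r) A i <= U)%VS.
Proof.
move=> AU; rewrite big_seq; elim/big_ind: _ => [|B C BU CU|i]; first exact: sub0v.
  by rewrite subv_add BU.
exact: AU.
Qed.

Lemma mem_seq_sum (I : eqType) (r : seq I) (A : I -> {vspace V}) (c : I -> V) :
  (forall i, i \in r -> c i \in A i) -> \sum_(i <- r) c i \in (\sum_(i <- r) A i)%VS.
Proof.
move=> cA; rewrite [X in X \in _]big_seq; apply: rpred_sum => i ir.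
exact: (subvP (seq_sum_sup A ir) _ (cA i ir)).
Qed.

End LinearAlgebra.

(** * Eigenvectors and primary decomposition over a closed field *)

Section Eigen.

Variables (F : closedFieldType) (V : vectType F).
Implicit Types (f : 'End(V)) (U : {vspace V}).

Lemma eigenvector f U : (forall u, u \in U -> f u \in U) -> U <> 0%VS ->
  exists a v, [/\ v \in U, v != 0 & f v = a *: v].
Proof.
move=> fU U0.
have [a ra] : exists a, root (char_poly (mat U U f)) a.
  by apply/closed_rootP; rewrite size_char_poly eqSS dimv_eq0; apply/eqP.
move: ra; rewrite -eigenvalue_root_char => /eigenvalueP[v va v0].
exists a, (\sum_i v 0 i *: (vbasis U)`_i); split.
- by apply: rpred_sum => i _; apply/rpredZ/vbasis_in.
- apply: contraNneq v0 => e0; apply/eqP/rowP => i; rewrite mxE.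
  by have /freeP/(_ (v 0) e0 i) := basis_free (vbasisP U).
rewrite linear_sum scaler_sumr.
rewrite (eq_bigr (fun i => \sum_j (v 0 i * mat U U f i j) *: (vbasis U)`_j)); last first.
  move=> i _; rewrite linearZ /= {1}(coord_vbasis (fU _ (vbasis_in i))) scaler_sumr.
  by apply: eq_bigr => j _; rewrite mxE scalerA.
rewrite exchange_big; apply: eq_bigr => j _ /=.
rewrite -scaler_suml scalerA; congr (_ *: _).
have := congr1 (fun m : 'rV_ _ => m 0 j) va; by rewrite !mxE.
Qed.

(** Apply [fitting] to [f - a] for an eigenvalue [a]. The remaining [W] is smaller than [U], because
    [f - a] is injective on [W] but kills an eigenvector of [U]. *)
Lemma primary_dec f U : (forall u, u \in U -> f u \in U) ->
  exists s : seq F, (U <= \sum_(a <- s) (U :&: gker f a))%VS.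
Proof.
have [n] := ubnP (\dim U); elim: n U => // n IH U ltU fU.
have [->|/eqP U0] := eqVneq U 0%VS; first by exists [::]; apply: sub0v.
have [a [v [vU v0 fv]]] := eigenvector fU U0.
have gU u : u \in U -> (f - a *: \1%VF) u \in U.
  by move=> uU; rewrite shiftE rpredB ?rpredZ ?fU.
have [W [WU gW dec]] := fitting gU.
have ltW : (\dim W < n)%N.
  apply: (@leq_trans (\dim U)); last by [].
  rewrite (ltn_leqif (dimv_leqif_eq WU)).
  apply/eqP => e; move: v0; rewrite -e in vU; rewrite (surj_inj gW vU) ?eqxx //.
  by rewrite shiftE fv subrr.
have fW u : u \in W -> f u \in W.
  move=> uW; rewrite -[f u](subrK (a *: u)) rpredD ?rpredZ //.
  by rewrite -shiftE -gW memv_img.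
have [s sP] := IH W ltW fW.
exists (a :: s); rewrite big_cons; apply/subvP => u uU.
have [w wW uw] := dec u uU; rewrite -[u](subrK w) memv_add //.
  by rewrite memv_cap; apply/andP; split; [rewrite rpredB // (subvP WU) | apply/gkerP].
have /subvP : (\sum_(a <- s) (W :&: gker f a) <= \sum_(a <- s) (U :&: gker f a))%VS.
  by elim/big_ind2: _ => [|A B C D /addvS h /h|i _] //; apply: capvS.
by apply; apply: (subvP sP).
Qed.

End Eigen.

(** * Generalized weight spaces of a Cartan subalgebra *)

Section LieBasics.

Variables (F : fieldType) (L : lieAlgType F).
Implicit Types (x y z h : L) (U M W : {vspace L}).

Lemma lieDl x y z : lie (x + y) z = lie x z + lie y z.
Proof. by rewrite -[x]scale1r lie_linearl !scale1r. Qed.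

Lemma lieDr x y z : lie z (x + y) = lie z x + lie z y.
Proof. by rewrite -[x]scale1r lie_linearr !scale1r. Qed.

Lemma lie0r x : lie x 0 = 0.
Proof. by rewrite -adE linear0. Qed.

Lemma lieC x y : lie x y = - lie y x.
Proof.
apply/eqP; rewrite -addr_eq0; apply/eqP.
by have := liexx (x + y); rewrite lieDl !lieDr !liexx add0r addr0.
Qed.

Lemma lie0l x : lie 0 x = 0.
Proof. by rewrite lieC lie0r oppr0. Qed.

Lemma lieZl a x y : lie (a *: x) y = a *: lie x y.
Proof. by rewrite -[a *: x]addr0 lie_linearl lie0l addr0. Qed.

Lemma lieZr a x y : lie x (a *: y) = a *: lie x y.
Proof. by rewrite -[a *: y]addr0 lie_linearr lie0r addr0. Qed.

Lemma lieNl x y : lie (- x) y = - lie x y.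
Proof. by rewrite -scaleN1r lieZl scaleN1r. Qed.

Lemma lieNr x y : lie x (- y) = - lie x y.
Proof. by rewrite -scaleN1r lieZr scaleN1r. Qed.

Lemma lie_der h x y : lie h (lie x y) = lie (lie h x) y + lie x (lie h y).
Proof.
have := lie_jacobi h x y => /eqP; rewrite -addrA addr_eq0 => /eqP->.
by rewrite opprD [lie (lie h x) y]lieC addrC [lie y h]lieC lieNr opprK.
Qed.

Lemma ad_lie x y : ad (lie x y) = (ad x \o ad y)%VF - (ad y \o ad x)%VF.
Proof.
apply/lfunP => z; rewrite add_lfunE opp_lfunE !comp_lfunE !adE.
by rewrite lie_der addrK.
Qed.

(** By the Leibniz rule [ad h - (a + b)] acts on the bracket through [ad h - a] on [x] and
    [ad h - b] on [y]. Each term lowers one exponent, whence the induction on their sum. *)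
Lemma nilp_lie h a b x y : nilp_at (ad h - a *: \1%VF) x ->
  nilp_at (ad h - b *: \1%VF) y -> nilp_at (ad h - (a + b) *: \1%VF) (lie x y).
Proof.
move=> [N xN] [M yM]; have [k] := ubnP (N + M).
elim: k N M x y xN yM => // k IH N M x y xN yM ltk.
case: N xN ltk => [|N] xN ltk; first by exists 0%N; rewrite /= (xN : x = 0) lie0l.
case: M yM ltk => [|M] yM ltk; first by exists 0%N; rewrite /= (yM : y = 0) lie0r.
have [K1 e1] : nilp_at (ad h - (a + b) *: \1%VF) (lie ((ad h - a *: \1%VF) x) y).
  by apply: (IH N M.+1); rewrite -?iterSr // addSn in ltk *.
have [K2 e2] : nilp_at (ad h - (a + b) *: \1%VF) (lie x ((ad h - b *: \1%VF) y)).
  by apply: (IH N.+1 M); rewrite -?iterSr // addnS in ltk *.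
exists (maxn K1 K2).+1; rewrite iterSr.
have -> : (ad h - (a + b) *: \1%VF) (lie x y) =
    1 *: lie ((ad h - a *: \1%VF) x) y + lie x ((ad h - b *: \1%VF) y).
  rewrite !shiftE !adE lie_der scale1r lieDl lieDr lieNl lieNr lieZl lieZr.
  by rewrite scalerDl opprD addrACA.
rewrite iter_linear (iter_eq0_leq (leq_maxl _ _) e1) (iter_eq0_leq (leq_maxr _ _) e2).
by rewrite scaler0 addr0.
Qed.

Lemma lie_prod_mem U M x y : x \in U -> y \in M -> lie x y \in lie_prod U M.
Proof.
move=> xU yM; rewrite (coord_vbasis yM) -adE linear_sum.
apply: rpred_sum => j _; rewrite linearZ /= rpredZ // adE lieC rpredN.
rewrite (coord_vbasis xU) -adE linear_sum; apply: rpred_sum => i _.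
rewrite linearZ /= rpredZ // adE lieC rpredN.
by apply/memv_span/allpairs_f; rewrite mem_nth // size_tuple.
Qed.

Lemma lie_prod_sub U M W : (forall x y, x \in U -> y \in M -> lie x y \in W) ->
  (lie_prod U M <= W)%VS.
Proof.
move=> h; apply/span_subvP => z /allpairsP[[x y] /= [xU yM ->]].
by apply: h; apply: vbasis_mem.
Qed.

Lemma killing_tr x y : killing x y = tr fullv (ad x \o ad y)%VF.
Proof. by rewrite trE. Qed.

Lemma killingC x y : killing x y = killing y x.
Proof. by rewrite !killing_tr; apply: tr_cyc => u _; rewrite memvf. Qed.

Lemma killing_inv x y z : killing (lie x y) z = killing x (lie y z).
Proof.
rewrite !killing_tr !ad_lie comp_lfunDl comp_lfunDr comp_lfunNl comp_lfunNr !trB.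
rewrite !comp_lfunA; congr (_ - _); rewrite -!comp_lfunA.
rewrite [X in _ = tr _ X]comp_lfunA.
by apply: tr_cyc => u _; rewrite memvf.
Qed.

Lemma killingDl x y z : killing (x + y) z = killing x z + killing y z.
Proof. by have := killing_linearl z 1 x y; rewrite !scale1r. Qed.

Lemma killingZl a x z : killing (a *: x) z = a * killing x z.
Proof.
have k0 : killing 0 z = 0.
  by have := killing_linearl z (-1) 0 0; rewrite scaler0 addr0 scaleN1r addNr.
by have := killing_linearl z a x 0; rewrite addr0 k0 addr0.
Qed.

Lemma killingDr x y z : killing z (x + y) = killing z x + killing z y.
Proof. by rewrite ![killing z _]killingC killingDl. Qed.

Lemma killingZr a x z : killing z (a *: x) = a * killing z x.
Proof. by rewrite ![killing z _]killingC killingZl. Qed.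

End LieBasics.

Section Weights.

Variables (F : closedFieldType) (char0 : [pchar F]%R =i pred0).
Variables (L : lieAlgType F) (H : {vspace L}).
Hypothesis cartanH : cartan_subalgebra H.

Local Notation dualH := (dual H).
Implicit Types (x y z : L) (a b : F) (U W : {vspace L}) (l m : dualH).

Lemma natF_eq0 n : (n%:R == 0 :> F) = (n == 0%N).
Proof. by have /pcharf0P := char0. Qed.

Lemma intF_eq0 (n : int) : (n%:~R == 0 :> F) = (n == 0).
Proof. by case: n => n; rewrite ?NegzE ?mulrNz ?oppr_eq0 ?natF_eq0. Qed.

Lemma intF_inj (n m : int) : n%:~R = m%:~R :> F -> n = m.
Proof.
by move=> e; apply/eqP; rewrite -subr_eq0 -intF_eq0 rmorphB /= e subrr.
Qed.

Lemma cartan_subalg x y : x \in H -> y \in H -> lie x y \in H.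
Proof. by case: cartanH => h _ _; apply: h. Qed.

Lemma cartan_ad_nilp h k : h \in H -> k \in H -> nilp_at (ad h) k.
Proof.
case: cartanH => _ [n hn] _ hH kH; exists n; apply/eqP.
rewrite -memv0 -hn /lower_central; elim: n {hn} => //= n IH.
by rewrite adE lie_prod_mem.
Qed.

Definition Hstable U := forall h x, h \in H -> x \in U -> lie h x \in U.

(** If some [ad h] has no single eigenvalue on [U], its generalized eigenspaces cut [U] into smaller
    pieces. These stay [H]-stable: [ad h] is nilpotent on [H], so by [nilp_lie] bracketing with [H]
    does not change the eigenvalue. *)
Lemma weight_dec U : Hstable U -> exists s : seq {vspace L},
  (U <= \sum_(W <- s) W)%VS /\ forall W, W \in s -> Hstable W /\
    forall h, h \in H -> exists a, forall x, x \in W -> nilp_at (ad h - a *: \1%VF) x.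
Proof.
have [n] := ubnP (\dim U); elim: n U => // n IH U ltU HU.
have [good|bad] := pselect (forall h, h \in H -> exists a, forall x, x \in U ->
    nilp_at (ad h - a *: \1%VF) x).
  exists [:: U]; rewrite big_seq1; split=> // W; rewrite inE => /eqP->; by split.
have {bad} [h hH bad] : exists2 h, h \in H & forall a, ~ (U <= gker (ad h) a)%VS.
  apply: contrapT => ne; apply: bad => h hH; apply: contrapT => ne2; apply: ne.
  exists h => // a Ua; apply: ne2; exists a => x xU; apply/gkerP.
  exact: (subvP Ua).
have [u uU|s sP] := @primary_dec _ _ (ad h) U; first by rewrite adE HU.
have piece a : exists t : seq {vspace L}, (U :&: gker (ad h) a <= \sum_(W <- t) W)%VS /\
    forall W, W \in t -> Hstable W /\
    forall h, h \in H -> exists a, forall x, x \in W -> nilp_at (ad h - a *: \1%VF) x.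
  apply: IH.
    apply: (@leq_trans (\dim U)); last by [].
    rewrite (ltn_leqif (dimv_leqif_eq (capvSl _ _))); apply/eqP => e.
    by apply: (bad a); rewrite -e capvSr.
  move=> k x kH; rewrite !memv_cap => /andP[xU /gkerP xa].
  rewrite HU //=; apply/gkerP; rewrite -[a]add0r; apply: nilp_lie xa.
  by rewrite scale0r subr0; apply: cartan_ad_nilp.
elim: s U {IH ltU HU bad} piece sP => [|a s IH] U piece; first by
  rewrite big_nil => U0; exists [::]; rewrite big_nil.
rewrite big_cons => sP.
suff [t [tU tP]] : exists t : seq {vspace L}, (\sum_(a <- s) (U :&: gker (ad h) a) <= \sum_(W <- t) W)%VS /\
    forall W, W \in t -> Hstable W /\
    forall h, h \in H -> exists a, forall x, x \in W -> nilp_at (ad h - a *: \1%VF) x.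
  have [t1 [t1U t1P]] := piece a; exists (t1 ++ t); rewrite big_cat /=; split.
    by apply: subv_trans sP _; apply: addvS.
  by move=> W; rewrite mem_cat => /orP[/t1P|/tP].
elim: (s) => [|b r [t [tU tP]]]; first by exists [::]; rewrite !big_nil.
have [t1 [t1U t1P]] := piece b; exists (t1 ++ t); rewrite big_cons big_cat /=; split.
  exact: addvS.
by move=> W; rewrite mem_cat => /orP[/t1P|/tP].
Qed.

Lemma gw_ex l : exists U : {vspace L}, forall x, (x \in U) <->
  forall h : subvs_of H, nilp_at (ad (vsval h) - (l h : F) *: \1%VF) x.
Proof.
apply: vspace_of_pred => [h|a x y hx hy h]; first exact: nilp_at0.
exact: nilp_atP.
Qed.

Definition gw l : {vspace L} := projT1 (cid (gw_ex l)).

Lemma gwP l x : (x \in gw l) <->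
  forall h : subvs_of H, nilp_at (ad (vsval h) - (l h : F) *: \1%VF) x.
Proof. by rewrite /gw; case: (cid _) => U /=. Qed.

Lemma gw_lie l m x y : x \in gw l -> y \in gw m -> lie x y \in gw (l + m).
Proof.
move=> /gwP xl /gwP ym; apply/gwP => h; rewrite add_lfunE; exact: nilp_lie.
Qed.

Lemma cartan_gw0 : (H <= gw (0 : dualH)%R)%VS.
Proof.
apply/subvP => k kH; apply/gwP => h; rewrite zero_lfunE scale0r subr0.
by apply: cartan_ad_nilp => //; apply: subvsP.
Qed.

Lemma gw_stable l : Hstable (gw l).
Proof.
move=> h x hH xl; rewrite -[l]add0r; apply: gw_lie => //.
exact: (subvP cartan_gw0).
Qed.

Lemma gw_ad l h N x : h \in H -> x \in gw l -> forall a, iter N (ad h - a *: \1%VF) x \in gw l.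
Proof.
move=> hH xl a; apply: iter_stable => // u ul.
by rewrite shiftE adE rpredB ?rpredZ ?gw_stable.
Qed.

Lemma dual_neq l m : l <> m -> exists h, (l h : F) <> m h.
Proof.
move=> ne; apply: contrapT => h; apply: ne; apply/lfunP => k.
by apply: contrapT => hk; apply: h; exists k.
Qed.

(** Choose [h] with [m h] and [l h] different. A power of [ad h - m h] kills [c m], hence by
    induction all other terms, and on [gw l] it kills only 0. *)
Lemma gw_indep (s : seq dualH) (c : dualH -> L) : uniq s ->
  (forall l, l \in s -> c l \in gw l) -> \sum_(l <- s) c l = 0 ->
  forall l, l \in s -> c l = 0.
Proof.
elim: s c => // m s IH c /andP[ms us] cg.
rewrite big_cons => sum0.
have tail l : l \in s -> c l = 0.
  move=> ls; have [h hlm] : exists h, (m h : F) <> l h.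
    by apply: dual_neq => e; rewrite e ls in ms.
  have /gwP/(_ h)[N cmN] := cg m (mem_head _ _).
  have lm : l \in m :: s by rewrite inE ls orbT.
  apply: contrapT => /eqP cl0; apply: hlm.
  apply: (@nilp_shift_inj _ _ (ad (vsval h)) (m h) (l h) (c l)) => //; last first.
    by have /gwP := cg l lm; apply.
  exists N; apply: (IH (fun k => iter N (ad (vsval h) - (m h : F) *: \1%VF) (c k))) => //.
    move=> k ks; apply: gw_ad; first exact: subvsP.
    by apply: cg; rewrite inE ks orbT.
  have : iter N (ad (vsval h) - (m h : F) *: \1%VF) (c m + \sum_(j <- s) c j) = 0.
    by rewrite sum0 iter_lin0.
  rewrite -[c m]scale1r iter_linear cmN scaler0 add0r => e; apply: etrans e; apply: esym.
  rewrite (big_morph _ (id1 := 0) (op1 := +%R)) ?iter_lin0 // => x y.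
  by rewrite -[x]scale1r iter_linear !scale1r.
move=> l; rewrite inE => /orP[/eqP->|/tail //].
by move: sum0; rewrite big_seq big1 ?addr0.
Qed.

Lemma gw_sum_disj (s : seq dualH) (A : dualH -> {vspace L}) l x : uniq s ->
  l \notin s -> (forall m, m \in s -> (A m <= gw m)%VS) -> x \in gw l ->
  x \in (\sum_(m <- s) A m)%VS -> x = 0.
Proof.
move=> us ls Ag xl /(memv_seq_sum us)[c cA ex].
pose d m := if m == l then - x else c m.
have e0 : \sum_(m <- l :: s) d m = 0.
  rewrite big_cons /d eqxx big_seq (eq_bigr c) -?big_seq -?ex ?addNr // => m ms.
  by case: eqP => // e; rewrite e (negbTE ls) in ms.
have := gw_indep _ _ e0 (mem_head _ _); rewrite /d eqxx /= ls us => /(_ isT).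
move=> h; apply/eqP; rewrite -oppr_eq0; apply/eqP/h => m.
rewrite inE; case: eqP => [-> _|_ /= ms]; first by rewrite rpredN.
exact: (subvP (Ag m ms)).
Qed.

Lemma gw_tr_sum (s : seq dualH) (A : dualH -> {vspace L}) (f : 'End(L)) : uniq s ->
  (forall l, l \in s -> (A l <= gw l)%VS) ->
  (forall l, l \in s -> forall u, u \in A l -> f u \in A l) ->
  tr (\sum_(l <- s) A l)%VS f = \sum_(l <- s) tr (A l) f.
Proof.
elim: s => [|l s IH] /=.
  rewrite !big_nil => _ _ _; rewrite (@eq_tr _ _ 0%VS f 0) ?tr0 // => u.
  by rewrite memv0 => /eqP->; rewrite !linear0.
move=> /andP[ls us] Ag fA.
have Ag' m : m \in s -> (A m <= gw m)%VS by move=> ms; apply: Ag; rewrite inE ms orbT.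
have fA' m : m \in s -> forall u, u \in A m -> f u \in A m.
  by move=> ms; apply: fA; rewrite inE ms orbT.
rewrite !big_cons tr_add ?IH //.
- apply/eqP; rewrite -subv0; apply/subvP => x; rewrite memv_cap memv0 => /andP[xl xs].
  apply/eqP; apply: (gw_sum_disj us ls Ag' _ xs).
  exact: (subvP (Ag l (mem_head _ _))).
- exact: fA (mem_head _ _).
move=> u /(memv_seq_sum us)[c cA ->]; rewrite linear_sum; apply: mem_seq_sum => m ms.
exact: fA'.
Qed.

Lemma gw_tr_ad (s : seq dualH) (A : dualH -> {vspace L}) (h : subvs_of H) : uniq s ->
  (forall l, l \in s -> (A l <= gw l)%VS) ->
  (forall l, l \in s -> forall u, u \in A l -> lie (vsval h) u \in A l) ->
  tr (\sum_(l <- s) A l)%VS (ad (vsval h)) = \sum_(l <- s) (\dim (A l))%:R * (l h : F).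
Proof.
move=> us Ag hA; rewrite gw_tr_sum //; last first.
  by move=> l ls u uA; rewrite adE hA.
rewrite !big_seq; apply: eq_bigr => l ls; apply: tr_nilp_shift => u uA.
  by rewrite adE hA.
by have /gwP := subvP (Ag l ls) _ uA.
Qed.

End Weights.

(** * Non-degeneracy of the Killing form *)

Section Cartan.

Variables (F : closedFieldType) (char0 : [pchar F]%R =i pred0).
Variables (L : lieAlgType F) (H : {vspace L}).
Hypothesis cartanH : cartan_subalgebra H.

Local Notation dualH := (dual H).
Implicit Types (x y z : L) (a b : F) (U W : {vspace L}) (l m : dualH).

(** The eigenvalue of [ad h] on [W] is its trace divided by the dimension, which is linear in [h].
    The division needs characteristic zero. *)
Lemma Hstable_weight W : Hstable H W ->
  (forall h, h \in H -> exists a, forall x, x \in W -> nilp_at (ad h - a *: \1%VF) x) ->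
  exists l : dualH, (W <= gw l)%VS.
Proof.
move=> HW good; have [->|W0] := eqVneq W 0%VS; first by exists 0; apply: sub0v.
pose g (h : subvs_of H) : F^o := (\dim W)%:R^-1 * tr W (ad (vsval h)).
have g_lin : linear g.
  move=> a x y; rewrite /g (linearP vsval) ad_is_linear trD trZ mulrDr.
  by rewrite mulrCA.
pose gM := HB.pack_for {linear subvs_of H -> F^o} g
  (GRing.isLinear.Build F (subvs_of H) F^o *:%R g g_lin).
exists (linfun gM); apply/subvP => x xW; apply/gwP => h.
rewrite lfunE /= /g; have [a aP] := good _ (subvsP h).
rewrite (tr_nilp_shift _ aP); last by move=> u; rewrite adE; apply: HW; apply: subvsP.
by rewrite mulKf ?natF_eq0 ?dimv_eq0 //; apply: aP.
Qed.

Lemma gw_span : exists s : seq dualH,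
  [/\ uniq s, fullv = (\sum_(l <- s) gw l)%VS & forall l, (l \in s) = (gw l != 0%VS)].
Proof.
have [|ss [ssU ssP]] := @weight_dec _ _ _ cartanH fullv.
  by move=> h x _ _; apply: memvf.
have [s sP] : exists s : seq dualH, uniq s /\ (\sum_(W <- ss) W <= \sum_(l <- s) gw l)%VS.
  elim: ss {ssU} ssP => [|W ss IH] ssP; first by exists [::]; rewrite !big_nil subvv.
  have [s [us sP]] : exists s : seq dualH, uniq s /\ (\sum_(W <- ss) W <= \sum_(l <- s) gw l)%VS.
    by apply: IH => U Uss; apply: ssP; rewrite inE Uss orbT.
  have [HW good] := ssP W (mem_head _ _).
  have [l Wl] := Hstable_weight HW good.
  have [ls|ls] := boolP (l \in s).
    exists s; split=> //; rewrite big_cons subv_add sP andbT.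
    exact: subv_trans Wl (seq_sum_sup _ ls).
  by exists (l :: s); rewrite /= ls us !big_cons addvS.
case: sP => us sP; pose s' := [seq l <- s | gw l != 0%VS].
have us' : uniq s' by apply: filter_uniq.
have es' : fullv = (\sum_(l <- s') gw l)%VS.
  apply/eqP; rewrite eq_sym eqEsubv subvf /=; apply: subv_trans ssU _.
  apply: subv_trans sP _; apply: seq_sum_subP => l ls.
  have [->|l0] := eqVneq (gw l) 0%VS; first exact: sub0v.
  by apply: seq_sum_sup; rewrite mem_filter l0.
exists s'; split=> // l; apply/idP/idP; first by rewrite mem_filter => /andP[].
apply: contraNT => ls'; apply/eqP; apply/eqP; rewrite -subv0; apply/subvP => x xl.
rewrite memv0; apply/eqP; apply: (@gw_sum_disj _ _ _ cartanH s' (@gw _ _ H) l) => //.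
by rewrite -es' memvf.
Qed.

Definition wts : seq dualH := projT1 (cid gw_span).

Lemma wts_uniq : uniq wts.
Proof. by rewrite /wts; case: (cid _) => s []. Qed.

Lemma wts_sum : fullv = (\sum_(l <- wts) gw l)%VS.
Proof. by rewrite /wts; case: (cid _) => s []. Qed.

Lemma wtsE l : (l \in wts) = (gw l != 0%VS).
Proof. by rewrite /wts; case: (cid _) => s []. Qed.

Lemma wts_mem l x : x \in gw l -> x != 0 -> l \in wts.
Proof.
by move=> xl x0; rewrite wtsE; apply: contraNneq x0 => e; rewrite e memv0 in xl.
Qed.

Lemma wts_dec x : exists2 c : dualH -> L, forall l, c l \in gw l &
  x = \sum_(l <- wts) c l.
Proof.
by apply: (memv_seq_sum wts_uniq); rewrite -wts_sum memvf.
Qed.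

Lemma lower_centralS n : (lower_central H n.+1 <= lower_central H n)%VS.
Proof.
have subA : subalgebra H by case: cartanH.
elim: n => [|n IH]; first exact: lie_prod_sub.
apply: lie_prod_sub => x y xH yn; apply: lie_prod_mem => //.
exact: (subvP IH).
Qed.

Lemma lower_central_sub n : (lower_central H n <= H)%VS.
Proof.
elim: n => [|n IH]; first exact: subvv.
exact: subv_trans (lower_centralS n) IH.
Qed.

(** Engel's argument along the lower central series [C i] of [H]: let [V i] consist of the [y] in
    [gw 0] with [[C i, y]] inside [H]. Then [V 0] normalizes [H], so lies in it, and [V n] is all of
    [gw 0] once [C n = 0]. *)
Lemma gw0E : gw (0 : dualH)%R = H.
Proof.
apply/eqP; rewrite eqEsubv cartan_gw0 // andbT.
have VP i : exists U : {vspace L}, forall y, y \in U <->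
    y \in gw (0 : dualH) /\ forall c, c \in lower_central H i -> lie c y \in H.
  apply: vspace_of_pred => [|a x y [x0 xc] [y0 yc]].
    by split=> [|c _]; rewrite ?lie0r mem0v.
  split; first by rewrite rpredD ?rpredZ.
  by move=> c cC; rewrite lie_linearr rpredD ?rpredZ ?xc ?yc.
have [V VVP] := choice VP.
have [subA [n Cn] normH] := cartanH.
suff VH i : (V i <= H)%VS.
  apply: subv_trans (VH n); apply/subvP => x x0; apply/VVP; split=> // c.
  by rewrite Cn memv0 => /eqP->; rewrite lie0l mem0v.
elim: i => [|i IH].
  apply/subvP => y /VVP[_ yH]; apply: normH => h hH.
  by rewrite lieC rpredN yH.
apply: contrapT => nVH.
have CH j c : c \in lower_central H j -> c \in H by apply/subvP/lower_central_sub.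
have CC c d j : c \in H -> d \in lower_central H j -> lie c d \in lower_central H j.+1.
  by move=> cH dC; apply: lie_prod_mem.
(* These operators are nilpotent on [V i.+1] and commute there modulo [H], since [[C i, C i]] lies
   in [C i.+1]. A common null vector modulo [H] lies in [V i], hence in [H], so it cannot be outside
   [H]. *)
pose fs := [seq ad c | c <- vbasis (lower_central H i)].
have fsP f : f \in fs -> exists2 c, c \in lower_central H i & f = ad c.
  by move=> /mapP[c /vbasis_mem cC ->]; exists c.
have [||||y [yV yH yf]] := @commuting_null _ _ fs (V i.+1) H _ _ _ _ nVH.
- move=> f /fsP[c cC ->] u /VVP[u0 uH]; apply/VVP; rewrite adE; split.
    by apply: (gw_stable cartanH) u0; apply: CH cC.
  move=> d dC; rewrite lie_der rpredD //; last first.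
    by apply: subA; [apply: CH cC | apply: uH].
  rewrite [lie d c]lieC lieNl rpredN.
  by apply: uH; apply: (subvP (lower_centralS _)); apply: CC => //; apply: CH cC.
- by move=> f /fsP[c cC ->] u uH; rewrite adE; apply: subA => //; apply: CH cC.
- move=> f g /fsP[c cC ->] /fsP[d dC ->] u /VVP[u0 uH].
  rewrite !adE lie_der addrK; apply: uH; apply: CC => //; exact: CH cC.
- move=> f /fsP[c cC ->] u /VVP[/gwP u0 _].
  have cH := CH _ _ cC; have [N eN] := u0 (vsproj H c).
  by exists N; move: eN; rewrite vsprojK // zero_lfunE scale0r subr0 => ->; apply: mem0v.
move: yH; apply/negP/negPn; apply: (subvP IH); apply/VVP.
have [y0 _] := (VVP _ _).1 yV; split=> // c cC.
rewrite (coord_vbasis cC) lieC rpredN -adE linear_sum; apply: rpred_sum => j _.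
rewrite linearZ /= rpredZ // adE lieC rpredN -adE; apply: yf; apply: map_f.
by rewrite mem_nth // size_tuple.
Qed.

(** The sum is the trace of [ad h] on the span of the [A l], where [ad h] is a commutator of two
    operators preserving that span. Subspaces of the [gw l] are allowed because [wts_multiple]
    replaces one of them by a line. *)
Lemma gw_lie_trace (t : seq dualH) (A : dualH -> {vspace L}) x y (h : subvs_of H) :
  uniq t -> (forall l, l \in t -> (A l <= gw l)%VS) ->
  (forall l, l \in t -> forall u, u \in A l -> lie (vsval h) u \in A l) ->
  (forall l, l \in t -> forall u, u \in A l -> lie x u \in (\sum_(k <- t) A k)%VS) ->
  (forall l, l \in t -> forall u, u \in A l -> lie y u \in (\sum_(k <- t) A k)%VS) ->
  vsval h = lie x y ->
  \sum_(l <- t) (\dim (A l))%:R * (l h : F) = 0.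
Proof.
move=> ut Ag hA xA yA hxy; rewrite -(gw_tr_ad cartanH ut Ag hA) hxy ad_lie.
have st z : (forall l, l \in t -> forall u, u \in A l -> lie z u \in (\sum_(k <- t) A k)%VS) ->
    forall u, u \in (\sum_(k <- t) A k)%VS -> ad z u \in (\sum_(k <- t) A k)%VS.
  move=> zA u /(memv_seq_sum ut)[c cA ->]; rewrite linear_sum [X in X \in _]big_seq.
  by apply: rpred_sum => l lt; rewrite /= adE (zA l).
by apply: tr_comm; apply: st.
Qed.

Lemma gw_lie_trace_full (t : seq dualH) m x y (h : subvs_of H) : uniq t ->
  x \in gw m -> y \in gw (- m) ->
  (forall l, l \in t -> l + m \in wts -> l + m \in t) ->
  (forall l, l \in t -> l - m \in wts -> l - m \in t) ->
  vsval h = lie x y ->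
  \sum_(l <- t) (\dim (gw l))%:R * (l h : F) = 0.
Proof.
move=> ut xm ym tp tm hxy.
have st k z : z \in gw k -> (forall l, l \in t -> l + k \in wts -> l + k \in t) ->
    forall l, l \in t -> forall u, u \in gw l -> lie z u \in (\sum_(k <- t) gw k)%VS.
  move=> zk tk l lt u ul; have zu := gw_lie zk ul; rewrite addrC in zu.
  have [->|ne] := eqVneq (lie z u) 0; first exact: mem0v.
  have lk := tk _ lt (wts_mem zu ne).
  exact: (subvP (seq_sum_sup _ lk)).
apply: gw_lie_trace hxy => //; [|exact: st xm tp|exact: st ym tm].
by move=> l _ u; apply: (gw_stable cartanH); apply: subvsP.
Qed.

Lemma dual_mulz m (k : int) (h : subvs_of H) : ((m *~ k) h : F) = k%:~R * (m h : F).
Proof. by rewrite -[m *~ k]scaler_int scale_lfunE. Qed.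

(** The trace of [[x, y]] vanishes on the sum of the weight spaces with weights [l + k m], [k] an
    integer. This is a linear relation between [l h] and [m h], and the coefficient of [l h] is the
    total dimension, so it is positive. *)
Lemma weight_ratio l m x y (h : subvs_of H) : l \in wts ->
  x \in gw m -> y \in gw (- m) -> vsval h = lie x y ->
  exists D E : int, 0 < D /\ D%:~R * (l h : F) = E%:~R * (m h : F).
Proof.
move=> lw xm ym hxy.
pose P (l' : dualH) := `[< exists k : int, l' = l + m *~ k >].
pose t := [seq l' <- wts | P l'].
have kP l' : exists k : int, l' \in t -> l' = l + m *~ k.
  have [l't|] := boolP (l' \in t); last by exists 0.
  by move: l't; rewrite mem_filter => /andP[/asboolP[k ->] _]; exists k.
have [k {}kP] := choice kP.
have tc e l' : l' \in t -> l' + m *~ e \in wts -> l' + m *~ e \in t.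
  rewrite !mem_filter => /andP[/asboolP[j ->] _] ->; rewrite andbT; apply/asboolP.
  by exists (j + e); rewrite mulrzDr addrA.
have H0 := gw_lie_trace_full (filter_uniq _ wts_uniq) xm ym (tc 1) (tc (-1)) hxy.
have lt : l \in t by rewrite mem_filter lw andbT; apply/asboolP; exists 0; rewrite addr0.
exists (\sum_(l' <- t) (\dim (gw l'))%:Z).
exists (- \sum_(l' <- t) (\dim (gw l'))%:Z * k l'); split.
  rewrite (big_rem l) //= ltr_wpDr //; last first.
    by rewrite ltz_nat lt0n dimv_eq0 -wtsE.
  by apply: sumr_ge0.
rewrite rmorphN mulNr; apply/eqP; rewrite -addr_eq0; apply/eqP.
rewrite -[RHS]H0 !rmorph_sum /= !mulr_suml -big_split /= !big_seq.
apply: eq_bigr => l' l't; rewrite [in RHS](kP l' l't) add_lfunE rmorphM /= mulrDr.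
by rewrite dual_mulz -(kP l' l't) mulrA.
Qed.

Lemma weight_ratios m x y (h : subvs_of H) :
  x \in gw m -> y \in gw (- m) -> vsval h = lie x y ->
  exists (D : int) (e : dualH -> int), 0 < D /\
    forall l, l \in wts -> D%:~R * (l h : F) = (e l)%:~R * (m h : F).
Proof.
move=> xm ym hxy.
have {xm ym} rat l : l \in wts -> exists D E : int, 0 < D /\ D%:~R * (l h : F) = E%:~R * (m h : F).
  by move=> lw; apply: weight_ratio lw xm ym hxy.
elim: wts rat => [|l s IH] rat; first by exists 1, (fun=> 0).
have [D [E [D0 DE]]] := rat l (mem_head _ _).
have [D' [e [D'0 D'e]]] := IH (fun k ks => rat k (mem_behead (s := l :: s) ks)).
exists (D * D'), (fun k => if k == l then D' * E else D * e k); split; first exact: mulr_gt0.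
move=> k; rewrite inE; case: eqP => [->|_] /=.
  by rewrite mulrC [in LHS]mulrC !rmorphM /= -!mulrA mulrCA DE.
by move=> /D'e ek; rewrite !rmorphM /= -!mulrA ek.
Qed.

Lemma killing_sqr (h : subvs_of H) :
  killing (vsval h) (vsval h) = \sum_(l <- wts) (\dim (gw l))%:R * ((l h : F) * l h).
Proof.
rewrite killing_tr wts_sum (gw_tr_sum cartanH wts_uniq) //; last first.
  move=> l _ u ul; rewrite comp_lfunE !adE; have hH := subvsP h.
  by do 2!apply: (gw_stable cartanH) => //.
apply: eq_bigr => l _; apply: tr_nilp_shift => u ul.
  by rewrite comp_lfunE !adE; have hH := subvsP h; do 2!apply: (gw_stable cartanH) => //.
by apply: nilp_sqr; have /gwP := ul.
Qed.

Hypothesis simpleL : lie_simple L.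

Lemma simple_lie_prod : lie_prod fullv fullv = fullv :> {vspace L}.
Proof.
have [nab ids] := simpleL.
have /ids[e|//] : lie_ideal (lie_prod fullv fullv : {vspace L}).
  by move=> x y _; apply: lie_prod_mem; apply: memvf.
case: nab => x y _ _; apply/eqP; rewrite -memv0 -e.
by apply: lie_prod_mem; apply: memvf.
Qed.

(** If the Killing form is zero, every weight vanishes on the brackets of vectors of opposite
    weights. Since [L = [L, L]], the weights then vanish on all of [H]; so 0 is the only weight and
    [L = H] is nilpotent, which contradicts [L = [L, L]]. *)
Lemma killing_nonzero : ~ forall x y : L, killing x y = 0.
Proof.
move=> k0.
have vanish l m x y : l \in wts -> x \in gw m -> y \in gw (- m) ->
    (l (vsproj H (lie x y)) : F) = 0.
  move=> lw xm ym; set h := vsproj _ _.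
  have [x0|x0] := eqVneq x 0; first by rewrite /h x0 lie0l !linear0.
  have hxy : vsval h = lie x y.
    by rewrite vsprojK // -gw0E -(subrr m); apply: gw_lie.
  have [D [e [D0 De]]] := weight_ratios xm ym hxy.
  have Dn0 : D%:~R != 0 :> F by rewrite intF_eq0 // gt_eqF.
  suff mh0 : (m h : F) = 0.
    have := De l lw; rewrite mh0 mulr0 => /eqP.
    by rewrite mulf_eq0 (negbTE Dn0) => /eqP.
  apply: contrapT => /eqP mh0.
  have mw : m \in wts by apply: wts_mem xm x0.
  (* By [weight_ratios], [D ^ 2] times [killing h h] is [(m h) ^ 2] times a weighted sum of integer
     squares; its vanishing forces [e m = 0]. *)
  have /eqP : (\sum_(k <- wts) (\dim (gw k))%:Z * (e k * e k))%:~R * ((m h : F) * m h) = 0.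
    transitivity (D%:~R * D%:~R * killing (vsval h) (vsval h)); last by rewrite k0 mulr0.
    rewrite killing_sqr rmorph_sum mulr_suml mulr_sumr /= !big_seq.
    apply: eq_bigr => k kw; have ek := De k kw; rewrite !rmorphM /=.
    transitivity ((\dim (gw k))%:R * (((e k)%:~R * (m h : F)) * ((e k)%:~R * (m h : F)))); first by ring.
    by rewrite -!ek; ring.
  rewrite mulf_eq0 mulf_eq0 (negbTE mh0) !orbF intF_eq0 // => /eqP s0.
  have : e m = 0.
    apply: contrapT => /eqP em0.
    have : 0 < \sum_(k <- wts) (\dim (gw k))%:Z * (e k * e k); last by rewrite s0.
    rewrite (big_rem m) //= ltr_pwDl //.
      by rewrite mulr_gt0 ?ltz_nat ?lt0n ?dimv_eq0 -?wtsE // -expr2 exprn_even_gt0.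
    by apply: sumr_ge0 => k _; rewrite mulr_ge0 // -expr2 sqr_ge0.
  move=> em; have := De m mw; rewrite em mul0r => /eqP.
  by rewrite mulf_eq0 (negbTE Dn0) (negbTE mh0).
have [K KP] : exists K : {vspace L}, forall x, x \in K <->
    x \in H /\ forall l, l \in wts -> (l (vsproj H x) : F) = 0.
  apply: vspace_of_pred => [|a x y [xH xl] [yH yl]].
    by rewrite mem0v; split=> // l _; rewrite !linear0.
  split=> [|l lw]; first by rewrite rpredD ?rpredZ.
  by rewrite !linearP /= xl // yl // scaler0 addr0.
pose s := [seq l <- wts | l != 0].
pose Z := (K + \sum_(l <- s) gw l)%VS.
have ZT : Z = fullv.
  apply/eqP; rewrite eqEsubv subvf -simple_lie_prod; apply: lie_prod_sub => x y _ _.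
  have [c cg ->] := wts_dec x; have [d dg ->] := wts_dec y.
  rewrite -adE linear_sum; apply: rpred_sum => l _.
  rewrite /= adE lieC rpredN -adE linear_sum; apply: rpred_sum => m _.
  rewrite /= adE; have dc := gw_lie (dg l) (cg m).
  have [lm0|lm0] := eqVneq (l + m) 0.
    apply: (subvP (addvSl _ _)); apply/KP; split.
      by rewrite -gw0E -lm0.
    move=> k kw; apply: (vanish _ l) => //.
    by have -> : - l = m by apply/eqP; rewrite eq_sym -addr_eq0 addrC lm0.
  have [->|ne] := eqVneq (lie (d l) (c m)) 0; first exact: mem0v.
  apply: (subvP (addvSr _ _)); apply: (subvP (@seq_sum_sup _ _ _ s (@gw _ _ H) (l + m) _)) => //.
  by rewrite mem_filter lm0 (wts_mem dc ne).
have wts0 l : l \in wts -> l = 0.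
  move=> lw; apply/lfunP => h; rewrite zero_lfunE.
  have : vsval h \in Z by rewrite ZT memvf.
  move=> /memv_addP[k /KP[kH kl] [z zs e]].
  have z0 : z = 0.
    apply: (@gw_sum_disj _ _ _ cartanH s (@gw _ _ H) 0) => //.
    - exact: filter_uniq wts_uniq.
    - by rewrite mem_filter eqxx.
    by rewrite gw0E (_ : z = vsval h - k) ?rpredB ?subvsP // e addrC addrA addNr add0r.
  by rewrite -(kl l lw); congr (l _ : F); apply: val_inj; rewrite /= e z0 addr0 vsprojK.
have HT : H = fullv.
  apply/eqP; rewrite eqEsubv subvf wts_sum; apply: seq_sum_subP => l lw.
  by rewrite (wts0 l lw) gw0E.
have [_ [n Cn] _] := cartanH; have [nab _] := simpleL; case: nab => x y _ _.
have lT : lower_central H n = fullv.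
  by rewrite HT; elim: (n) => //= j ->; apply: simple_lie_prod.
by apply/eqP; rewrite -memv0 -Cn lT memvf.
Qed.

Lemma killing_nondeg x : (forall y, killing x y = 0) -> x = 0.
Proof.
have [R RP] : exists R : {vspace L}, forall x, x \in R <-> forall y, killing x y = 0.
  apply: vspace_of_pred => [y|a u v ku kv y].
    by rewrite -(scale0r (0 : L)) killingZl mul0r.
  by rewrite killingDl killingZl ku kv mulr0 addr0.
have Rid : lie_ideal R.
  move=> u v /RP kv; apply/RP => y.
  by rewrite lieC -scaleN1r killingZl killing_inv kv mulr0.
have [_ /(_ R Rid)[R0|RT]] := simpleL.
  by move/RP; rewrite R0 memv0 => /eqP.
by case: killing_nonzero => u v; apply: (RP u).1; rewrite RT memvf.
Qed.

End Cartan.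

(** * Root spaces and root strings *)

Section Structure.

Variables (F : closedFieldType) (char0 : [pchar F]%R =i pred0).
Variables (L : lieAlgType F) (H : {vspace L}).
Hypothesis cartanH : cartan_subalgebra H.
Hypothesis simpleL : lie_simple L.

Local Notation dualH := (dual H).
Local Notation wts := (wts char0 cartanH).
Implicit Types (x y z e f : L) (U W : {vspace L}) (a b c l m : dualH) (h : subvs_of H).

Let gw0E := gw0E cartanH.
Let killing_nondeg := killing_nondeg char0 cartanH simpleL.

(** By invariance [ad h - l h] is adjoint, up to sign, to [ad h + l h]. The first is nilpotent at
    [x]; the second is bijective on [gw m] when [(l + m) h] is not 0, so [y] lies in the image of
    each of its powers. *)
Lemma killing_orth l m x y : x \in gw l -> y \in gw m -> l + m <> 0 -> killing x y = 0.
Proof.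
move=> xl ym lm0.
have [h hlm] : exists h, ((l + m) h : F) <> (0 : dualH) h by apply: dual_neq.
rewrite add_lfunE zero_lfunE in hlm.
pose g := ad (vsval h) - (l h : F) *: \1%VF.
pose g' := ad (vsval h) - (- l h : F) *: \1%VF.
have gm u : u \in gw m -> g' u \in gw m.
  move=> um; rewrite shiftE adE rpredB ?rpredZ //.
  by apply: gw_stable => //; apply: subvsP.
have g'm : (g' @: gw m)%VS = gw m.
  apply/eqP; rewrite eqEdim; apply/andP; split.
    by apply/subvP => _ /memv_imgP[u um ->]; apply: gm.
  rewrite limg_dim_eq //; apply/eqP; rewrite -subv0; apply/subvP => u.
  rewrite memv_cap memv_ker memv0 => /andP[um /eqP g'u].
  apply: contrapT => /negP u0; apply: hlm.
  have /gwP/(_ h) nm := um; have nl : nilp_at g' u by exists 1%N.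
  by rewrite -(nilp_shift_inj nl nm u0) subrr.
have gg' u v : killing (g u) v = - killing u (g' v).
  rewrite /g /g' !shiftE !adE lieC scaleNr opprK -!opprD.
  rewrite -scaleN1r killingZl mulN1r killingDl killingDr killing_inv.
  by rewrite killingZl killingZr.
have /gwP/(_ h)[N eN] := xl.
have surj u : u \in gw m -> exists2 v, v \in gw m & iter N g' v = u.
  elim: N {eN} u => [|N IH] u; first by exists u.
  by rewrite -{1}g'm => /memv_imgP[w /IH[v vm <-] ->]; exists v.
have [v vm <-] := surj y ym.
have it n u w : killing (iter n g u) w = (-1) ^+ n * killing u (iter n g' w).
  elim: n u w => [|n IH] u w; first by rewrite mul1r.
  by rewrite iterSr IH gg' exprSr -mulrA mulN1r.
have := it N x v; rewrite eN => /esym/eqP; rewrite -(scale0r (0 : L)) killingZl mul0r.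
by rewrite mulf_eq0 expf_eq0 oppr_eq0 oner_eq0 andbF => /eqP.
Qed.

Lemma killing_dual_vec l x : x \in gw l -> x <> 0 ->
  exists2 y, y \in gw (- l) & killing x y = 1.
Proof.
move=> xl x0; apply: contrapT => ne; apply/x0/killing_nondeg => y.
have [c cg ->] := wts_dec char0 cartanH y.
elim/big_ind: _ => [|u v ku kv|m _].
- by rewrite -(scale0r (0 : L)) killingZr mul0r.
- by rewrite killingDr ku kv addr0.
have [lm|/eqP lm] := eqVneq (l + m) 0; last exact: killing_orth (cg m) lm.
apply: contrapT => /eqP kn; apply: ne; exists ((killing x (c m))^-1 *: c m).
  by rewrite rpredZ // (_ : - l = m) //; apply/eqP; rewrite eq_sym -addr_eq0 addrC lm.
by rewrite killingZr mulVf.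
Qed.

Lemma wtsN l : l \in wts -> - l \in wts.
Proof.
rewrite wtsE => /eqP l0; have [x xl x0] : exists2 x, x \in gw l & x <> 0.
  apply: contrapT => ne; apply: l0; apply/eqP; rewrite -subv0; apply/subvP => x xl.
  by rewrite memv0; apply/eqP; apply: contrapT => x0; apply: ne; exists x.
have [y yl kxy] := killing_dual_vec xl x0; apply: wts_mem yl _.
apply/eqP => y0; move: kxy => /eqP; rewrite y0 -(scale0r (0 : L)) killingZr mul0r.
by rewrite eq_sym oner_eq0.
Qed.

Lemma killing_nondegH x : x \in H -> (forall y, y \in H -> killing x y = 0) -> x = 0.
Proof.
move=> xH k0; apply: contrapT => x0; have x0g := xH; rewrite -gw0E in x0g.
have [y] := killing_dual_vec x0g x0; rewrite oppr0 gw0E => /k0-> /eqP.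
by rewrite eq_sym oner_eq0.
Qed.

(** Polarization of [killing_sqr], with 2 invertible in [F]. *)
Lemma killingH h (k : subvs_of H) : killing (vsval h) (vsval k) =
  \sum_(l <- wts) (\dim (gw l))%:R * ((l h : F) * l k).
Proof.
have := killing_sqr char0 cartanH (h + k).
rewrite (linearD vsval) killingDl !killingDr !killing_sqr [killing (vsval k) _]killingC => e.
have n2 : 2 != 0 :> F by rewrite (natF_eq0 char0 2).
apply: (mulfI n2); apply: (addrI (killing (vsval h) (vsval h) + killing (vsval k) (vsval k))).
transitivity (\sum_(l <- wts) (\dim (gw l))%:R * ((l (h + k) : F) * l (h + k))).
  by rewrite -e !(killing_sqr char0 cartanH); ring.
rewrite !(killing_sqr char0 cartanH) mulr_sumr -!big_split /=.
by apply: eq_bigr => l _; rewrite linearD /=; ring.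
Qed.

(** This is [weight_ratio] for [m = 0], whose right-hand side vanishes. *)
Lemma wts_lieH l x y : l \in wts -> x \in H -> y \in H -> (l (vsproj H (lie x y)) : F) = 0.
Proof.
move=> lw xH yH; have x0 := xH; have y0 := yH; rewrite -gw0E in x0 y0.
rewrite -oppr0 in y0.
have hxy : vsval (vsproj H (lie x y)) = lie x y.
  by rewrite vsprojK // (cartan_subalg cartanH).
have [D [E [D0 DE]]] := weight_ratio lw x0 y0 hxy.
move/eqP: DE; rewrite zero_lfunE mulr0 mulf_eq0 intF_eq0 // gt_eqF //=.
by move/eqP.
Qed.

Lemma cartan_abelian : lie_abelian H.
Proof.
move=> x y xH yH; have xyH := cartan_subalg cartanH xH yH.
apply: killing_nondegH => // z zH.
rewrite -[lie x y](vsprojK xyH) -[z](vsprojK zH) killingH big_seq big1 // => l lw.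
by rewrite wts_lieH // mul0r mulr0.
Qed.

Lemma wts_sep h : (forall l, l \in wts -> (l h : F) = 0) -> h = 0.
Proof.
move=> h0; apply: val_inj => /=; apply: killing_nondegH; first exact: subvsP.
move=> y yH; rewrite -[y](vsprojK yH) killingH big_seq big1 // => l lw.
by rewrite h0 // mul0r mulr0.
Qed.

Definition rvec l : subvs_of H := (killing_dual H)^-1%VF l.

Lemma root_vecE l : root_vec l = vsval (rvec l). Proof. by []. Qed.

Lemma rvecP l h : killing (vsval (rvec l)) (vsval h) = l h.
Proof.
rewrite -killing_dualE limg_lfunVK //.
suff -> : limg (killing_dual H) = fullv by apply: memvf.
apply/eqP; rewrite eqEdim subvf limg_dim_eq; first by rewrite !dimvf /dim /= muln1.
apply/eqP; rewrite -subv0; apply/subvP => k; rewrite memv_cap memv_ker memv0 => /andP[_ /eqP k0].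
apply/eqP; apply: val_inj => /=; apply: killing_nondegH; first exact: subvsP.
by move=> y yH; rewrite -[y](vsprojK yH) -killing_dualE k0 zero_lfunE.
Qed.

Lemma rvec_sym l m : (l (rvec m) : F) = m (rvec l).
Proof. by rewrite -!rvecP killingC. Qed.

Lemma lie_weight l x : x \in weight_space l -> forall h, lie (vsval h) x = (l h : F) *: x.
Proof. by move/weight_spaceP. Qed.

Lemma weight_gw l : (weight_space l <= gw l)%VS.
Proof.
apply/subvP => x xl; apply/gwP => h; exists 1%N.
by rewrite /= shiftE adE (lie_weight xl) subrr.
Qed.

Lemma lie_rvec l e f : e \in weight_space l -> f \in gw (- l) ->
  lie e f = killing e f *: vsval (rvec l).
Proof.
move=> el fl; have efH : lie e f \in H.
  by rewrite -gw0E -(subrr l); apply: gw_lie => //; apply: (subvP (weight_gw l)).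
apply/eqP; rewrite -subr_eq0; apply/eqP/killing_nondegH.
  by rewrite rpredB ?rpredZ ?subvsP.
move=> h hH; rewrite -[h](vsprojK hH) killingDl -scaleN1r !killingZl rvecP.
rewrite killingC -killing_inv (lie_weight el) killingZl; ring.
Qed.

(** Since [rvec l] is [[e, f]], all weights take at it rational multiples of [l (rvec l)]. If this
    value were 0, all weights would vanish there, so [rvec l] and [l] would be 0. *)
Lemma rvec_neq0 l e f : l <> 0 -> e \in weight_space l -> f \in gw (- l) ->
  killing e f = 1 -> (l (rvec l) : F) <> 0.
Proof.
move=> l0 el fl kef ll; apply: l0.
have hef : vsval (rvec l) = lie e f by rewrite (lie_rvec el fl) kef scale1r.
have eg := subvP (weight_gw l) _ el.
have [D [n [D0 Dn]]] := weight_ratios char0 cartanH eg fl hef.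
have r0 : rvec l = 0.
  apply: wts_sep => m mw; have := Dn m mw; rewrite ll mulr0 => /eqP.
  by rewrite mulf_eq0 intF_eq0 // gt_eqF //= => /eqP.
apply/lfunP => h; rewrite zero_lfunE -rvecP r0 linear0.
by rewrite -(scale0r (0 : L)) killingZl mul0r.
Qed.

(** Now that [H] is abelian, the operators [ad h - l h] commute; they are nilpotent on [gw l] and so
    have a common null vector. *)
Lemma weight_vec l : l \in wts -> exists2 e, e \in weight_space l & e <> 0.
Proof.
move=> lw.
pose fs := [seq ad (vsval h) - (l h : F) *: \1%VF | h <- vbasis {: subvs_of H}].
have fsP (f : 'End(L)) : f \in fs -> exists h, f = ad (vsval h) - (l h : F) *: \1%VF.
  by move=> /mapP[h _ ->]; exists h.
have [|||||e [el e0 ef]] := @commuting_null _ _ fs (gw l) 0%VS.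
- move=> f /fsP[h ->] u ul; rewrite shiftE adE rpredB ?rpredZ //.
  by apply: gw_stable => //; apply: subvsP.
- by move=> f _ u; rewrite memv0 => /eqP->; rewrite linear0 mem0v.
- move=> f g /fsP[h ->] /fsP[k ->] u ul; rewrite memv0 !shiftE !adE.
  have hk : lie (vsval h) (lie (vsval k) u) = lie (vsval k) (lie (vsval h) u).
    by rewrite lie_der (cartan_abelian (subvsP h) (subvsP k)) lie0l add0r.
  rewrite subr_eq0 !lieDr !lieNr !lieZr hk !scalerBr !scalerA [(l k : F) * _]mulrC.
  rewrite !opprB !addrA; apply/eqP.
  by rewrite addrAC [RHS]addrAC; congr (_ + _); rewrite addrAC.
- move=> f /fsP[h ->] u /gwP/(_ h)[N eN]; exists N; rewrite eN; exact: mem0v.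
- by rewrite subv0; apply/negP; rewrite -wtsE.
exists e; last by apply/eqP; rewrite memv0 in e0.
rewrite memvE; apply/subv_bigcapP => i _; rewrite -memvE memv_ker.
rewrite -memv0; apply: ef; apply: map_f.
by rewrite mem_nth // size_tuple.
Qed.

Lemma dual_muln m n h : ((m *+ n) h : F) = n%:R * (m h : F).
Proof. by rewrite -[m *+ n]scaler_nat scale_lfunE. Qed.

Lemma dual_muln_eq0 l n : (l *+ n == 0) = (n == 0%N) || (l == 0).
Proof. by rewrite -scaler_nat scaler_eq0 natF_eq0. Qed.

(* [e], the negative multiples of [l] and [H] together span an [sl_2]-stable
   subspace on which [[e, f]] has trace [0]. *)
Lemma wts_multiple l : l \in wts -> l <> 0 ->
  \dim (gw (- l)) = 1%N /\ forall n, (1 < n)%N -> (- l) *+ n \notin wts.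
Proof.
move=> lw l0; have [e el e0] := weight_vec lw.
have eg := subvP (weight_gw l) _ el.
have [f fl kef] := killing_dual_vec eg e0.
have ll := rvec_neq0 l0 el fl kef.
pose P k := `[< exists n : nat, k = (- l) *+ n >].
pose t' := [seq k <- wts | P k].
have kP k : exists n : nat, k \in t' -> k = (- l) *+ n.
  have [kt|] := boolP (k \in t'); last by exists 0%N.
  by move: kt; rewrite mem_filter => /andP[/asboolP[n ->] _]; exists n.
have [nk {}kP] := choice kP.
have lnt n : (- l) *+ n != l.
  by rewrite -subr_eq0 mulNrn -opprD -mulrSr oppr_eq0 dual_muln_eq0 /=; apply/eqP.
have lt' : l \notin t'.
  by apply/negP => /kP e1; move: (lnt (nk l)); rewrite -e1 eqxx.
pose t := l :: t'.
have ut : uniq t by rewrite /= lt' filter_uniq // wts_uniq.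
(* The dimension of [gw l] is not yet known. Keeping only the line of [e] gives the trace relation
   the coefficient 1 at [l]. *)
pose A k := if k == l then <[e]>%VS else gw k.
have At n : A ((- l) *+ n) = gw ((- l) *+ n) by rewrite /A (negbTE (lnt n)).
have tn n : (- l) *+ n \in wts -> (- l) *+ n \in t.
  by move=> nw; rewrite inE mem_filter nw andbT; apply/orP; right; apply/asboolP; exists n.
have inS n u : u \in gw ((- l) *+ n) -> u \in (\sum_(k <- t) A k)%VS.
  move=> un; have [->|u0] := eqVneq u 0; first exact: mem0v.
  have nt := tn n (wts_mem char0 cartanH un u0).
  by apply: (subvP (seq_sum_sup A nt)); rewrite At.
have eS : e \in (\sum_(k <- t) A k)%VS.
  by apply: (subvP (seq_sum_sup A (mem_head _ _))); rewrite /A eqxx memv_line.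
have tP k : k \in t -> k = l \/ exists n, k = (- l) *+ n.
  by rewrite inE => /orP[/eqP->|/kP e1]; [left | right; exists (nk k)].
have hef : vsval (rvec l) = lie e f by rewrite (lie_rvec el fl) kef scale1r.
have sum0 : \sum_(k <- t) (\dim (A k))%:R * (k (rvec l) : F) = 0.
  apply: (gw_lie_trace cartanH ut _ _ _ _ hef)
    => k /tP[->|[n ->]]; [| |move=> u|move=> u|move=> u|move=> u|move=> u|move=> u].
  - by rewrite /A eqxx -memvE.
  - by rewrite At.
  - rewrite /A eqxx => /vlineP[c ->]; rewrite lieZr (lie_weight el) !rpredZ //.
    exact: memv_line.
  - by rewrite At => un; apply: gw_stable => //; apply: subvsP.
  - by rewrite /A eqxx => /vlineP[c ->]; rewrite lieZr liexx scaler0 mem0v.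
  - rewrite At; case: n => [|n] un.
      rewrite mulr0n gw0E in un; rewrite lieC rpredN -[u](vsprojK un) (lie_weight el).
      by rewrite rpredZ.
    apply: (inS n); rewrite (_ : _ *+ n = l + (- l) *+ n.+1); first exact: gw_lie.
    by rewrite mulrS addrA subrr add0r.
  - rewrite /A eqxx => /vlineP[c ->]; rewrite lieZr rpredZ // lieC rpredN.
    by apply: (inS 0%N); rewrite mulr0n -(subrr l); apply: gw_lie.
  - rewrite At => un; apply: (inS n.+1); rewrite mulrS; exact: gw_lie.
(* Divided by [l (rvec l)], the trace relation says that the sum of [n] times the dimension of
   [gw (- n l)] is 1. The term [n = 1] is positive, so it is 1 and no term with larger [n]
   occurs. *)
have {sum0} sum1 : (\sum_(k <- t') \dim (gw k) * nk k = 1)%N.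
  have e2 : \sum_(k <- t') (\dim (A k))%:R * (k (rvec l) : F) =
      - ((\sum_(k <- t') \dim (gw k) * nk k)%N%:R * (l (rvec l) : F)).
    rewrite natr_sum mulr_suml -sumrN !big_seq; apply: eq_bigr => k kt.
    rewrite natrM -mulrA -mulrN; congr (_ * _).
      by rewrite /A; case: eqP => // kl; rewrite -kl kt in lt'.
    by rewrite {1}(kP k kt) dual_muln opp_lfunE mulrN.
  have d1 : \dim (A l) = 1%N by rewrite /A eqxx dim_vline; move/eqP: e0 => ->.
  move: sum0; rewrite big_cons e2 d1 => /eqP; rewrite subr_eq0 eq_sym => /eqP.
  move/(mulIf (introN eqP ll)) => e3; apply/eqP.
  by rewrite -eqz_nat; apply/eqP/(intF_inj char0).
have lNt : - l \in t'.
  by rewrite mem_filter wtsN // andbT; apply/asboolP; exists 1%N.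
have ut' : uniq t' by case/andP: ut.
have nk1 n : (- l) *+ n \in t' -> nk ((- l) *+ n) = n.
  move/kP/eqP; rewrite eq_sym -subr_eq0 => /eqP e1.
  have [le|lt] := leqP n (nk ((- l) *+ n)).
    move/eqP: e1; rewrite -mulrnBr // dual_muln_eq0 oppr_eq0 subn_eq0.
    by case/orP => [le'|/eqP//]; apply/eqP; rewrite eqn_leq le le'.
  move/eqP: e1; rewrite -oppr_eq0 opprB -mulrnBr ?(ltnW lt) // dual_muln_eq0 oppr_eq0 subn_eq0.
  by rewrite leqNgt lt => /eqP.
have dpos k : k \in t' -> (0 < \dim (gw k))%N.
  by rewrite mem_filter => /andP[_]; rewrite wtsE lt0n dimv_eq0.
have nl1 : nk (- l) = 1%N by rewrite -[- l]mulr1n nk1 // mulr1n.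
split.
  move: sum1; rewrite (big_rem (- l)) //= nl1 muln1; have := dpos _ lNt.
  by case: (\dim _) => [|[|n]].
move=> n n1; apply/negP => nw.
have nt : (- l) *+ n \in t'.
  by rewrite mem_filter nw andbT; apply/asboolP; exists n.
move: sum1; rewrite (big_rem ((- l) *+ n)) //= nk1 //.
by case: (\dim _) (dpos _ nt) n1 => // d _; case: n {nw nt} => [|[|n]].
Qed.

Lemma dim_gw l : l \in wts -> l <> 0 -> \dim (gw l) = 1%N.
Proof.
move=> lw l0; rewrite -[l]opprK; case: (@wts_multiple (- l)) => //.
  exact: wtsN.
by move/eqP; rewrite oppr_eq0 => /eqP.
Qed.

Lemma wts_noncollinear a b : a \in wts -> a <> 0 -> b \in wts -> b <> 0 ->
  b <> a -> b <> - a -> forall k : int, b + a *~ k <> 0.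
Proof.
move=> aw a0 bw b0 ba bna k.
have aNw := wtsN aw.
have aN0 : - a <> 0 by move/eqP; rewrite oppr_eq0 => /eqP.
case: k => n; rewrite ?NegzE ?mulrNz => /eqP.
  rewrite addr_eq0 -mulNrn => /eqP eb; case: n eb => [|[|n]] eb //.
  by have [_ /(_ n.+2 isT)] := wts_multiple aw a0; rewrite -eb bw.
rewrite subr_eq0 => /eqP eb; case: n eb => [|n] eb //.
by have [_ /(_ n.+2 isT)] := wts_multiple aNw aN0; rewrite opprK -[_ *+ _]eb bw.
Qed.

Lemma weight_gwE l : l \in wts -> gw l = weight_space l.
Proof.
move=> lw; apply/eqP; rewrite eq_sym; have [->|/eqP l0] := eqVneq l 0.
  rewrite eqEsubv weight_gw gw0E /=; apply/subvP => x xH; apply/weight_spaceP => h.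
  by rewrite zero_lfunE scale0r; apply: cartan_abelian => //; apply: subvsP.
have [e el e0] := weight_vec lw.
rewrite eqEdim weight_gw dim_gw // lt0n dimv_eq0.
by apply/eqP => w0; rewrite w0 memv0 in el; apply/e0/eqP.
Qed.

Lemma is_rootE a : is_root a <-> a \in wts /\ a <> 0.
Proof.
split=> [[a0 wa]|[aw a0]].
  split=> //; rewrite wtsE; apply/eqP => g0; apply: wa; apply/eqP.
  by rewrite -subv0 -g0 weight_gw.
by split=> //; rewrite -weight_gwE //; apply/eqP; rewrite -wtsE.
Qed.

Lemma is_rootN a : is_root a -> is_root (- a).
Proof.
move/is_rootE=> [aw a0]; apply/is_rootE; split; first exact: wtsN.
by move/eqP; rewrite oppr_eq0 => /eqP.
Qed.

Lemma root_triple a : is_root a -> exists e f,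
  [/\ e \in weight_space a, f \in weight_space (- a), killing e f = 1,
      vsval (rvec a) = lie e f & (a (rvec a) : F) <> 0].
Proof.
move/is_rootE=> [aw a0]; have [e ea e0] := weight_vec aw.
have eg := subvP (weight_gw a) _ ea.
have [f fa kef] := killing_dual_vec eg e0.
exists e, f; split; [exact: ea | | exact: kef | |].
- by rewrite -weight_gwE // wtsN.
- by rewrite (lie_rvec ea fa) kef scale1r.
exact: rvec_neq0 ea fa kef.
Qed.

(** The trace of [[e, f]] on the string from [c] to [c + n a] is the sum of an arithmetic
    progression with [n + 1] terms. The last condition asks only for vanishing brackets at the top,
    so that [lie_root_neq0] can use a string cut off below its actual end. *)
Lemma string_trace a c n : is_root a ->
  (forall i, (i <= n)%N -> is_root (c + a *+ i)) -> c <> a -> ~ is_root (c - a) ->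
  (forall x u, x \in weight_space a -> u \in weight_space (c + a *+ n) -> lie x u = 0) ->
  (c (rvec a) : F) *+ 2 + (a (rvec a) : F) *+ n = 0.
Proof.
move=> ra str ca bot top; have [e [f [ea fa kef hef aa]]] := root_triple ra.
have [aw a0] := (is_rootE a).1 ra.
have inj i j : c + a *+ i = c + a *+ j -> i = j.
  move/addrI; wlog le : i j / (i <= j)%N => [hw|/esym/eqP].
    by case/orP: (leq_total i j) => /hw h // /esym/h.
  rewrite -subr_eq0 -mulrnBr // dual_muln_eq0 subn_eq0 => /orP[le'|/eqP//].
  by apply/eqP; rewrite eqn_leq le le'.
pose t := [seq c + a *+ i | i <- iota 0 n.+1].
have ut : uniq t.
  by rewrite map_inj_in_uniq ?iota_uniq // => i j _ _; apply: inj.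
have tP k : k \in t -> exists2 i, (i <= n)%N & k = c + a *+ i.
  by move=> /mapP[i]; rewrite mem_iota add0n ltnS => /andP[_ ile] ->; exists i.
have tin i : (i <= n)%N -> c + a *+ i \in t.
  by move=> ile; apply: (map_f (fun i => c + a *+ i)); rewrite mem_iota add0n ltnS.
have strw i : (i <= n)%N -> c + a *+ i \in wts /\ c + a *+ i <> 0.
  by move=> /str /is_rootE.
have eg := subvP (weight_gw a) _ ea; have fg := subvP (weight_gw (- a)) _ fa.
have sum0 : \sum_(k <- t) (\dim (gw k))%:R * (k (rvec a) : F) = 0.
  apply: (gw_lie_trace cartanH ut _ _ _ _ hef) => k /tP[i ile ->] // u.
  - by move=> ug; apply: gw_stable => //; apply: subvsP.
  - move=> ug; move: ile; rewrite leq_eqVlt => /orP[/eqP ein|lt].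
      have uw : u \in weight_space (c + a *+ n).
        by have [iw _] := strw i (eq_leq ein); rewrite -ein -weight_gwE.
      by rewrite (top e u ea uw) mem0v.
    apply: (subvP (seq_sum_sup _ (tin i.+1 lt))).
    by rewrite mulrS addrCA; apply: gw_lie.
  move=> ug; case: i ile ug => [|i] ile ug.
    have ug' : lie f u \in gw (c - a).
      by rewrite addrC -[c in _ + c]addr0; apply: gw_lie.
    have [->|ne] := eqVneq (lie f u) 0; first exact: mem0v.
    case: bot; apply/is_rootE; split; first exact: (wts_mem _ _ ug' ne).
    by move/eqP; rewrite subr_eq0 => /eqP.
  apply: (subvP (seq_sum_sup _ (tin i (ltnW ile)))).
  have -> : c + a *+ i = - a + (c + a *+ i.+1) by rewrite mulrS (addrCA c) addKr.
  exact: gw_lie.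
have : \sum_(k <- t) (\dim (gw k))%:R * (k (rvec a) : F) =
    \sum_(0 <= i < n.+1) ((c (rvec a) : F) + (a (rvec a) : F) *+ i).
  rewrite /t big_map /index_iota subn0 !big_seq; apply: eq_bigr => i.
  rewrite mem_iota add0n ltnS => /andP[_ ile]; have [iw i0] := strw i ile.
  by rewrite dim_gw // mul1r add_lfunE dual_muln mulr_natl.
rewrite sum0 => s0.
have arith (C A : F) (m : nat) : (\sum_(0 <= i < m.+1) (C + A *+ i)) *+ 2 = (C *+ 2 + A *+ m) *+ m.+1.
  elim: m => [|m IH]; first by rewrite big_nat1 mulr0n !addr0.
  by rewrite big_nat_recr //= mulrnDl IH; ring.
move/eqP: (arith (c (rvec a)) (a (rvec a)) n); rewrite -s0 mul0rn eq_sym.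
by rewrite -mulr_natl mulf_eq0 natF_eq0 // => /eqP.
Qed.

Lemma root_string_end a b : is_root a -> (forall k : int, b + a *~ k <> 0) -> is_root b ->
  exists2 q, forall i, (i <= q)%N -> is_root (b + a *+ i) & ~ is_root (b + a *+ q.+1).
Proof.
move=> ra nc rb; apply: contrapT => ne.
have all_roots n : forall i, (i <= n)%N -> is_root (b + a *+ i).
  elim: n => [|n IH] i; first by rewrite leqn0 => /eqP->; rewrite addr0.
  rewrite leq_eqVlt => /orP[/eqP->|]; last exact: IH.
  by apply: contrapT => nr; apply: ne; exists n.
have [_ a0] := (is_rootE a).1 ra.
pose t := [seq b + a *+ i | i <- iota 0 (size wts).+1].
have ut : uniq t.
  rewrite map_inj_in_uniq ?iota_uniq // => i j _ _ /addrI.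
  wlog le : i j / (i <= j)%N => [hw|/esym/eqP].
    by case/orP: (leq_total i j) => /hw h // /esym/h.
  rewrite -subr_eq0 -mulrnBr // dual_muln_eq0 subn_eq0 => /orP[le'|/eqP//].
  by apply/eqP; rewrite eqn_leq le le'.
have tw : {subset t <= wts}.
  by move=> _ /mapP[i _ ->]; have /is_rootE[] := all_roots i i (leqnn i).
by have := uniq_leq_size ut tw; rewrite size_map size_iota ltnn.
Qed.

Lemma root_string a b : is_root a -> (forall k : int, b + a *~ k <> 0) -> is_root b ->
  exists p q : nat,
  [/\ forall i, (i <= p)%N -> is_root (b - a *+ i),
      ~ is_root (b - a *+ p.+1),
      forall i, (i <= q)%N -> is_root (b + a *+ i),
      ~ is_root (b + a *+ q.+1) &
      (b (rvec a) : F) *+ 2 = (a (rvec a) : F) * (p%:R - q%:R)].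
Proof.
move=> ra nc rb; have [q qs qe] := root_string_end ra nc rb.
have [|p ps pe] := @root_string_end (- a) b (is_rootN ra) _ rb.
  by move=> k; rewrite mulNrz -mulrNz; apply: nc.
have ps' i : (i <= p)%N -> is_root (b - a *+ i) by rewrite -mulNrn; apply: ps.
have pe' : ~ is_root (b - a *+ p.+1) by rewrite -mulNrn.
exists p, q; split; [exact: ps' | exact: pe' | exact: qs | exact: qe |].
have top : b - a *+ p + a *+ (p + q) = b + a *+ q by rewrite mulrnDr addrA subrK.
have : ((b - a *+ p) (rvec a) : F) *+ 2 + (a (rvec a) : F) *+ (p + q) = 0.
  apply: (string_trace ra).
  - move=> i ile; have [le|/ltnW le] := leqP i p.
      rewrite (_ : _ + _ = b - a *+ (p - i)); first by apply: ps'; apply: leq_subr.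
      by rewrite (mulrnBr a le) opprB addrA addrAC.
    rewrite (_ : _ + _ = b + a *+ (i - p)); first by apply: qs; lia.
    by rewrite (mulrnBr a le) addrA addrAC.
  - move/eqP; rewrite -subr_eq0 -addrA -opprD -mulrSr => /eqP e.
    by apply: (nc (- (p.+1)%:Z)); rewrite mulrNz.
  - by rewrite -addrA -opprD -mulrSr.
  move=> x u xa; rewrite top => ub.
  have xu : lie x u \in gw (b + a *+ q.+1).
    rewrite mulrS addrCA; apply: gw_lie; exact: (subvP (weight_gw _)).
  apply/eqP; apply: contrapT => /negP ne; apply: qe; apply/is_rootE; split.
    exact: (wts_mem _ _ xu ne).
  exact: (nc q.+1).
rewrite add_lfunE opp_lfunE dual_muln => /eqP; rewrite addr_eq0 => /eqP e.
rewrite (_ : (b (rvec a) : F) *+ 2 = ((b (rvec a) : F) - p%:R * a (rvec a)) *+ 2 + (p%:R * (a (rvec a) : F)) *+ 2).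
  by rewrite e -[_ *+ (p + q)]mulr_natr natrD; ring.
by rewrite -mulrnDl subrK.
Qed.

(** If all these brackets vanished, [string_trace] would also apply to the part of the string up to
    [b]. Comparison with the whole string gives [q = 0], although [b + a] is a root. *)
Lemma lie_root_neq0 a b : is_root a -> is_root b -> is_root (b + a) ->
  (forall k : int, b + a *~ k <> 0) ->
  exists x y, [/\ x \in weight_space a, y \in weight_space b & lie x y <> 0].
Proof.
move=> ra rb rab nc; apply: contrapT => ne.
have [e [f [_ _ _ _ aa]]] := root_triple ra.
have [p [q [ps pe qs qe eb]]] := root_string ra nc rb.
have : ((b - a *+ p) (rvec a) : F) *+ 2 + (a (rvec a) : F) *+ p = 0.
  apply: (string_trace ra).
  - move=> i le; rewrite (_ : _ + _ = b - a *+ (p - i)); first by apply: ps; apply: leq_subr.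
    by rewrite (mulrnBr a le) opprB addrA addrAC.
  - move/eqP; rewrite -subr_eq0 -addrA -opprD -mulrSr => /eqP e0.
    by apply: (nc (- (p.+1)%:Z)); rewrite mulrNz.
  - by rewrite -addrA -opprD -mulrSr.
  move=> x u xa; rewrite subrK => ub.
  by apply: contrapT => xu; apply: ne; exists x, u.
rewrite add_lfunE opp_lfunE dual_muln mulrnDl eb => /eqP.
rewrite (_ : _ + _ = - ((a (rvec a) : F) * q%:R)); last by ring.
rewrite oppr_eq0 mulf_eq0 natF_eq0 // => /orP[/eqP//|/eqP q0].
by apply: qe; rewrite q0 mulr1n.
Qed.

Lemma root_noncollinear a b : is_root a -> is_root b -> b <> a -> b <> - a ->
  forall k : int, b + a *~ k <> 0.
Proof.
by move=> /is_rootE[aw a0] /is_rootE[bw b0]; apply: wts_noncollinear.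
Qed.

Lemma weight0E : weight_space (0 : dualH) = H.
Proof.
have [w0|w0] := boolP ((0 : dualH) \in wts); first by rewrite -weight_gwE // gw0E.
have H0 : H = 0%VS by rewrite -gw0E; apply/eqP; rewrite wtsE negbK in w0.
apply/eqP; rewrite eqEsubv; apply/andP; split; last by rewrite [X in (X <= _)%VS]H0 sub0v.
by apply: subv_trans (weight_gw _) _; rewrite gw0E subvv.
Qed.

Lemma root_decomposition (Gamma : {fset dualH}) : root_system Gamma ->
  fullv = (H + \sum_(a <- Gamma) weight_space a)%VS.
Proof.
move=> rG; apply/eqP; rewrite eq_sym eqEsubv subvf /= (wts_sum char0 cartanH).
apply: seq_sum_subP => l lw; rewrite weight_gwE //.
have [->|/eqP l0] := eqVneq l 0; first by rewrite weight0E addvSl.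
have lG : l \in Gamma by apply/rG/is_rootE.
exact: subv_trans (seq_sum_sup _ lG) (addvSr _ _).
Qed.

Lemma weight_disj (s : seq dualH) l x : uniq s -> l \notin s -> x \in weight_space l ->
  x \in (\sum_(m <- s) weight_space m)%VS -> x = 0.
Proof.
move=> us ls xl; apply: (gw_sum_disj cartanH us ls) => [m _|]; first exact: weight_gw.
exact: (subvP (weight_gw l)).
Qed.

Lemma weight_lie l m x y : x \in weight_space l -> y \in weight_space m ->
  lie x y \in weight_space (l + m).
Proof.
move=> xl ym; apply/weight_spaceP => h; rewrite lie_der (lie_weight xl) (lie_weight ym).
by rewrite lieZl lieZr -scalerDl add_lfunE.
Qed.

Lemma root_formE a b : root_form a b = (a (rvec b) : F).
Proof. by rewrite /root_form !root_vecE rvecP. Qed.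

Lemma cartan_numberP a b : is_root a -> (b (rvec a) : F) *+ 2 = cartan_number b a * a (rvec a).
Proof.
move=> ra; have [e [f [_ _ _ _ /eqP aa]]] := root_triple ra.
by rewrite /cartan_number !root_formE divfK.
Qed.

Lemma cartan_number_string a b : is_root a -> is_root b -> b <> a -> b <> - a ->
  exists p q : nat,
  [/\ forall i, (i <= p)%N -> is_root (b - a *+ i),
      ~ is_root (b - a *+ p.+1),
      forall i, (i <= q)%N -> is_root (b + a *+ i),
      ~ is_root (b + a *+ q.+1) &
      cartan_number b a = (p%:Z - q%:Z)%:~R].
Proof.
move=> ra rb ba bna.
have [p [q [h1 h2 h3 h4 e]]] := root_string ra (root_noncollinear ra rb ba bna) rb.
exists p, q; split; [exact: h1 | exact: h2 | exact: h3 | exact: h4 |].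
rewrite /cartan_number !root_formE e.
have [_ [_ [_ _ _ _ /eqP aa]]] := root_triple ra.
by rewrite mulrAC divff // mul1r rmorphB.
Qed.

(* The factor comparing the two Cartan integers of a pair of roots is the
   positive integer [sum_g cint g a ^ 2 = 4 / (a, a)]. *)
Lemma root_form_int a (c : dualH -> int) : is_root a ->
  (forall l, l \in wts -> cartan_number l a = (c l)%:~R) ->
  exists2 N : int, 0 < N & N%:~R * (a (rvec a) : F) = 4.
Proof.
move=> ra cP; have [_ [_ [_ _ _ _ /eqP aa]]] := root_triple ra.
exists (\sum_(l <- wts) (\dim (gw l))%:Z * (c l * c l)).
  have /is_rootE[aw a0] := ra.
  have ca : c a != 0.
    rewrite -(intF_eq0 char0) -cP // /cartan_number !root_formE -mulr_natl mulfK //.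
    by rewrite (natF_eq0 char0 2).
  rewrite (big_rem a) //= ltr_pwDl //.
    by rewrite dim_gw // mul1r -expr2 exprn_even_gt0.
  by apply: sumr_ge0 => l _; rewrite mulr_ge0 // -expr2 sqr_ge0.
apply: (mulIf aa); rewrite -mulrA -[X in 4 * X](rvecP a (rvec a)) killingH.
rewrite rmorph_sum mulr_suml mulr_sumr /= !big_seq; apply: eq_bigr => l lw.
have e := cartan_numberP l ra; rewrite cP // in e.
transitivity ((\dim (gw l))%:R * (((c l)%:~R * (a (rvec a) : F)) * ((c l)%:~R * (a (rvec a) : F)))).
  by rewrite !rmorphM /=; ring.
by rewrite -e; ring.
Qed.


End Structure.

(** * Simple roots and parabolic subalgebras *)

Section CartanIntegers.

Variables (F : closedFieldType) (char0 : [pchar F]%R =i pred0).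
Variables (L : lieAlgType F) (H : {vspace L}).
Hypothesis cartanH : cartan_subalgebra H.
Hypothesis simpleL : lie_simple L.

Local Notation dualH := (dual H).
Implicit Types (a b c : dualH).

(** The value 0 is a default for non-integral Cartan numbers; by [cintP] it is not reached in this
    way for roots. *)
Definition cint b a : int :=
  if pselect (exists n : int, cartan_number b a = n%:~R) is left ex
  then projT1 (cid ex) else 0.

Lemma cartan_number_diag a : is_root a -> cartan_number a a = 2.
Proof.
move=> ra; have [_ [_ [_ _ _ _ /eqP aa]]] := root_triple char0 cartanH simpleL ra.
by rewrite /cartan_number !(root_formE char0 cartanH simpleL) -[X in X / _]mulr_natl mulfK.
Qed.

Lemma cartan_numberD a b c : cartan_number (b + c) a = cartan_number b a + cartan_number c a.
Proof.
by rewrite /cartan_number !(root_formE char0 cartanH simpleL) add_lfunE mulrnDl mulrDl.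
Qed.

Lemma cartan_numberMz a b (k : int) : cartan_number (b *~ k) a = k%:~R * cartan_number b a.
Proof.
by rewrite /cartan_number !(root_formE char0 cartanH simpleL) dual_mulz -mulrnAr mulrA.
Qed.

Lemma cartan_numberN a b : cartan_number (- b) a = - cartan_number b a.
Proof. by rewrite -[- b]/(b *~ -1) cartan_numberMz mulN1r. Qed.

Lemma cint_eq b a (n : int) : cartan_number b a = n%:~R -> cint b a = n.
Proof.
rewrite /cint; case: pselect => [ex|ne e]; last by case: ne; exists n.
by case: (cid ex) => /= m -> /intF_inj-/(_ char0).
Qed.

Lemma cint_diag a : is_root a -> cint a a = 2.
Proof. by move=> ra; apply: cint_eq; rewrite cartan_number_diag. Qed.

Lemma cintNdiag a : is_root a -> cint (- a) a = - 2.
Proof. by move=> ra; apply: cint_eq; rewrite cartan_numberN cartan_number_diag // rmorphN. Qed.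

Lemma cint_string a b : is_root a -> is_root b -> b <> a -> b <> - a ->
  exists p q : nat,
  [/\ forall i, (i <= p)%N -> is_root (b - a *+ i),
      forall i, (i <= q)%N -> is_root (b + a *+ i) &
      cint b a = p%:Z - q%:Z].
Proof.
move=> ra rb ba bna.
have [p [q [h1 _ h2 _ e]]] := cartan_number_string char0 cartanH simpleL ra rb ba bna.
by exists p, q; split=> //; apply: cint_eq.
Qed.

Lemma cintP a b : is_root a -> is_root b -> cartan_number b a = (cint b a)%:~R.
Proof.
move=> ra rb; have [->|/eqP ba] := eqVneq b a.
  by rewrite cint_diag // cartan_number_diag.
have [->|/eqP bna] := eqVneq b (- a).
  by rewrite cintNdiag // cartan_numberN cartan_number_diag // rmorphN.
have [p [q [_ _ _ _ e]]] := cartan_number_string char0 cartanH simpleL ra rb ba bna.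
by rewrite (cint_eq e).
Qed.

(** Subtracting [(p - q) a] does not leave the string from [b - p a] to [b + q a]. *)
Lemma root_reflection a b : is_root a -> is_root b -> is_root (b - a *~ cint b a).
Proof.
move=> ra rb; have [->|/eqP ba] := eqVneq b a.
  by rewrite cint_diag // (mulrzDr a 1 1) mulr1z opprD addNKr; apply: is_rootN.
have [->|/eqP bna] := eqVneq b (- a).
  have -> : cint (- a) a = (-1) + (-1) by rewrite cintNdiag.
  by rewrite mulrzDr mulrN1z opprD opprK addKr.
have [p [q [ps qs ->]]] := cint_string ra rb ba bna.
have [le|/ltnW le] := leqP q p.
  rewrite subzn //; apply: ps; exact: leq_subr.
by rewrite -[p%:Z - _]opprB subzn // mulrNz opprK; apply: qs; apply: leq_subr.
Qed.

Lemma root_sub a b : is_root a -> is_root b -> b <> a -> 0 < cint b a -> is_root (b - a).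
Proof.
move=> ra rb ba; have [->|/eqP bna] := eqVneq b (- a); first by rewrite cintNdiag.
have [p [q [ps _ ->]]] := cint_string ra rb ba bna.
case: p ps => [|p] ps pos; first by lia.
by have := ps 1%N isT.
Qed.

(** The form is symmetric, and by [root_form_int] both [(a, a)] and [(b, b)] are 4 divided by a
    positive integer. This carries signs from one Cartan integer to the other although [F] has no
    order. *)
Lemma cint_sym a b : is_root a -> is_root b ->
  exists N M : int, [/\ 0 < N, 0 < M & cint b a * N = cint a b * M].
Proof.
move=> ra rb.
have ex c l : is_root c -> l \in wts char0 cartanH -> cartan_number l c = (cint l c)%:~R.
  move=> rc lw; have [->|/eqP l0] := eqVneq l 0; last by apply: cintP => //; apply/(is_rootE char0 cartanH simpleL).
  have e0 : cartan_number (0 : dualH) c = 0 by rewrite -(mulr0z c) cartan_numberMz mul0r.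
  by rewrite (cint_eq (n := 0)) ?e0.
have [Na Na0 eNa] := root_form_int simpleL ra (fun l => @ex a l ra).
have [Nb Nb0 eNb] := root_form_int simpleL rb (fun l => @ex b l rb).
exists Nb, Na; split=> //; apply: (intF_inj char0); rewrite !rmorphM /=.
have n4 : 4 != 0 :> F by rewrite (natF_eq0 char0 4).
apply: (mulfI n4); rewrite -{1}eNa -eNb -!cintP //.
have e1 := cartan_numberP char0 cartanH simpleL b ra.
have e2 := cartan_numberP char0 cartanH simpleL a rb.
rewrite (rvec_sym char0 cartanH simpleL) e2 in e1.
transitivity (Na%:~R * Nb%:~R * (cartan_number b a * (a (rvec a) : F))); first by ring.
by rewrite -e1; ring.
Qed.

Lemma cint_gt0 a b : is_root a -> is_root b -> (0 < cint b a) = (0 < cint a b).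
Proof.
move=> ra rb; have [N [M [N0 M0 e]]] := cint_sym ra rb.
by rewrite -(pmulr_lgt0 _ N0) e pmulr_lgt0.
Qed.

Lemma cint_eq0 a b : is_root a -> is_root b -> (cint b a == 0) = (cint a b == 0).
Proof.
move=> ra rb; have [N [M [N0 M0 e]]] := cint_sym ra rb.
have : (cint b a * N == 0) = (cint a b * M == 0) by rewrite e.
by rewrite !mulf_eq0 (gt_eqF N0) (gt_eqF M0) !orbF.
Qed.

End CartanIntegers.

(** * Coefficients of roots, induction on the height, and coweights *)

Section SimpleRoots.

Variables (F : closedFieldType) (char0 : [pchar F]%R =i pred0).
Variables (L : lieAlgType F) (H : {vspace L}).
Hypothesis cartanH : cartan_subalgebra H.
Hypothesis simpleL : lie_simple L.

Local Notation dualH := (dual H).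
Implicit Types (a b c : dualH).

Variables (Gamma Sigma : {fset dualH}).
Hypotheses (rootsG : root_system Gamma) (simpleS : simple_system Gamma Sigma).
Variables (n : nat) (al : 'I_n -> dualH).
Hypothesis alS : perm_eq [seq al i | i <- enum 'I_n] Sigma.

Definition comb (m : 'I_n -> int) : dualH := \sum_i al i *~ m i.

Lemma comb_sum (f : dualH -> dualH) : \sum_(s <- Sigma) f s = \sum_i f (al i).
Proof. by rewrite -(perm_big _ alS) /= big_map big_enum. Qed.

Lemma al_mem i : al i \in Sigma.
Proof. by rewrite -(perm_mem alS) map_f // mem_enum. Qed.

Lemma al_inj : injective al.
Proof.
have : uniq [seq al i | i <- enum 'I_n] by rewrite (perm_uniq alS) fset_uniq.
by move/injectiveP.
Qed.

Lemma al_surj s : s \in Sigma -> exists i, s = al i.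
Proof. by rewrite -(perm_mem alS) => /mapP[i _ ->]; exists i. Qed.

Lemma simple_root i : is_root (al i).
Proof. by apply/rootsG; have [sub _ _] := simpleS; apply/sub/al_mem. Qed.

Lemma comb0_inj m : comb m = 0 -> forall i, m i = 0.
Proof.
have [_ freeS _] := simpleS; move=> cm0 i.
have freeal : free [seq al i | i <- enum 'I_n] by rewrite (perm_free alS).
have sz : size [seq al i | i <- enum 'I_n] = n by rewrite size_map size_enum_ord.
pose X : n.-tuple dualH := Tuple (introT eqP sz).
have Xi (j : 'I_n) : X`_j = al j.
  by rewrite /= (nth_map j) ?size_enum_ord // nth_ord_enum.
have /freeP/(_ (fun j => (m j)%:~R)) : free X by [].
move=> h; apply/eqP; rewrite -(intF_eq0 char0); apply/eqP; apply: h.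
by rewrite -[RHS]cm0; apply: eq_bigr => j _; rewrite Xi scaler_int.
Qed.

Lemma combB m m' : comb m - comb m' = comb (fun i => m i - m' i).
Proof. by rewrite /comb -sumrB; apply: eq_bigr => i _; rewrite mulrzBr. Qed.

Lemma combN m : - comb m = comb (fun i => - m i).
Proof. by rewrite /comb -sumrN; apply: eq_bigr => i _; rewrite mulrNz. Qed.

Lemma eq_comb m m' : m =1 m' -> comb m = comb m'.
Proof. by move=> e; apply: eq_bigr => i _; rewrite e. Qed.

Lemma comb_inj m m' : comb m = comb m' -> m =1 m'.
Proof.
move=> /eqP; rewrite -subr_eq0 combB => /eqP/comb0_inj e i.
by apply/eqP; rewrite -subr_eq0 e.
Qed.

Lemma al_comb j (c : int) : al j *~ c = comb (fun i => if i == j then c else 0).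
Proof.
by rewrite /comb (bigD1 j) //= eqxx big1 ?addr0 // => i /negbTE->; rewrite mulr0z.
Qed.

Lemma al_comb1 j : al j = comb (fun i => if i == j then 1 else 0).
Proof. by rewrite -al_comb mulr1z. Qed.

Lemma root_comb g : is_root g ->
  exists m, g = comb m /\ ((forall i, 0 <= m i) \/ (forall i, m i <= 0)).
Proof.
have [_ _ sgn] := simpleS.
move=> /rootsG/sgn[[m e]|[m e]].
  exists (fun i => (m (al i))%:Z); split; last by left.
  by rewrite e comb_sum.
exists (fun i => - (m (al i))%:Z); split; last by right=> i; rewrite oppr_le0.
by rewrite -[g]opprK e comb_sum -combN.
Qed.

Lemma root_comb_sign m : is_root (comb m) -> (forall i, 0 <= m i) \/ (forall i, m i <= 0).
Proof.
move=> /root_comb[m' [/comb_inj e [h|h]]]; [left|right] => i; rewrite e; exact: h.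
Qed.

Definition gcm i j : int := cint (al i) (al j).

Lemma gcm_diag i : gcm i i = 2.
Proof. by apply: cint_diag => //; apply: simple_root. Qed.

(** Otherwise [al i - al j] would be a root with coefficients of both signs. *)
Lemma gcm_le0 i j : i != j -> gcm i j <= 0.
Proof.
move=> ij; rewrite leNgt; apply/negP => pos.
have : is_root (al i - al j).
  apply: root_sub => //; try exact: simple_root.
  by move/al_inj => e; rewrite e eqxx in ij.
rewrite !al_comb1 combB => /root_comb_sign[/(_ j)|/(_ i)]; rewrite eqxx.
  by rewrite eq_sym (negbTE ij).
by rewrite (negbTE ij).
Qed.

Lemma gcm_eq0 i j : (gcm i j == 0) = (gcm j i == 0).
Proof. by apply: cint_eq0 => //; apply: simple_root. Qed.

Lemma cartan_number_comb m b : cartan_number (comb m) b = \sum_i (m i)%:~R * cartan_number (al i) b.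
Proof.
rewrite /comb; elim/big_ind2: _ => [|x u y v <- <-|i _].
- by rewrite -[0 in LHS](mulr0z (0 : dualH)) cartan_numberMz // mul0r.
- by rewrite cartan_numberD.
by rewrite cartan_numberMz.
Qed.

Lemma cint_comb m b : is_root b -> is_root (comb m) ->
  cint (comb m) b = \sum_i m i * cint (al i) b.
Proof.
move=> rb rm; apply: (intF_inj char0); rewrite -cintP // cartan_number_comb rmorph_sum.
by apply: eq_bigr => i _; rewrite rmorphM /= -cintP //; apply: simple_root.
Qed.

(** If no [cint (comb m) (al j)] were positive, expanding [cint (comb m) (comb m)] in its first
    argument would give a value at most 0, but it is 2. All inductions on the height rest on this
    descent. *)
Lemma pos_descent m : (forall i, 0 <= m i) -> is_root (comb m) ->
  (exists j, comb m = al j) \/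
  exists j, [/\ 0 < cint (comb m) (al j),
    is_root (comb (fun i => m i - if i == j then cint (comb m) (al j) else 0)),
    forall i, 0 <= m i - (if i == j then cint (comb m) (al j) else 0) &
    is_root (comb (fun i => m i - if i == j then 1 else 0))].
Proof.
move=> m0 rm; have [[j e]|ns] := pselect (exists j, comb m = al j); first by left; exists j.
right; have [j cj] : exists j, 0 < cint (comb m) (al j).
  apply: contrapT => ne.
  have : cint (comb m) (comb m) <= 0.
    rewrite cint_comb // sumr_le0 // => i _; rewrite mulr_ge0_le0 // leNgt.
    rewrite cint_gt0 //; last exact: simple_root.
    by apply/negP => c; apply: ne; exists i.
  by rewrite cint_diag.
have mj : comb m <> al j by move=> e; apply: ns; exists j.
set c := cint _ _ in cj *.
have rc : is_root (comb (fun i => m i - if i == j then c else 0)).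
  by rewrite -combB -al_comb; apply: root_reflection => //; apply: simple_root.
have r1 : is_root (comb (fun i => m i - if i == j then 1 else 0)).
  by rewrite -combB -al_comb1; apply: root_sub => //; apply: simple_root.
exists j; split=> // i.
(* If the reflected root were negative, [comb m] would involve [al j] only and be an integer
   multiple of it, which [root_noncollinear] excludes. *)
have [h|h] := root_comb_sign rc; first exact: h.
have mi k : k != j -> m k = 0.
  move=> kj; have := h k; rewrite (negbTE kj) subr0 => le.
  by apply/eqP; rewrite eq_le le m0.
have ej : comb m = al j *~ m j.
  by rewrite al_comb; apply: eq_comb => k; case: eqVneq => [->|/mi].
have mjN : comb m <> - al j.
  rewrite al_comb1 combN => /comb_inj/(_ j); rewrite eqxx => mjj.
  by have := m0 j; rewrite mjj.
have nc := root_noncollinear char0 cartanH simpleL (simple_root j) rm mj mjN.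
by case: (nc (- m j)); rewrite ej mulrNz subrr.
Qed.

(* [lam] lists the values on the simple roots of an integral coweight; [good] bounds
   it by [1] on all roots, and [fire k] is the simple reflection [s_k]. *)
Definition pairing (m lam : 'I_n -> int) : int := \sum_i m i * lam i.

Definition good lam := forall m, is_root (comb m) -> `|pairing m lam| <= 1.

Definition fire k (lam : 'I_n -> int) j := lam j - gcm j k * lam k.

(** Firing is the transpose of the simple reflection. *)
Lemma pair_fire m k lam : is_root (comb m) ->
  pairing m (fire k lam) = pairing (fun i => m i - if i == k then cint (comb m) (al k) else 0) lam.
Proof.
move=> rm; rewrite /pairing /fire.
rewrite (eq_bigr (fun i => m i * lam i - (m i * gcm i k) * lam k)); last by move=> i _; ring.
rewrite sumrB -mulr_suml -cint_comb //; last exact: simple_root.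
rewrite [RHS](eq_bigr (fun i => m i * lam i -
   (if i == k then cint (comb m) (al k) else 0) * lam i)); last by move=> i _; ring.
rewrite sumrB; congr (_ - _); rewrite (bigD1 k) //= eqxx big1 ?addr0 // => i /negbTE->.
by rewrite mul0r.
Qed.

Lemma good_fire k lam : good lam -> good (fire k lam).
Proof.
move=> gl m rm; rewrite pair_fire //; apply: gl.
by rewrite -combB -al_comb; apply: root_reflection => //; apply: simple_root.
Qed.

Lemma pair_al j lam : pairing (fun i => if i == j then 1 else 0) lam = lam j.
Proof.
rewrite /pairing (bigD1 j) //= eqxx mul1r big1 ?addr0 // => i /negbTE->.
by rewrite mul0r.
Qed.

Lemma good_bound lam j : good lam -> `|lam j| <= 1.
Proof. by move=> gl; rewrite -(pair_al j) gl // -al_comb1; apply: simple_root. Qed.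

(** The pairing does not change when root and coweight are both reflected at [j]; [pos_descent]
    picks a [j] that lowers the root. At a simple root the pairing is an entry of [lam]. *)
Lemma orbit_good (O : ('I_n -> int) -> Prop) :
  (forall lam k, O lam -> O (fire k lam)) ->
  (forall lam j, O lam -> `|lam j| <= 1) -> forall lam, O lam -> good lam.
Proof.
move=> Of Ob lam Ol.
suff pos m : (forall i, 0 <= m i) -> is_root (comb m) -> `|pairing m lam| <= 1.
  move=> m rm; have [h|h] := root_comb_sign rm; first exact: pos.
  have -> : pairing m lam = - pairing (fun i => - m i) lam.
    by rewrite /pairing -sumrN; apply: eq_bigr => i _; rewrite mulNr opprK.
  rewrite normrN; apply: pos => [i|]; first by rewrite oppr_ge0.
  by rewrite -combN; apply: is_rootN.
have [N ltN] : exists N : nat, \sum_i m i < N%:Z by exists `|\sum_i m i|.+1; lia.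
elim: N m ltN lam Ol => [|N IH] m ltN lam Ol m0 rm.
  have ge : 0 <= \sum_i m i by apply: sumr_ge0 => i _; apply: m0.
  by move: (le_lt_trans ge ltN); rewrite ltxx.
have [[j ej]|[j [cj rc c0 _]]] := pos_descent m0 rm.
  have -> : pairing m lam = lam j; last exact: Ob.
  rewrite -(pair_al j); apply: eq_bigr => i _; congr (_ * _).
  by move: ej; rewrite al_comb1 => /comb_inj.
set c := cint _ _ in cj rc c0.
have e : pairing m lam = pairing (fun i => m i - if i == j then c else 0) (fire j lam).
  rewrite pair_fire // -/c; apply: eq_bigr => i _; congr (_ * _).
  rewrite -[comb _](combB m) -al_comb.
  have rj := simple_root j; rewrite -/c.
  have -> : cint (comb m - al j *~ c) (al j) = - c.
    apply: (intF_inj char0); rewrite rmorphN /= -cintP //; last by rewrite al_comb combB.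
    rewrite cartan_numberD // -mulrNz cartan_numberMz // cartan_number_diag // cintP //.
    by rewrite rmorphN /=; ring.
  by case: eqP => _; ring.
rewrite e; apply: IH => //; last exact: Of.
rewrite sumrB -big_mkcond big_pred1_eq.
have : \sum_i m i - c < N.+1%:Z - c by rewrite ltrD2r.
by move=> h; apply: lt_le_trans h _; lia.
Qed.

Definition coef (g : dualH) : 'I_n -> int :=
  if pselect (exists m, g = comb m) is left ex then projT1 (cid ex) else fun=> 0.

Lemma coef_comb m i : coef (comb m) i = m i.
Proof.
rewrite /coef; case: pselect => [ex|ne]; last by case: ne; exists m.
by case: (cid ex) => /= m' /comb_inj->.
Qed.

Lemma root_coef g : is_root g -> g = comb (coef g).
Proof. by move=> /root_comb[m [-> _]]; apply: eq_comb => i; rewrite coef_comb. Qed.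

Lemma coef_sign g : is_root g -> (forall i, 0 <= coef g i) \/ (forall i, coef g i <= 0).
Proof. by move=> rg; apply: root_comb_sign; rewrite -root_coef. Qed.

Lemma coef0 i : coef 0 i = 0.
Proof.
have -> : (0 : dualH) = comb (fun=> 0) by rewrite /comb big1 // => j _; rewrite mulr0z.
exact: coef_comb.
Qed.

Lemma coef_al i j : coef (al j) i = if i == j then 1 else 0.
Proof. by rewrite al_comb1 coef_comb. Qed.

(** All weights of [L], with [H] as the space of weight 0. *)
Definition Gamma0 : seq dualH := 0 :: Gamma.

Lemma Gamma0_uniq : uniq Gamma0.
Proof. by rewrite /= fset_uniq andbT; apply/negP => /rootsG[]. Qed.

Lemma Gamma0P g : g \in Gamma0 <-> g = 0 \/ is_root g.
Proof.
rewrite inE; split=> [/orP[/eqP|/rootsG]|[->|/rootsG->]]; rewrite ?eqxx ?orbT //.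
  by left.
by right.
Qed.

Lemma Gamma0_coef g : g \in Gamma0 -> g = comb (coef g).
Proof.
move=> /Gamma0P[->|/root_coef //].
by rewrite /comb big1 // => i _; rewrite coef0 mulr0z.
Qed.

Lemma coefD g g' i : g \in Gamma0 -> g' \in Gamma0 -> coef (g + g') i = coef g i + coef g' i.
Proof.
move=> gG gG'; have -> : g + g' = comb (fun i => coef g i + coef g' i).
  rewrite {1}(Gamma0_coef gG) {1}(Gamma0_coef gG') /comb -big_split.
  by apply: eq_bigr => j _; rewrite mulrzDr.
exact: coef_comb.
Qed.

Lemma coefN g i : g \in Gamma0 -> coef (- g) i = - coef g i.
Proof. by move=> gG; rewrite {1}(Gamma0_coef gG) combN coef_comb. Qed.

Lemma weight_notin g : g \notin Gamma0 -> weight_space g = 0%VS.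
Proof.
move=> gG; apply: contrapT => w0; move: gG; apply/negP; rewrite negbK; apply/Gamma0P.
by have [->|/eqP g0] := eqVneq g 0; [left | right; split].
Qed.

(** The parabolic subalgebra and its supplement have this form, and [wsum_lie] reduces their
    brackets to additions of coefficients. *)
Definition wsum (p : pred dualH) : {vspace L} :=
  (\sum_(g <- [seq g <- Gamma0 | p g]) weight_space g)%VS.

Lemma wsum_sup (p : pred dualH) g : p g -> (weight_space g <= wsum p)%VS.
Proof.
move=> pg; have [gG|/weight_notin->] := boolP (g \in Gamma0); last exact: sub0v.
by apply: (seq_sum_sup (fun g => weight_space g)); rewrite mem_filter pg.
Qed.

Lemma wsum_disj (p : pred dualH) g x : ~~ p g -> x \in weight_space g ->
  x \in wsum p -> x = 0.
Proof.
move=> pg xg; apply: (weight_disj cartanH (filter_uniq p Gamma0_uniq) _ xg).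
by rewrite mem_filter (negbTE pg).
Qed.

Lemma wsum_sub (p q : pred dualH) : (forall g, g \in Gamma0 -> p g -> q g) ->
  (wsum p <= wsum q)%VS.
Proof.
move=> pq; apply: seq_sum_subP => g; rewrite mem_filter => /andP[pg gG].
by apply: wsum_sup; apply: pq.
Qed.

Lemma wsum_full (p q : pred dualH) : (forall g, g \in Gamma0 -> p g || q g) ->
  fullv = (wsum p + wsum q)%VS.
Proof.
move=> pq; apply/eqP; rewrite eq_sym eqEsubv subvf (root_decomposition char0 cartanH simpleL rootsG) /=.
have key g : g \in Gamma0 -> (weight_space g <= wsum p + wsum q)%VS.
  move=> /pq/orP[pg|qg]; first exact: subv_trans (wsum_sup pg) (addvSl _ _).
  exact: subv_trans (wsum_sup qg) (addvSr _ _).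
rewrite subv_add; apply/andP; split.
  by have := key 0 (mem_head _ _); rewrite (weight0E char0 cartanH simpleL).
by apply: seq_sum_subP => g gG; apply: key; rewrite inE gG orbT.
Qed.

Lemma wsum_lie (p q r : pred dualH) x y :
  (forall g g', g \in Gamma0 -> g' \in Gamma0 -> p g -> q g' -> g + g' \in Gamma0 -> r (g + g')) ->
  x \in wsum p -> y \in wsum q -> lie x y \in wsum r.
Proof.
move=> pqr xp yq.
have [c cw ->] := memv_seq_sum (filter_uniq p Gamma0_uniq) xp.
have [d dw ->] := memv_seq_sum (filter_uniq q Gamma0_uniq) yq.
have mf (p' : pred dualH) g : g \in [seq g <- Gamma0 | p' g] -> p' g && (g \in Gamma0).
  by rewrite mem_filter.
move: (mf p) (mf q); move: [seq g <- _ | p g] [seq g <- _ | q g] => sp sq spP sqP.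
rewrite -adE linear_sum [X in X \in _]big_seq; apply: rpred_sum => g' /sqP/andP[qg' gG'] /=.
rewrite adE lieC rpredN -adE linear_sum [X in X \in _]big_seq.
apply: rpred_sum => g /spP/andP[pg gG] /=; rewrite adE lieC rpredN.
have := weight_lie (cw g) (dw g').
have [gg|/weight_notin->] := boolP (g + g' \in Gamma0); last first.
  by rewrite memv0 => /eqP->; apply: mem0v.
by apply/subvP/wsum_sup/pqr.
Qed.

Lemma wsum0 (x : L) : x \in wsum pred0 -> x = 0.
Proof. by rewrite /wsum filter_pred0 big_nil memv0 => /eqP. Qed.

Lemma root_weight_vec (g : dualH) : is_root g -> exists2 x, x \in weight_space g & x <> 0.
Proof.
move=> [_ w0]; apply: contrapT => ne; apply: w0; apply/eqP; rewrite -subv0.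
apply/subvP => x xw; rewrite memv0; apply/eqP; apply: contrapT => x0.
by apply: ne; exists x.
Qed.

Lemma root_Gamma0 g : is_root g -> g \in Gamma0.
Proof. by move=> rg; apply/Gamma0P; right. Qed.

Lemma coefNr g i : is_root g -> coef (- g) i = - coef g i.
Proof. by move=> rg; apply/coefN/root_Gamma0. Qed.

(** * Standard parabolic subalgebras as sums of weight spaces *)

Section Parabolic.

Variable Sigma1 : {fset dualH}.

Lemma Delta1P g : (g \in Delta1 Gamma Sigma Sigma1) <->
  is_root g /\ forall i, al i \in Sigma1 -> coef g i = 0.
Proof.
have rem_sum (f : dualH -> dualH) : \sum_(s <- (Sigma `\` Sigma1)%fset) f s =
    \sum_i if al i \in Sigma1 then 0 else f (al i).
  rewrite -(comb_sum (fun s => if s \in Sigma1 then 0 else f s)).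
  transitivity (\sum_(s <- (Sigma `\` Sigma1)%fset) if s \in Sigma1 then 0 else f s).
    by apply: eq_big_seq => s; rewrite in_fsetD => /andP[/negbTE->].
  rewrite (perm_big [seq s <- Sigma | s \notin Sigma1]) /=; last first.
    apply: uniq_perm; rewrite ?filter_uniq ?fset_uniq // => s.
    by rewrite in_fsetD mem_filter.
  by rewrite big_filter [RHS](bigID [pred s | s \in Sigma1]) /= [X in _ = X + _]big1 ?add0r // => s ->.
rewrite !inE /=; split.
  move=> /andP[/rootsG rg /asboolP[m e]]; split=> // i iS.
  rewrite e rem_sum (_ : \sum_i _ = comb (fun i => if al i \in Sigma1 then 0 else m (al i))).
    by rewrite coef_comb iS.
  by apply: eq_bigr => j _; case: ifP; rewrite ?mulr0z.
move=> [rg c0]; apply/andP; split; first exact/rootsG.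
apply/asboolP; exists (fun s => \sum_i if al i == s then coef g i else 0).
rewrite rem_sum {1}(root_coef rg); apply: eq_bigr => i _.
case: ifP => [/c0->|_]; first by rewrite mulr0z.
congr (_ *~ _); rewrite (bigD1 i) //= eqxx big1 ?addr0 // => j ji.
by case: eqP => // /al_inj e; rewrite e eqxx in ji.
Qed.

Lemma positive_rootsP g : (g \in positive_roots Gamma Sigma) <->
  is_root g /\ forall i, 0 <= coef g i.
Proof.
rewrite !inE /=; split.
  move=> /andP[/rootsG rg /asboolP[m e]]; split=> // i.
  rewrite e comb_sum (_ : \sum_i _ = comb (fun i => (m (al i))%:Z)); last by [].
  by rewrite coef_comb.
move=> [rg c0]; apply/andP; split; first exact/rootsG.
apply/asboolP; exists (fun s => \sum_i if al i == s then `|coef g i|%N else 0)%N.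
rewrite comb_sum {1}(root_coef rg); apply: eq_bigr => i _.
rewrite (bigD1 i) //= eqxx big1 ?addn0.
  by have := c0 i; case: (coef g i).
move=> j ji; by case: eqP => // /al_inj e; rewrite e eqxx in ji.
Qed.

Definition nonneg1 : pred dualH := fun g => [forall i, (al i \in Sigma1) ==> (0 <= coef g i)].

Lemma nonneg1P g : reflect (forall i, al i \in Sigma1 -> 0 <= coef g i) (nonneg1 g).
Proof. by apply: (iffP forallP) => h i; [move/implyP: (h i) | apply/implyP/h]. Qed.

(** A root with non-negative coefficients on [Sigma1] either has only zeros there, and is in
    [Delta1], or has a positive one, and is then a positive root. *)
Lemma parabolicE : standard_parabolic Gamma Sigma Sigma1 = wsum nonneg1.
Proof.
have n0 : nonneg1 0 by apply/nonneg1P => i _; rewrite coef0.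
apply/eqP; rewrite eqEsubv /standard_parabolic !subv_add; apply/andP; split.
  rewrite -{1}(weight0E char0 cartanH simpleL) wsum_sup //=.
  apply/andP; split; apply: seq_sum_subP => g.
    by move=> /Delta1P[rg c0]; apply/wsum_sup/nonneg1P => i /c0->.
  rewrite in_fsetI => /andP[_ /positive_rootsP[rg c0]].
  by apply/wsum_sup/nonneg1P.
apply: seq_sum_subP => g; rewrite mem_filter => /andP[/nonneg1P ng /Gamma0P[->|rg]].
  by rewrite (weight0E char0 cartanH simpleL) -addvA addvSl.
have [gD|gD] := boolP (g \in Delta1 Gamma Sigma Sigma1).
  apply: subv_trans (addvSl _ _); apply: subv_trans (addvSr _ _).
  exact: (seq_sum_sup (fun a => weight_space a)).
apply: subv_trans (addvSr _ _); apply: (seq_sum_sup (fun a => weight_space a)).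
rewrite in_fsetI in_fsetD gD (rootsG g).2 //=; apply/positive_rootsP; split=> //.
have [//|neg] := coef_sign rg; case/negP: gD; apply/Delta1P; split=> // i iS.
by apply/eqP; rewrite eq_le neg ng.
Qed.

(** For [al i] in [Sigma1], the sign condition at [i] alone defines a proper subalgebra containing
    the parabolic one. A second [al j] in [Sigma1] would make it strictly larger, because of the
    root space of [- al j]. *)
Lemma maximal_parabolic_singleton : (Sigma1 `<=` Sigma)%fset -> Sigma1 <> fset0 ->
  maximal_subalgebra (standard_parabolic Gamma Sigma Sigma1) ->
  exists i, Sigma1 = [fset al i]%fset.
Proof.
move=> sub1 /eqP/fset0Pn[s sS] [_ _ maxP].
have [i es] := al_surj (fsubsetP sub1 s sS); rewrite {}es in sS.
exists i; apply/fsetP => t; rewrite in_fset1; apply/idP/eqP => [tS|->//].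
have [j et] := al_surj (fsubsetP sub1 t tS); rewrite {}et in tS *.
apply: contrapT => ji.
pose p : pred dualH := fun g => 0 <= coef g i.
have subp : subalgebra (wsum p).
  move=> x y; apply: wsum_lie => g g' gG gG'; rewrite /p => pg pg' gg.
  by rewrite coefD // addr_ge0.
have Pp : (standard_parabolic Gamma Sigma Sigma1 <= wsum p)%VS.
  by rewrite parabolicE; apply: wsum_sub => g _ /nonneg1P/(_ i sS).
have out (q : pred dualH) k : ~~ q (- al k) -> ~ (weight_space (- al k) <= wsum q)%VS.
  move=> nq le; have [x xw x0] := root_weight_vec (is_rootN char0 cartanH simpleL (simple_root k)).
  by apply: x0; apply: (wsum_disj nq xw); apply: (subvP le).
have [e|e] := maxP _ subp Pp.
  apply: (out nonneg1 j).
    by apply/negP => /nonneg1P/(_ j tS); rewrite coefNr ?coef_al ?eqxx //; apply: simple_root.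
  rewrite -parabolicE -e wsum_sup // /p coefNr ?coef_al; last exact: simple_root.
  by case: eqP => // ij; case: ji; rewrite ij.
apply: (out p i).
  by rewrite /p coefNr ?coef_al ?eqxx //; apply: simple_root.
by rewrite e subvf.
Qed.

End Parabolic.

Lemma parabolic1E i :
  standard_parabolic Gamma Sigma [fset al i]%fset = wsum (fun g => 0 <= coef g i).
Proof.
rewrite parabolicE; apply/eqP; rewrite eqEsubv; apply/andP; split; apply: wsum_sub => g _.
  by move=> /nonneg1P; apply; rewrite in_fset1.
by move=> gi; apply/nonneg1P => j; rewrite in_fset1 => /eqP/al_inj->.
Qed.

Lemma bound_supplement i : (forall g, is_root g -> `|coef g i| <= 1) ->
  has_abelian_supplement (standard_parabolic Gamma Sigma [fset al i]%fset).
Proof.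
move=> bd; rewrite parabolic1E.
have ab : lie_abelian (wsum (fun g => coef g i < 0)).
  move=> x y xU yU; apply: wsum0; apply: wsum_lie xU yU => g g' gG gG' /= gn gn' gg.
  have := coefD i gG gG'; have : `|coef (g + g') i| <= 1; last by lia.
  by move/Gamma0P: gg => [->|/bd //]; rewrite coef0.
exists (wsum (fun g => coef g i < 0)); split=> //; split.
  by move=> x y xU yU; rewrite ab // mem0v.
by apply: wsum_full => g _; case: leP.
Qed.

(** Reflections at [j] other than [i] lower the root without changing its coefficient at [i]. The
    descent must therefore meet [j = i], where [al i] can be subtracted. *)
Lemma deep_root i g : is_root g -> 1 < `|coef g i| ->
  exists b, [/\ is_root b, is_root (b + al i) & 1 <= coef b i].
Proof.
wlog pos : g / forall j, 0 <= coef g j.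
  move=> hw rg; have [h|h] := coef_sign rg; first exact: hw.
  rewrite -normrN -coefNr // => lt; apply: hw lt; last exact: is_rootN.
  by move=> j; rewrite coefNr // oppr_ge0.
move=> rg; rewrite ger0_norm // => lt.
pose m := coef g; have em : g = comb m by apply: root_coef.
rewrite em in rg; have m0 : forall j, 0 <= m j by [].
have mi : 1 < m i by [].
clearbody m; clear em lt pos g.
have [N ltN] : exists N : nat, \sum_i m i < N%:Z by exists `|\sum_i m i|.+1; lia.
elim: N m ltN rg m0 mi => [|N IH] m ltN rm m0 mi.
  have ge : 0 <= \sum_i m i by apply: sumr_ge0 => j _; apply: m0.
  by move: (le_lt_trans ge ltN); rewrite ltxx.
have [[j ej]|[j [cj rc c0 r1]]] := pos_descent m0 rm.
  by move: ej mi; rewrite al_comb1 => /comb_inj->; case: ifP.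
have [eij|ij] := eqVneq i j; last first.
  apply: (IH (fun k => m k - if k == j then cint (comb m) (al j) else 0)) => //.
    rewrite sumrB -big_mkcond big_pred1_eq.
    have : \sum_i m i - cint (comb m) (al j) < N.+1%:Z - cint (comb m) (al j) by rewrite ltrD2r.
    by move=> h; apply: lt_le_trans h _; lia.
  by rewrite (negbTE ij) subr0.
exists (comb (fun k => m k - if k == j then 1 else 0)); split=> //.
  by rewrite eij -combB -al_comb1 subrK.
by rewrite coef_comb eij eqxx -eij; lia.
Qed.

Lemma supplement_bound i :
  has_abelian_supplement (standard_parabolic Gamma Sigma [fset al i]%fset) ->
  forall g, is_root g -> `|coef g i| <= 1.
Proof.
rewrite parabolic1E => -[U [[_ full] abU]] g rg; rewrite leNgt; apply/negP => lt.
have [b [rb rab cb]] := deep_root rg lt.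
have ra := simple_root i; set a := al i in ra rab.
have ca : coef a i = 1 by rewrite coef_al eqxx.
(* Otherwise [a + a] would be a root; [lie_root_neq0] needs two non-collinear roots. *)
have ba : b <> a.
  move=> eb; rewrite eb in rab.
  have aa : a + a <> a by move/eqP; rewrite -subr_eq0 addrK => /eqP a0; case: ra.
  have aNa : a + a <> - a.
    move/eqP; rewrite -subr_eq0 opprK => /eqP e; have := coef0 i.
    rewrite -e !coefD ?ca ?root_Gamma0 //.
  have := root_noncollinear char0 cartanH simpleL ra rab aa aNa (k := -1 - 1).
  by rewrite mulrzDr mulrN1z addrACA subrr addr0; apply.
have bNa : b <> - a by move=> eb; move: cb; rewrite eb coefNr // ca.
have rNa := is_rootN char0 cartanH simpleL ra.
have rNb := is_rootN char0 cartanH simpleL rb.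
have rNab : is_root (- b + - a).
  by rewrite -opprD; apply: is_rootN.
have [|x [y [xa yb xy]]] := lie_root_neq0 char0 cartanH simpleL rNa rNb rNab.
  apply: (root_noncollinear char0 cartanH simpleL) => //; first by move/oppr_inj.
  by rewrite opprK => e; apply: bNa; rewrite -e opprK.
apply: xy.
pose r : pred dualH := fun g => - 1 - coef b i < coef g i.
pose pp (c : int) : pred dualH := fun g => c <= coef g i.
have fullP : fullv = (wsum (pp 0%R) + U)%VS := full.
have rxy : lie x y \in wsum r.
  have /memv_addP[p pP [u uU ex]] : x \in (wsum (pp 0%R) + U)%VS.
    by rewrite -fullP memvf.
  have /memv_addP[q qP [v vU ey]] : y \in (wsum (pp 0%R) + U)%VS.
    by rewrite -fullP memvf.
  have eu : u = x - p by rewrite ex addrC addKr.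
  have ev : v = y - q by rewrite ey addrC addKr.
  have := abU u v uU vU; rewrite eu ev lieDl !lieDr !lieNl !lieNr opprK => e.
  (* This is [[x - p, y - q] = 0] expanded. As [1 <= coef b i], all three brackets live in degrees
     above [- 1 - coef b i], the degree of [[x, y]]. *)
  have -> : lie x y = lie x q + lie p y - lie p q.
    apply/eqP; rewrite -subr_eq0; apply/eqP; rewrite -[RHS]e.
    by rewrite opprD opprK opprD !addrA.
  have xpp : x \in wsum (pp (-1)).
    by apply: (subvP (wsum_sup _)) xa; rewrite /pp coefNr // ca.
  have ypp : y \in wsum (pp (- coef b i)).
    by apply: (subvP (wsum_sup _)) yb; rewrite /pp coefNr.
  rewrite rpredB ?rpredD //.
  - apply: wsum_lie xpp qP => h h' hG hG'; rewrite /pp /r coefD // => h1 h2 _.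
    by move: h1 h2 cb; clear; lia.
  - apply: wsum_lie pP ypp => h h' hG hG'; rewrite /pp /r coefD // => h1 h2 _.
    by move: h1 h2 cb; clear; lia.
  - apply: wsum_lie pP qP => h h' hG hG'; rewrite /pp /r coefD // => h1 h2 _.
    by move: h1 h2 cb; clear; lia.
apply: wsum_disj (weight_lie xa yb) rxy.
rewrite /r coefD ?root_Gamma0 // !coefNr // ca; lia.
Qed.

Definition supported (B : {set 'I_n}) : pred dualH :=
  fun g => [forall i, (i \notin B) ==> (coef g i == 0)].

Lemma supportedP (B : {set 'I_n}) g : reflect (forall i, i \notin B -> coef g i = 0) (supported B g).
Proof.
apply: (iffP forallP) => h i.
  by move=> iB; apply/eqP; move/implyP: (h i); apply.
by apply/implyP => /h->.
Qed.

Lemma supported0 (B : {set 'I_n}) : supported B 0.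
Proof. by apply/supportedP => i _; rewrite coef0. Qed.

Lemma root_supported2 (B : {set 'I_n}) g : is_root g -> supported B g -> supported (~: B) g -> False.
Proof.
move=> rg /supportedP s1 /supportedP s2; have [g0 _] := rg; apply: g0.
rewrite (root_coef rg) /comb big1 // => i _.
have [iB|iB] := boolP (i \in B); last by rewrite s1 // mulr0z.
by rewrite s2 ?mulr0z // in_setC negbK.
Qed.

Lemma supportedN (B : {set 'I_n}) g : is_root g -> supported B (- g) = supported B g.
Proof.
by move=> rg; apply: eq_forallb => i; rewrite coefNr // oppr_eq0.
Qed.

(** * Connectedness of the Dynkin diagram *)

Section Component.

Variable B : {set 'I_n}.
Hypothesis sepB : forall i j, i \in B -> j \notin B -> gcm i j = 0.

Lemma sepB_sym i j : i \in B -> j \notin B -> gcm j i = 0.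
Proof. by move=> iB jB; apply/eqP; rewrite gcm_eq0 sepB. Qed.

(** Induction on the height. If the lower root and [al j] were on different sides, their Cartan
    integer would be 0, but it is [- c] with [c] positive. *)
Lemma root_supported g : is_root g -> supported B g \/ supported (~: B) g.
Proof.
wlog pos : g / forall j, 0 <= coef g j.
  move=> hw rg; have [h|h] := coef_sign rg; first exact: hw.
  rewrite -[supported B g]supportedN // -[supported (~: B) g]supportedN //.
  by apply: hw; [move=> j; rewrite coefNr // oppr_ge0 | apply: is_rootN].
move=> rg; pose m := coef g; have em : g = comb m by apply: root_coef.
rewrite em in rg *; have m0 : forall j, 0 <= m j by [].
clearbody m; clear em pos g.
have [N ltN] : exists N : nat, \sum_i m i < N%:Z by exists `|\sum_i m i|.+1; lia.
elim: N m ltN rg m0 => [|N IH] m ltN rm m0.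
  have ge : 0 <= \sum_i m i by apply: sumr_ge0 => j _; apply: m0.
  by move: (le_lt_trans ge ltN); rewrite ltxx.
have [[j ->]|[j [cj rc c0 _]]] := pos_descent m0 rm.
  have [jB|jB] := boolP (j \in B); [left|right]; apply/supportedP => i.
    by rewrite coef_al; case: eqP => // ->; rewrite jB.
  by rewrite coef_al in_setC negbK; case: eqP => // -> jB'; rewrite jB' in jB.
set c := cint _ _ in cj rc c0; pose m' := fun i => m i - (if i == j then c else 0).
have rj := simple_root j.
have cm' : cint (comb m') (al j) = - c.
  apply: (intF_inj char0); rewrite -cintP // -combB -al_comb cartan_numberD // -mulrNz.
  by rewrite cartan_numberMz // cartan_number_diag // cintP // -/c !rmorphN /=; ring.
have ltN' : \sum_i m' i < N%:Z.
  rewrite sumrB -big_mkcond big_pred1_eq.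
  have : \sum_i m i - c < N.+1%:Z - c by rewrite ltrD2r.
  by move=> h; apply: lt_le_trans h _; lia.
have extend (C : {set 'I_n}) : (forall i, i \in C -> j \notin C -> gcm i j = 0) ->
    supported C (comb m') -> supported C (comb m).
  move=> sepC /supportedP sm'; have [jC|jC] := boolP (j \in C).
    apply/supportedP => i iC; have := sm' i iC; rewrite !coef_comb /m'.
    by case: eqP => [eij|]; [rewrite eij jC in iC | rewrite subr0].
  move/eqP: cm'; rewrite cint_comb // big1 => [|i _].
    by rewrite eq_sym oppr_eq0 => /eqP c00; rewrite c00 in cj.
  have [iC|iC] := boolP (i \in C); first by rewrite -/(gcm i j) sepC ?mulr0.
  by have := sm' i iC; rewrite coef_comb => ->; rewrite mul0r.
have [s|s] := IH m' ltN' rc c0; [left|right]; apply: extend s => //.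
  by move=> i; apply: sepB.
by move=> i iB jB; apply: sepB_sym; [rewrite in_setC negbK in jB | rewrite in_setC in iB].
Qed.

Lemma supported_orth g d : is_root g -> is_root d -> supported B g -> supported (~: B) d ->
  (d (rvec g) : F) = 0.
Proof.
move=> rg rd /supportedP sg /supportedP sd.
have cd : cint d g = 0.
  rewrite [d in cint d _](root_coef rd) cint_comb // -?root_coef // big1 // => i _.
  have [iB|iB] := boolP (i \in B); first by rewrite sd ?mul0r // in_setC negbK.
  apply/eqP; rewrite mulf_eq0; apply/orP; right.
  rewrite cint_eq0 //; last exact: simple_root.
  rewrite [g in cint g _](root_coef rg) cint_comb -?root_coef //; last exact: simple_root.
  rewrite big1 // => j _; have [jB|jB] := boolP (j \in B); last by rewrite sg ?mul0r.
  by rewrite [cint _ _]sepB ?mulr0.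
have := cartan_numberP char0 cartanH simpleL d rg.
rewrite cintP // cd mul0r => /eqP.
by rewrite -mulr_natl mulf_eq0 (natF_eq0 char0 2) => /eqP.
Qed.

(** The root spaces supported in [B], together with the part [K] of [H] killed by the roots
    supported off [B], span an ideal. It contains the root space of [al i0] but not that of [al j0],
    so a proper non-empty [B] contradicts simplicity. *)
Lemma component_full : B != set0 -> B = setT.
Proof.
move=> /set0Pn[i0 i0B]; apply: contrapT => BT.
have [j0 j0B] : exists j, j \notin B.
  apply: contrapT => ne; apply: BT; apply/setP => j; rewrite in_setT.
  by apply: contrapT => /negP jB; apply: ne; exists j.
have [K KP] : exists K : {vspace L}, forall x, x \in K <->
    x \in H /\ forall d, is_root d -> supported (~: B) d -> (d (vsproj H x) : F) = 0.
  apply: vspace_of_pred => [|a x y [xH xl] [yH yl]].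
    by rewrite mem0v; split=> // d _ _; rewrite !linear0.
  split=> [|d rd sd]; first by rewrite rpredD ?rpredZ.
  by rewrite !linearP /= xl // yl // scaler0 addr0.
pose pB : pred dualH := fun g => (g != 0) && supported B g.
pose I := (K + wsum pB)%VS.
have H0 x : x \in weight_space (0 : dualH) -> x \in H by rewrite (weight0E char0 cartanH simpleL).
have inK g x y : is_root g -> supported B g -> x \in weight_space g ->
    y \in weight_space (- g) -> lie x y \in K.
  move=> rg sg xg yg.
  have := lie_rvec char0 cartanH simpleL xg (subvP (weight_gw _) _ yg) => ->.
  apply: rpredZ; apply/KP; split; first exact: subvsP.
  by move=> d rd sd; rewrite vsvalK; apply: supported_orth rg rd sg sd.
have idI : lie_ideal I.
  move=> x y yI.
  have [z zT ->] : exists2 z, z \in wsum predT & x = z.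
    exists x => //; have := memvf x.
    by rewrite (@wsum_full predT pred0) // => /memv_addP[u uT [v /wsum0-> ->]]; rewrite addr0.
  have [c cw ->] := memv_seq_sum (filter_uniq predT Gamma0_uniq) zT.
  rewrite lieC rpredN -adE linear_sum [X in X \in _]big_seq; apply: rpred_sum => g.
  rewrite filter_predT => /Gamma0P rg /=; rewrite adE.
  move: yI => /memv_addP[k kK [w wB ->]]; rewrite lieDl; apply: rpredD.
    have /KP[kH k0] := kK; have := cw g => /weight_spaceP/(_ (vsproj H k)).
    rewrite vsprojK // => ->; case: rg => [->|rg]; first by rewrite zero_lfunE scale0r mem0v.
    have [sg|sg] := root_supported rg; last by rewrite k0 // scale0r mem0v.
    apply: rpredZ; apply: (subvP (addvSr _ _)); apply: (subvP (wsum_sup _)) (cw g).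
    by rewrite /pB sg andbT; apply/eqP; case: rg.
  have [d dw ->] := memv_seq_sum (filter_uniq pB Gamma0_uniq) wB.
  rewrite lieC rpredN -adE linear_sum [X in X \in _]big_seq; apply: rpred_sum => h.
  rewrite mem_filter => /andP[/andP[h0 sh] /Gamma0P[/eqP|rh]]; first by rewrite (negbTE h0).
  rewrite /= adE; have gh := weight_lie (cw g) (dw h).
  case: rg => [g0|rg].
    apply: (subvP (addvSr _ _)); apply: (subvP (wsum_sup _)) gh.
    by rewrite /pB g0 add0r h0.
  have [gh0|gh0] := eqVneq (g + h) 0.
    have hg : h = - g by apply/eqP; rewrite -addr_eq0 addrC gh0.
    apply: (subvP (addvSl _ _)); apply: (inK g) => //; last by rewrite -hg; apply: dw.
    by move: sh; rewrite hg supportedN.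
  have [ghG|/weight_notin e] := boolP (g + h \in Gamma0); last first.
    by move: gh; rewrite e memv0 => /eqP->; apply: mem0v.
  have rgh : is_root (g + h) by case/Gamma0P: ghG gh0 => // ->; rewrite eqxx.
  have gG := root_Gamma0 rg; have hG := root_Gamma0 rh.
  have [sg|sg] := root_supported rg.
    apply: (subvP (addvSr _ _)); apply: (subvP (wsum_sup _)) gh.
    rewrite /pB gh0; apply/supportedP => i iB; rewrite coefD //.
    by rewrite (supportedP _ _ sg) // (supportedP _ _ sh) // addr0.
  exfalso; have [s|s] := root_supported rgh.
    apply: (root_supported2 (B := B) rg) => //; apply/supportedP => i iB.
    have := supportedP _ _ s i iB; rewrite coefD // (supportedP _ _ sh i iB) addr0 //.
  apply: (root_supported2 (B := B) rh) => //; apply/supportedP => i iB.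
  by have := supportedP _ _ s i iB; rewrite coefD // (supportedP _ _ sg i iB) add0r.
have salB i : i \in B -> supported B (al i).
  by move=> iB; apply/supportedP => j jB; rewrite coef_al; case: eqP => // e; rewrite e iB in jB.
have [_ /(_ I idI)[I0|IT]] := simpleL.
  have [x xw x0] := root_weight_vec (simple_root i0).
  apply: x0; apply/eqP; rewrite -memv0 -I0; apply: (subvP (addvSr _ _)).
  apply: (subvP (wsum_sup _)) xw; rewrite /pB salB // andbT.
  by apply/eqP; case: (simple_root i0).
have [x xw x0] := root_weight_vec (simple_root j0); apply: x0.
pose q : pred dualH := supported B.
have nq : ~~ q (al j0) by apply/negP => /supportedP/(_ j0 j0B); rewrite coef_al eqxx.
apply: (wsum_disj nq xw); have : x \in I by rewrite IT memvf.
apply/subvP; rewrite subv_add; apply/andP; split.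
  apply: subv_trans (wsum_sup (supported0 B)); rewrite (weight0E char0 cartanH simpleL).
  by apply/subvP => y /KP[].
by apply: wsum_sub => g _ /andP[].
Qed.

End Component.

End SimpleRoots.

(** * Minuscule coweights *)

Section Minuscule.

(** Here [c] lists the values of a coweight on the simple roots and is unconstrained at indices that
    are not nodes. The last condition puts the fundamental coweight of node [i] into [O]. *)
Definition minuscule (X : dynkin_type) (i : nat) : Prop :=
  exists O : (nat -> int) -> Prop,
  [/\ forall c k, O c -> (0 < k <= dynkin_rank X)%N -> exists2 c', O c' &
        forall j, (0 < j <= dynkin_rank X)%N -> c' j = c j - cartan_matrix X j k * c k,
      forall c j, O c -> (0 < j <= dynkin_rank X)%N -> `|c j| <= 1 &
      exists2 c, O c & forall j, (0 < j <= dynkin_rank X)%N -> c j = (j == i)%:Z].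

(** Coweights in the usual orthogonal coordinates: on a chain the node values are [b j - b j.+1],
    and firing [k] exchanges the coordinates [k] and [k.+1]. In types C and D the coordinates are
    1/2 or -1/2, shifted by 1/2 to be integers. *)
Let bits (b : nat -> int) := forall j, b j = 0 \/ b j = 1.

(** The zero vector and the unit vectors with either sign; the latter form the orbit of the first
    fundamental coweight in types B and D. *)
Let axis (x : nat -> int) := (forall j, `|x j| <= 1) /\
  (forall j k, j != k -> x j = 0 \/ x k = 0).

Let swap (b : nat -> int) k j := if j == k then b k.+1 else if j == k.+1 then b k else b j.

Lemma bits_swap b k : bits b -> bits (swap b k).
Proof. by move=> h j; rewrite /swap; do !case: ifP => _. Qed.

Lemma axis_swap x k : axis x -> axis (swap x k).
Proof.
move=> [h1 h2]; split=> [j|i j ij]; first by rewrite /swap; do !case: ifP => _.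
by rewrite /swap; do !case: eqP => ?; subst; first [apply: h2; lia | lia].
Qed.

Lemma minuscule_A n i : (1 <= i <= n)%N -> minuscule (Type_A n) i.
Proof.
move=> /andP[i1 ilen].
exists (fun c => exists2 b, bits b & forall j, (0 < j <= n)%N -> c j = b j - b j.+1); split.
- move=> c k [b bb cb] /= kn; exists (fun j => swap b k j - swap b k j.+1).
    by exists (swap b k) => //; apply: bits_swap.
  move=> j jn; rewrite !cb // /cartan_matrix /swap /= !eqSS.
  by do !case: eqP => ? /=; subst; lia.
- by move=> c j [b bb cb] /= jn; rewrite cb //; case: (bb j) => ->; case: (bb j.+1) => ->.
exists (fun j => (j <= i)%N%:Z - (j.+1 <= i)%N%:Z).
  by exists (fun j => (j <= i)%N%:Z) => // j; case: (_ <= _)%N; [right|left].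
by move=> j _; lia.
Qed.

Lemma minuscule_B n : (2 <= n)%N -> minuscule (Type_B n) 1.
Proof.
move=> n2.
pose cr x j : int := if j == n then x j else x j - x j.+1.
exists (fun c => exists2 x, axis x & forall j, (0 < j <= n)%N -> c j = cr x j); split.
- move=> c k [x ax cx] /= kn.
  exists (cr (if k == n then fun j => if j == n then - x j else x j else swap x k)).
    eexists; last by []; case: eqP => // _; last exact: axis_swap.
    case: ax => h1 h2; split=> [j|i j ij]; first by case: eqP; rewrite ?normrN.
    by have := h2 _ _ ij; do !case: eqP => _; lia.
  move=> j jn; rewrite !cx // /cartan_matrix /= /cr.
  case: (k =P n) => kn'; rewrite /swap ?eqSS;
    by do !case: eqP => ? /=; subst; lia.
- move=> c j [x [h1 h2] cx] /= jn; rewrite cx // /cr.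
  have : x j = 0 \/ x j.+1 = 0 by apply: h2; lia.
  by have := h1 j; have := h1 j.+1; case: eqP; lia.
exists (cr (fun j => (j == 1%N)%:Z)); last first.
  by move=> j jn; rewrite /cr /=; do !case: eqP; lia.
eexists; last by [].
by split=> [j|j k jk]; [case: eqP | do !case: eqP; lia].
Qed.

(** The long simple root is twice the last coordinate, which after the shift by 1/2 reads
    [2 * b n - 1]. Firing it flips the last bit. *)
Lemma minuscule_C n : (2 <= n)%N -> minuscule (Type_C n) n.
Proof.
move=> n2.
pose cr b j : int := if j == n then 2 * b j - 1 else b j - b j.+1.
exists (fun c => exists2 b, bits b & forall j, (0 < j <= n)%N -> c j = cr b j); split.
- move=> c k [b bb cb] /= kn.
  exists (cr (if k == n then fun j => if j == n then 1 - b j else b j else swap b k)).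
    eexists; last by []; case: eqP => // _; last exact: bits_swap.
    by move=> j; have := bb j; case: eqP => _; lia.
  move=> j jn; rewrite !cb // /cartan_matrix /= /cr.
  case: (k =P n) => kn'; rewrite /swap ?eqSS;
    by do !case: eqP => ? /=; subst; lia.
- move=> c j [b bb cb] /= jn; rewrite cb // /cr.
  by have := bb j; have := bb j.+1; case: eqP; lia.
exists (cr (fun=> 1)); last by move=> j jn; rewrite /cr /=; do !case: eqP; lia.
by eexists; last by []; right.
Qed.

Lemma minuscule_D1 n : (4 <= n)%N -> minuscule (Type_D n) 1.
Proof.
case: n => // n n2.
pose cr x j : int := if j == n.+1 then x n + x n.+1 else x j - x j.+1.
exists (fun c => exists2 x, axis x & forall j, (0 < j <= n.+1)%N -> c j = cr x j); split.
- move=> c k [x ax cx] /= kn.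
  exists (cr (if k == n.+1 then
      fun j => if j == n.+1 then - x n else if j == n then - x n.+1 else x j else swap x k)).
    eexists; last by []; case: eqP => // _; last exact: axis_swap.
    case: ax => h1 h2; split=> [j|i j ij].
      by do !case: eqP => _; rewrite ?normrN.
    have a1 := h2 i j; have a2 := h2 i n.+1; have a3 := h2 i n; have a4 := h2 n.+1 j.
    have a5 := h2 n j; have a6 := h2 n.+1 n; do !case: eqP => ?; lia.
  move=> j jn; rewrite !cx // /cartan_matrix /= /cr.
  case: (k =P n.+1) => kn'; rewrite /swap ?eqSS;
    by do !(case: eqP => ? || case: ltnP => ?) => /=; subst; lia.
- move=> c j [x [h1 h2] cx] /= jn; rewrite cx // /cr.
  have := h1 j; have := h1 j.+1; have := h1 n; have := h1 n.+1.
  have : x n = 0 \/ x n.+1 = 0 by apply: h2; lia.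
  have : x j = 0 \/ x j.+1 = 0 by apply: h2; lia.
  by case: eqP; lia.
exists (cr (fun j => (j == 1%N)%:Z)); last first.
  by move=> j jn; rewrite /cr /=; do !case: eqP; lia.
eexists; last by [].
by split=> [j|j k jk]; [case: eqP | do !case: eqP; lia].
Qed.

(** The parity of the number of ones is not recorded, so both half-spin orbits are covered at once.
    All ones is the start for the last node; clearing the last bit gives the node before it. *)
Lemma minuscule_D n i : (4 <= n)%N -> i \in [:: n.-1; n] -> minuscule (Type_D n) i.
Proof.
case: n => // n n2 ni.
pose cr b j : int := if j == n.+1 then b n + b n.+1 - 1 else b j - b j.+1.
exists (fun c => exists2 b, bits b & forall j, (0 < j <= n.+1)%N -> c j = cr b j); split.
- move=> c k [b bb cb] /= kn.
  exists (cr (if k == n.+1 then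
      fun j => if j == n.+1 then 1 - b n else if j == n then 1 - b n.+1 else b j else swap b k)).
    eexists; last by []; case: eqP => // _; last exact: bits_swap.
    by move=> j; have := bb n; have := bb n.+1; have := bb j; do !case: eqP => _; lia.
  move=> j jn; rewrite !cb // /cartan_matrix /= /cr.
  case: (k =P n.+1) => kn'; rewrite /swap ?eqSS;
    by do !(case: eqP => ? || case: ltnP => ?) => /=; subst; lia.
- move=> c j [b bb cb] /= jn; rewrite cb // /cr.
  by have := bb j; have := bb j.+1; have := bb n; have := bb n.+1; case: eqP; lia.
exists (cr (fun j => if (j == n.+1) && (i == n) then 0 else 1)).
  by eexists; last by []; move=> j; case: ifP; [left|right].
move: ni; rewrite !inE => ni j jn; rewrite /cr /=.
by move: ni; do !case: eqP => ? //=; subst; lia.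
Qed.

Let fireS r (M : nat -> nat -> int) (s : seq int) k : seq int :=
  [seq s`_j.-1 - M j k * s`_k.-1 | j <- iota 1 r].

(** Breadth-first generation of the orbit by firing nodes of value 1. [orbit_check] verifies the
    result, so the generation itself needs no proof. The depths 16 and 27 used below are the numbers
    of positive roots involving the chosen node of E_6 and E_7. *)
Fixpoint layers r (M : nat -> nat -> int) (l : seq (seq int)) d : seq (seq int) :=
  if d is d'.+1 then
    l ++ layers r M (undup [seq fireS r M s k | s <- l, k <- [seq k <- iota 1 r | s`_k.-1 == 1]]) d'
  else l.

Definition orbit_check r (M : nat -> nat -> int) i (O : seq (seq int)) : bool :=
  [&& all (fun s => all (fun k => fireS r M s k \in O) (iota 1 r)) O,
      all (fun s => all (fun j => `|s`_j.-1| <= 1) (iota 1 r)) O &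
      [seq (j == i)%:Z | j <- iota 1 r] \in O].

Lemma orbit_minuscule X i O :
  orbit_check (dynkin_rank X) (cartan_matrix X) i O -> minuscule X i.
Proof.
move=> /and3P[/allP clo /allP bd init]; set r := dynkin_rank X in clo bd init *.
exists (fun c => exists2 s, s \in O & forall j, c j = s`_j.-1).
have rng j : (0 < j <= r)%N -> j \in iota 1 r by rewrite mem_iota add1n ltnS.
have nthr (f : nat -> int) j : (0 < j <= r)%N -> [seq f j | j <- iota 1 r]`_j.-1 = f j.
  move=> jr; rewrite (nth_map 0%N) ?size_iota; last by lia.
  rewrite nth_iota; last by lia.
  by congr f; lia.
split.
- move=> c k [s sO cs] kr.
  exists (fun j => (fireS r (cartan_matrix X) s k)`_j.-1).
    by exists (fireS r (cartan_matrix X) s k) => //; apply: (allP (clo s sO)); apply: rng.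
  by move=> j jr; rewrite nthr // !cs.
- by move=> c j [s sO cs] jr; rewrite cs; apply: (allP (bd s sO)); apply: rng.
exists (fun j => [seq (j == i)%:Z | j <- iota 1 r]`_j.-1).
  by exists [seq (j == i)%:Z | j <- iota 1 r].
by move=> j jr; rewrite nthr.
Qed.

Lemma minuscule_E6 i : i \in [:: 1; 6]%N -> minuscule (Type_E 6) i.
Proof.
rewrite !inE => /orP[] /eqP->.
  apply: (@orbit_minuscule _ _ (layers 6 (cartan_matrix (Type_E 6)) [:: [:: 1; 0; 0; 0; 0; 0]] 16)).
  by vm_compute.
apply: (@orbit_minuscule _ _ (layers 6 (cartan_matrix (Type_E 6)) [:: [:: 0; 0; 0; 0; 0; 1]] 16)).
by vm_compute.
Qed.

Lemma minuscule_E7 : minuscule (Type_E 7) 7.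
Proof.
apply: (@orbit_minuscule _ _ (layers 7 (cartan_matrix (Type_E 7)) [:: [:: 0; 0; 0; 0; 0; 0; 1]] 27)).
by vm_compute.
Qed.

End Minuscule.

(** * The numbers game on rooted diagrams *)


Section Game.

Variables (V : finType) (A : V -> V -> int).
Hypothesis Adiag : forall v, A v v = 2.
Hypothesis Ale0 : forall u v, u != v -> A u v <= 0.
Hypothesis Aeq0 : forall u v, (A u v == 0) = (A v u == 0).

Definition fireV (k : V) (lam : V -> int) (v : V) : int := lam v - A v k * lam k.

Variable G : (V -> int) -> Prop.
Hypothesis Gfire : forall lam k, G lam -> G (fireV k lam).
Hypothesis Gbound : forall lam v, G lam -> `|lam v| <= 1.

Implicit Types (Y Z : {set V}) (u v i j : V) (lam : V -> int) (p q : seq V).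

(** Values off [Y] are left free, so that a game on [Y] can be played inside a larger position. *)
Definition starts lam Y j := G lam /\ forall y, y \in Y -> lam y = (y == j)%:Z.

(* Some firing sequence started at [j] returns the value [1] to [j], that is, it
   fires [j] twice, and raises a vertex attached to [Y] only at [j] twice. *)
Definition refire Y j := forall lam, starts lam Y j ->
  exists2 lam', G lam' & forall z, z \notin Y ->
    (forall y, y \in Y -> y != j -> A z y = 0) -> lam' z = lam z - 2 * A z j.

Definition numbers (X : dynkin_type) p := [/\ uniq p, size p = dynkin_rank X &
  forall v0 x y, (x < size p)%N -> (y < size p)%N ->
    A (nth v0 p x) (nth v0 p y) = cartan_matrix X x.+1 y.+1].

(** The final claim is the existence of a numbering, so the nodes [n.-1] of D_n and 6 of E_6,
    equivalent to listed ones by a diagram symmetry, are left out. *)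
Definition cominuscule (X : dynkin_type) (k : nat) : bool :=
  match X with
  | Type_A n => (1 <= k <= n)%N
  | Type_B n => (2 <= n)%N && (k == 1%N)
  | Type_C n => (2 <= n)%N && (k == n)
  | Type_D n => (4 <= n)%N && ((k == 1%N) || (k == n))
  | Type_E n => (n == 6%N) && (k == 1%N) || (n == 7%N) && (k == 7%N)
  end.

Definition rooted Y j X k p :=
  [/\ cominuscule X k, numbers X p, p =i Y & nth j p k.-1 = j].

Definition chain_end Y j := exists n p, rooted Y j (Type_A n) 1 p.

(** The induction invariant: [refire] is recorded for all rooted diagrams other than a chain entered
    at its end, because it limits what can be attached above the root. *)
Definition classified Y j := chain_end Y j \/
  (refire Y j /\ exists X k p, rooted Y j X k p).

Lemma A_leN1 u v : u != v -> A u v != 0 -> A u v <= -1.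
Proof. by move=> /Ale0; lia. Qed.

(* Firing only raises the values at the vertices that have not been fired. *)
Lemma path_contra u p lam : path (fun x y => A x y != 0) u p -> uniq (u :: p) -> p != [::] ->
  G lam -> 1 <= lam u -> (forall v, v \in p -> 0 <= lam v) -> 1 <= lam (last u p) -> False.
Proof.
elim: p u lam => // v p IH u lam /= /andP[uv pth] /andP[uvp /andP[vp up]] _ Gl lu lp lst.
have nuv : v != u by apply: contra uvp => /eqP->; apply: mem_head.
have Gl' := Gfire u Gl.
have ge w : w \in v :: p -> lam w <= fireV u lam w.
  move=> wp; have wu : w != u by apply: contra uvp => /eqP<-.
  by rewrite /fireV; have := Ale0 wu; nia.
have vl : lam v + 1 <= fireV u lam v.
  by rewrite /fireV; have := A_leN1 nuv; rewrite Aeq0 => /(_ uv); nia.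
have [p0|p0] := eqVneq p [::].
  move: lst vl (Gbound v Gl'); rewrite p0 /=; lia.
apply: (IH v (fireV u lam)) => //.
- exact/andP.
- by have := lp v (mem_head _ _); lia.
- by move=> w wp; apply: le_trans (lp w _) (ge w _); rewrite inE wp orbT.
by apply: le_trans lst (ge _ _); apply: mem_last.
Qed.

Let fireL (N : nat -> nat -> int) (r : nat) (s : seq int) k : seq int :=
  [seq s`_x - N x k * s`_k | x <- iota 0 r].

(** A certificate that a start at vertex 0 cannot stay bounded: the word [w] is the firing sequence,
    with vertices counted from 0. *)
Definition overflow (N : nat -> nat -> int) r (w : seq nat) : bool :=
  all (ltn^~ r) w && has (fun c => 1 < `|c|) (foldl (fireL N r) ((1 : int) :: nseq r.-1 0) w).

Lemma overflow_contra (us : seq V) N w lam v0 : (0 < size us)%N -> G lam ->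
  (forall x y, (x < size us)%N -> (y < size us)%N -> A (nth v0 us x) (nth v0 us y) = N x y) ->
  (forall x, (x < size us)%N -> lam (nth v0 us x) = (x == 0%N)%:Z) ->
  overflow N (size us) w -> False.
Proof.
move=> us0 Gl AN l0 /andP[aw]; set s0 := _ :: _.
have : forall x, (x < size us)%N -> lam (nth v0 us x) = s0`_x.
  by move=> x xr; rewrite l0 //; case: x xr => //= x xr; rewrite nth_nseq; case: ifP.
have : size s0 = size us by rewrite /= size_nseq prednK.
move: s0 => s.
elim: w s lam Gl {l0} aw => [|k w IH] s lam Gl /=.
  move=> _ ss ls /hasP[c /(nthP 0)[x xs <-]].
  by rewrite -ls -?ss // ltNge Gbound.
move=> /andP[kr aw] ss ls; apply: (IH _ (fireV (nth v0 us k) lam)) => //.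
- exact: Gfire.
- by rewrite size_map size_iota.
move=> x xr; rewrite (nth_map 0%N) ?size_iota // nth_iota // add0n.
by rewrite /fireV AN // !ls.
Qed.

(** With the conditions written as 0-1 integers, [lia] can compare Cartan matrices entry by
    entry. *)
Lemma cartan_matrixE X x y : cartan_matrix X x y =
  2 * (x == y)%:Z - ((x != y) && (bond X x y || bond X y x))%:Z
  - [&& x != y, bond X x y || bond X y x & arrow X x y]%:Z.
Proof. by rewrite /cartan_matrix; case: eqP => //=; case: (_ || _); case: (arrow _ _ _). Qed.

Lemma if_int (b : bool) (u : int) : (if b then u else 0) = u * b%:Z.
Proof. by case: b; rewrite ?mulr1 ?mulr0. Qed.

(* The Cartan matrix of the diagram [M] with a new vertex [0] attached to vertex [k]. *)
Definition ext (M : nat -> nat -> int) (k : nat) (d : int) (x y : nat) : int :=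
  match x, y with
  | 0, 0 => 2
  | 0, y => if y == k then - d else 0
  | x, 0 => if x == k then - 1 else 0
  | x, y => M x y
  end.

(** * Attaching a vertex to a numbered diagram *)

Section Extend.

Variables (Y : {set V}) (i j : V) (X : dynkin_type) (k : nat) (p : seq V) (d : int).
Hypotheses (iY : i \notin Y) (rY : rooted Y j X k p) (k0 : (0 < k <= dynkin_rank X)%N).
Hypothesis Aij : forall y, y \in Y -> A i y = if y == j then - d else 0.
Hypothesis Aji : forall y, y \in Y -> A y i = if y == j then - 1 else 0.

Let q := i :: p.
Let r := dynkin_rank X.

Lemma ext_size : size q = r.+1.
Proof. by case: rY => _ [_ e _] _ _; rewrite /q /r /= e. Qed.

Lemma nth_root x : (0 < x <= r)%N -> (nth i q x == j) = (x == k).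
Proof.
case: rY => _ [up sp _] pY nk xr; rewrite -[X in _ == X]nk (set_nth_default i); last by rewrite sp; lia.
rewrite (_ : nth i p k.-1 = nth i q k); last by case: (k) k0.
rewrite nth_uniq ?ext_size //; try lia.
by rewrite /= up andbT pY.
Qed.

Lemma extE x y : (x <= r)%N -> (y <= r)%N ->
  A (nth i q x) (nth i q y) = ext (cartan_matrix X) k d x y.
Proof.
case: (rY) => _ [up sp mp] pY _.
have mY x' : (x' < r)%N -> nth i p x' \in Y by move=> xr; rewrite -pY mem_nth // sp.
case: x => [|x] xr; case: y => [|y] yr; first by rewrite /= Adiag.
- by have := @nth_root y.+1; rewrite /= yr Aij ?mY // => ->.
- by have := @nth_root x.+1; rewrite /= xr Aji ?mY // => ->.
by rewrite /= mp // sp.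
Qed.

(** The list [sg] gives the old labels in the new order: 0 stands for the added vertex [i], and a
    positive label for that vertex of [X]. *)
Lemma extend_numbers X' (sg : seq nat) : dynkin_rank X' = r.+1 ->
  perm_eq sg (iota 0 r.+1) ->
  (forall x y, (x < r.+1)%N -> (y < r.+1)%N ->
    ext (cartan_matrix X) k d (nth 0%N sg x) (nth 0%N sg y) = cartan_matrix X' x.+1 y.+1) ->
  numbers X' [seq nth i q x | x <- sg] /\ [seq nth i q x | x <- sg] =i i |: Y.
Proof.
move=> rk sgP sgM; have ss : size sg = r.+1 by rewrite (perm_size sgP) size_iota.
have sgr x : (x < r.+1)%N -> (nth 0%N sg x <= r)%N.
  move=> xr; have : nth 0%N sg x \in sg by rewrite mem_nth // ss.
  by rewrite (perm_mem sgP) mem_iota.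
have pq : perm_eq [seq nth i q x | x <- sg] q.
  apply: perm_trans (perm_map _ sgP) _; rewrite -ext_size.
  by rewrite (_ : [seq nth i q x | x <- _] = q) //; apply: (mkseq_nth i q).
case: (rY) => _ [up sp mp] pY _; split.
  split; first by rewrite (perm_uniq pq) /= up andbT pY.
    by rewrite size_map ss rk.
  rewrite size_map ss => v0 x y xr yr.
  by rewrite !(nth_map 0%N) ?ss // extE ?sgr // sgM.
by move=> v; rewrite (perm_mem pq) inE in_setU1 pY.
Qed.

(* [i] becomes vertex [k'] of the new numbering, that is [sg`_k'.-1 = 0]. *)
Lemma extend_rooted X' k' (sg : seq nat) : cominuscule X' k' -> dynkin_rank X' = r.+1 ->
  perm_eq sg (iota 0 r.+1) -> (k'.-1 < r.+1)%N -> nth 0%N sg k'.-1 = 0%N ->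
  (forall x y, (x < r.+1)%N -> (y < r.+1)%N ->
    ext (cartan_matrix X) k d (nth 0%N sg x) (nth 0%N sg y) = cartan_matrix X' x.+1 y.+1) ->
  exists p', rooted (i |: Y) i X' k' p'.
Proof.
move=> cX rk sgP kr sgk sgM; have [nu mY] := extend_numbers rk sgP sgM.
exists [seq nth i q x | x <- sg]; split=> //.
by rewrite (nth_map 0%N) ?sgk // (perm_size sgP) size_iota.
Qed.

(** The list [t] selects a subdiagram with the added vertex first; the default 1 of [head] excludes
    an empty list. As only selected vertices are fired, their values evolve as in the subdiagram
    alone. *)
Lemma extend_overflow lam (t : seq nat) N w : starts lam (i |: Y) i -> all (fun x => (x <= r)%N) t ->
  uniq t -> head 1%N t = 0%N ->
  (forall x y, (x < size t)%N -> (y < size t)%N ->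
     ext (cartan_matrix X) k d (nth 0%N t x) (nth 0%N t y) = N x y) ->
  overflow N (size t) w -> False.
Proof.
move=> [Gl lY] /all_nthP tr ut ht tM ov.
case: (rY) => _ [up sp mp] pY _.
have uq : uniq q by rewrite /= up andbT pY.
apply: (@overflow_contra [seq nth i q x | x <- t] N w lam i _ Gl); rewrite ?size_map //.
    by case: (t) ht.
  by move=> x y xr yr; rewrite !(nth_map 0%N) // extE ?tM //; apply: tr.
move=> x xr; rewrite (nth_map 0%N) //.
have xq : (nth 0%N t x < size q)%N by rewrite ext_size ltnS; apply: tr.
rewrite lY; last first.
  have : nth i q (nth 0%N t x) \in q by rewrite mem_nth.
  by rewrite inE in_setU1 pY.
have := nth_uniq i xq (isT : (0 < size q)%N) uq => /= ->.
have h0 : nth 0%N t 0 = 0%N by case: (t) ht.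
have t0 : (0 < size t)%N by case: (t) xr.
by rewrite -[in RHS](nth_uniq 0%N xr t0 ut) h0.
Qed.

End Extend.

Definition tab (T : seq (seq int)) x y : int := (nth [::] T x)`_y.

(** E_6 started at [alpha_2], whose coefficient in the highest root is 2. *)
Definition tabA := tab [:: [:: 2; -1; 0; 0; 0; 0]; [:: -1; 2; -1; 0; -1; 0]; [:: 0; -1; 2; -1; 0; 0]; [:: 0; 0; -1; 2; 0; 0]; [:: 0; -1; 0; 0; 2; -1]; [:: 0; 0; 0; 0; -1; 2]].
Definition wordA : seq nat := [:: 0; 1; 2; 3; 4; 1; 0; 2; 1; 4]%N.
Lemma overflowA : overflow tabA 6 wordA.
Proof. by vm_compute. Qed.

(** F_4 started at the end with the long roots. *)
Definition tabC := tab [:: [:: 2; -1; 0; 0]; [:: -1; 2; -2; 0]; [:: 0; -1; 2; -1]; [:: 0; 0; -1; 2]].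
Definition wordC : seq nat := [:: 0; 1; 2; 1; 0; 3; 2]%N.
Lemma overflowC : overflow tabC 4 wordC.
Proof. by vm_compute. Qed.

(** E_7 started at [alpha_1]. *)
Definition tabD := tab [:: [:: 2; -1; 0; 0; 0; 0; 0]; [:: -1; 2; -1; 0; 0; 0; 0]; [:: 0; -1; 2; -1; -1; 0; 0]; [:: 0; 0; -1; 2; 0; 0; 0]; [:: 0; 0; -1; 0; 2; -1; 0]; [:: 0; 0; 0; 0; -1; 2; -1]; [:: 0; 0; 0; 0; 0; -1; 2]].
Definition wordD : seq nat := [:: 0; 1; 2; 3; 4; 2; 1; 0; 5; 4; 2; 1; 3; 2; 4; 5]%N.
Lemma overflowD : overflow tabD 7 wordD.
Proof. by vm_compute. Qed.

(** E_8 started at [alpha_8], the end of its longest arm. *)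
Definition tabE := tab [:: [:: 2; -1; 0; 0; 0; 0; 0; 0]; [:: -1; 2; -1; 0; 0; 0; 0; 0]; [:: 0; -1; 2; -1; 0; 0; 0; 0]; [:: 0; 0; -1; 2; -1; 0; 0; 0]; [:: 0; 0; 0; -1; 2; -1; -1; 0]; [:: 0; 0; 0; 0; -1; 2; 0; -1]; [:: 0; 0; 0; 0; -1; 0; 2; 0]; [:: 0; 0; 0; 0; 0; -1; 0; 2]].
Definition wordE : seq nat := [:: 0; 1; 2; 3; 4; 5; 6; 4; 3; 2; 1; 0; 7; 5; 4; 3; 2; 1; 6; 4; 3; 2; 5; 4; 3; 6; 4; 5]%N.
Lemma overflowE : overflow tabE 8 wordE.
Proof. by vm_compute. Qed.

Lemma cominuscule_rank X k : cominuscule X k -> (0 < k <= dynkin_rank X)%N.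
Proof. by case: X => n /=; lia. Qed.

(** * A single component below the root vertex *)

Section Step.

Variables (Y : {set V}) (i j : V) (lam : V -> int).
Hypotheses (iY : i \notin Y) (jY : j \in Y) (start_i : starts lam (i |: Y) i).
Hypothesis Aj : forall y, y \in Y -> A y i = if y == j then - 1 else 0.

Let YX y : y \in Y -> y \in i |: Y. Proof. exact: setU1r. Qed.
Let yi y : y \in Y -> y != i. Proof. by apply: contraTneq => ->. Qed.

Lemma step_other y : y \in Y -> y != j -> A i y = 0.
Proof. by move=> yY yj; apply/eqP; rewrite Aeq0 Aj // (negbTE yj). Qed.

Lemma step_fire mu : starts mu (i |: Y) i -> starts (fireV i mu) Y j /\ fireV i mu i = - 1.
Proof.
move=> [Gm mE]; have mi : mu i = 1 by rewrite mE ?setU11 // eqxx.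
split; last by rewrite /fireV Adiag mi.
split; first exact: Gfire.
by move=> y yY; rewrite /fireV mE ?YX // mi (negbTE (yi yY)) Aj //; case: eqP.
Qed.

Lemma step_outside z : z \notin i |: Y -> (forall y, y \in i |: Y -> y != i -> A z y = 0) ->
  forall y, y \in Y -> A z y = 0.
Proof. by move=> _ Az y yY; apply: Az; [apply: YX | apply: yi]. Qed.

(** Firing [i] leaves -1 there, and firing [j] twice adds 2, so [i] can be fired a second time. *)
Lemma step_refire : refire Y j -> A i j = -1 -> refire (i |: Y) i.
Proof.
move=> rf ij mu sm; have [s1 m1i] := step_fire sm.
have [mu2 G2 m2] := rf _ s1; exists (fireV i mu2); first exact: Gfire.
move=> z zX Az; have AzY := step_outside zX Az.
have zY : z \notin Y by apply: contra zX => /YX.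
have [_ mE] := sm; have mi : mu i = 1 by rewrite mE ?setU11 // eqxx.
have m2i : mu2 i = 1 by rewrite m2 // ?m1i ?ij // => y; apply: step_other.
have m2z : mu2 z = mu z - A z i.
  rewrite m2 // => [|y yY _]; last exact: AzY.
  by rewrite (AzY j jY) /fireV mi; ring.
by rewrite /fireV m2i m2z; ring.
Qed.

(** After [i] and [j] have been fired, [i] holds [-1 - A i j], which is at most 1. *)
Lemma step_bound : -2 <= A i j <= -1.
Proof.
have [[G1 l1] l1i] := step_fire start_i.
have := Gbound i (Gfire j G1); rewrite {1}/fireV l1i l1 // eqxx mulr1.
have ij : i != j by rewrite eq_sym yi.
have : A i j <= -1 by apply: A_leN1 => //; rewrite Aeq0 Aj // eqxx.
lia.
Qed.

(** If [j] is fired twice, [i] ends with [-1 - 2 * A i j], which is at most 1. *)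
Lemma step_refire_bound : refire Y j -> A i j = -1.
Proof.
move=> rf; have [s1 l1i] := step_fire start_i; have [mu2 G2 m2] := rf _ s1.
have := Gbound i G2; rewrite m2 // ?l1i; last exact: step_other.
have := step_bound; lia.
Qed.

(** Across a double bond one firing of [j] already brings [i] from -1 back to 1. *)
Lemma step_double_refire : A i j = -2 -> refire (i |: Y) i.
Proof.
move=> ij mu sm; have [[G1 m1] m1i] := step_fire sm.
exists (fireV i (fireV j (fireV i mu))); first by do 2!apply: Gfire.
move=> z zX Az; have AzY := step_outside zX Az.
have [_ mE] := sm; have mi : mu i = 1 by rewrite mE ?setU11 // eqxx.
rewrite [fireV i (fireV j _) z]/fireV /fireV in m1i *.
have -> : (mu z - A z i * mu i - A z j * (mu j - A j i * mu i)) = mu z - A z i.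
  by rewrite (AzY j jY) mi; ring.
rewrite m1i; have -> : mu j - A j i * mu i = 1 by have := m1 j jY; rewrite /fireV eqxx.
by rewrite ij; ring.
Qed.

Ltac cartan_cases := rewrite /ext ?cartan_matrixE /bond /arrow ?if_int /=; lia.

Let Aij d : A i j = - d -> forall y, y \in Y -> A i y = if y == j then - d else 0.
Proof. by move=> e y yY; case: eqP => [->|/eqP /step_other->]. Qed.

(** A single bond lengthens the chain. A double bond has [i] on its long side and gives type C with
    [i] as last node, so the numbering is reversed. *)
Lemma step_chain : chain_end Y j -> classified (i |: Y) i.
Proof.
move=> [n [p rY]]; have [/andP[_ n1] _ _ _] := rY.
have kr : (0 < 1 <= dynkin_rank (Type_A n))%N by [].
have [ij|ij] : A i j = -1 \/ A i j = -2 by have := step_bound; lia.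
  left; have [|||||x y xr yr|p' rp'] := extend_rooted iY rY kr (Aij ij) Aj
    (X' := Type_A n.+1) (k' := 1) (sg := iota 0 n.+1) => //.
    rewrite /= in xr yr; rewrite !nth_iota // !add0n; case: x xr => [|x] xr; case: y yr => [|y] yr; cartan_cases.
  by exists n.+1, p'.
right; split; first exact: step_double_refire.
have [|||||x y xr yr|p' rp'] := extend_rooted iY rY kr (Aij ij) Aj
    (X' := Type_C n.+1) (k' := n.+1) (sg := rev (iota 0 n.+1)) => //.
- by rewrite /= eqxx andbT.
- by rewrite perm_rev.
- by rewrite nth_rev ?size_iota // subnn.
- rewrite /= in xr yr; rewrite !nth_rev ?size_iota // !nth_iota; try lia.
  rewrite !add0n !subSS; case ex: (n - x)%N => [|x']; case ey: (n - y)%N => [|y']; cartan_cases.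
by exists (Type_C n.+1), n.+1, p'.
Qed.

(** The vertex attached to an end of A_n gives A_{n+1}, next to an end D_{n+1} with a spin node as
    root. B_n and D_n at node 1 grow within their type; C_2 becomes B_3, D_4 becomes D_5, D_5 at a
    spin node becomes E_6, E_6 becomes E_7. In all other cases an overflowing subdiagram appears. *)
Lemma step_rooted X k p : rooted Y j X k p -> refire Y j ->
  exists X' k' p', rooted (i |: Y) i X' k' p'.
Proof.
move=> rY rf; have ij := step_refire_bound rf.
have [cX _ _ _] := rY; have kr := cominuscule_rank cX.
have ext_ok X' k' sg : cominuscule X' k' -> dynkin_rank X' = (dynkin_rank X).+1 ->
    perm_eq sg (iota 0 (dynkin_rank X).+1) -> (k'.-1 < (dynkin_rank X).+1)%N ->
    nth 0%N sg k'.-1 = 0%N ->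
    (forall x y, (x < (dynkin_rank X).+1)%N -> (y < (dynkin_rank X).+1)%N ->
      ext (cartan_matrix X) k 1 (nth 0%N sg x) (nth 0%N sg y) = cartan_matrix X' x.+1 y.+1) ->
    exists X' k' p', rooted (i |: Y) i X' k' p'.
  move=> h1 h2 h3 h4 h5 h6.
  have [p' rp'] := extend_rooted iY rY kr (Aij ij) Aj h1 h2 h3 h4 h5 h6.
  by exists X', k', p'.
have bad t N w : all (fun x => (x <= dynkin_rank X)%N) t -> uniq t -> head 1%N t = 0%N ->
    (forall x y, (x < size t)%N -> (y < size t)%N ->
     ext (cartan_matrix X) k 1 (nth 0%N t x) (nth 0%N t y) = N x y) ->
    overflow N (size t) w -> exists X' k' p', rooted (i |: Y) i X' k' p'.
  by move=> h1 h2 h3 h4 h5; have := extend_overflow iY rY kr (Aij ij) Aj start_i h1 h2 h3 h4 h5.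
case: X rY cX kr ext_ok bad => [n|n|n|n|n] /= rY cX kr ext_ok bad.
- have nth_last x : (x < n.+1)%N -> nth 0%N (rcons (iota 1 n) 0%N) x = if x == n then 0%N else x.+1.
    move=> xn; rewrite nth_rcons size_iota; case: eqP => [->|xn']; first by rewrite ltnn.
    by rewrite ifT ?nth_iota //; lia.
  have perm_last : perm_eq (rcons (iota 1 n) 0%N) (iota 0 n.+1) by rewrite perm_rcons.
  have [k1|k1] := eqVneq k 1%N.
    apply: (ext_ok (Type_A n.+1) 1%N (iota 0 n.+1)) => // x y xr yr.
    rewrite !nth_iota // !add0n; case: x xr => [|x] xr; case: y yr => [|y] yr; cartan_cases.
  have [kn|kn] := eqVneq k n.
    apply: (ext_ok (Type_A n.+1) n.+1 (rcons (iota 1 n) 0%N)) => //; first by simpl; lia.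
      by rewrite nth_last // eqxx.
    by move=> x y xr yr; rewrite !nth_last //; do 2!case: eqP => ?; cartan_cases.
  have [k2|k2] := eqVneq k 2%N.
    apply: (ext_ok (Type_D n.+1) n.+1 (rev (iota 0 n.+1))) => //.
    - simpl; lia.
    - by rewrite perm_rev.
    - by rewrite nth_rev ?size_iota // subnn.
    move=> x y xr yr; rewrite !nth_rev ?size_iota // !nth_iota; try lia.
    rewrite !add0n !subSS; case ex: (n - x)%N => [|x']; case ey: (n - y)%N => [|y']; cartan_cases.
  have [kn1|kn1] := eqVneq k n.-1.
    apply: (ext_ok (Type_D n.+1) n.+1 (rcons (iota 1 n) 0%N)) => //; first by simpl; lia.
      by rewrite nth_last // eqxx.
    move=> x y xr yr; rewrite !nth_last //; do 2!case: eqP => ?; cartan_cases.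
  (* There are at least two vertices on both sides of [k], so the new vertex together with two on
     each side and [k] form E_6. *)
  have [m [em [km nm]]] : exists m : nat, k = m.+3 /\ (m.+3 <= k)%N /\ (k + 2 <= n)%N.
    by exists (k - 3)%N; lia.
  apply: (bad [:: 0; m.+3; m.+2; m.+1; m.+4; m.+4.+1]%N _ _ _ _ _ _ overflowA) => //=; try by rewrite ?inE; lia.
  rewrite em; move=> [|[|[|[|[|[|x]]]]]] [|[|[|[|[|[|y]]]]]] // _ _; rewrite /tabA /tab /=; cartan_cases.
- apply: (ext_ok (Type_B n.+1) 1%N (iota 0 n.+1)) => //; first by simpl; lia.
  move=> x y xr yr; have k1 : k = 1%N by lia.
  rewrite !nth_iota // !add0n; case: x xr => [|x] xr; case: y yr => [|y] yr; cartan_cases.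
- have [n2|n3] := eqVneq n 2%N.
    apply: (ext_ok (Type_B 3) 1%N [:: 0; 2; 1]%N) => //; rewrite n2 //.
    have -> : k = 2%N by lia.
    by move=> [|[|[|x]]] [|[|[|y]]].
  have [m [em km]] : exists m : nat, n = m.+3 /\ k = m.+3 by exists (n - 3)%N; lia.
  apply: (bad [:: 0; m.+3; m.+2; m.+1]%N _ _ _ _ _ _ overflowC) => //=; try by rewrite ?inE; lia.
  rewrite em km; move=> [|[|[|[|x]]]] [|[|[|[|y]]]] // _ _; rewrite /tabC /tab /=; cartan_cases.
- have [k1|kn] : k = 1%N \/ k = n by lia.
    apply: (ext_ok (Type_D n.+1) 1%N (iota 0 n.+1)) => //; first by simpl; lia.
    move=> x y xr yr; rewrite !nth_iota // !add0n.
    case: x xr => [|x] xr; case: y yr => [|y] yr; cartan_cases.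
  (* By the symmetry of D_4, attaching at node 4 amounts to attaching at node 1. *)
  have [n4|n4] := eqVneq n 4%N.
    apply: (ext_ok (Type_D 5) 1%N [:: 0; 4; 2; 1; 3]%N) => //; rewrite ?kn ?n4 //.
    by move=> [|[|[|[|[|x]]]]] [|[|[|[|[|y]]]]].
  have [n5|n5] := eqVneq n 5%N.
    apply: (ext_ok (Type_E 6) 1%N [:: 0; 4; 5; 3; 2; 1]%N) => //; rewrite ?kn ?n5 //.
    by move=> [|[|[|[|[|[|x]]]]]] [|[|[|[|[|[|y]]]]]].
  have [m em] : exists m : nat, n = m.+3.+3 by exists (n - 6)%N; lia.
  apply: (bad [:: 0; m.+3.+3; m.+4; m.+3.+2; m.+3; m.+2; m.+1]%N _ _ _ _ _ _ overflowD) => //=; try by rewrite ?inE; lia.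
  rewrite kn em; move=> [|[|[|[|[|[|[|x]]]]]]] [|[|[|[|[|[|[|y]]]]]]] // _ _; rewrite /tabD /tab /=; cartan_cases.
have [[n6 k1]|[n7 k7]] : (n = 6 /\ k = 1)%N \/ (n = 7 /\ k = 7)%N by lia.
  apply: (ext_ok (Type_E 7) 7%N [:: 6; 2; 5; 4; 3; 1; 0]%N) => //; rewrite ?k1 ?n6 //.
  by move=> [|[|[|[|[|[|[|x]]]]]]] [|[|[|[|[|[|[|y]]]]]]].
apply: (bad [:: 0; 7; 6; 5; 4; 3; 2; 1]%N _ _ _ _ _ _ overflowE) => //=; try by rewrite n7.
by rewrite k7 n7; move=> [|[|[|[|[|[|[|[|x]]]]]]]] [|[|[|[|[|[|[|[|y]]]]]]]].
Qed.

End Step.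

End Game.

(** * Classification of rooted diagrams with a bounded game *)

Section Classification.

Variables (V : finType) (A : V -> V -> int).
Hypothesis Adiag : forall v, A v v = 2.
Hypothesis Ale0 : forall u v, u != v -> A u v <= 0.
Hypothesis Aeq0 : forall u v, (A u v == 0) = (A v u == 0).
Variable G : (V -> int) -> Prop.
Hypothesis Gfire : forall lam k, G lam -> G (fireV A k lam).
Hypothesis Gbound : forall lam v, G lam -> `|lam v| <= 1.

Local Notation fireV := (fireV A).
Local Notation starts := (starts G).
Local Notation classified := (classified A G).

Implicit Types (Y Z : {set V}) (u v i j : V) (lam : V -> int) (p q : seq V).

(** * Two components below the root vertex *)

Section Join.

Variables (Y1 Y2 : {set V}) (i a b : V) (lam : V -> int).
Hypotheses (iY1 : i \notin Y1) (iY2 : i \notin Y2) (aY : a \in Y1) (bY : b \in Y2).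
Hypothesis disj : forall y z, y \in Y1 -> z \in Y2 -> A y z = 0 /\ y != z.
Hypothesis Aa : forall y, y \in Y1 -> A y i = if y == a then - 1 else 0.
Hypothesis Ab : forall y, y \in Y2 -> A y i = if y == b then - 1 else 0.

Let Y := i |: (Y1 :|: Y2).
Hypothesis start_i : starts lam Y i.

Let in1 y : y \in Y1 -> y \in Y. Proof. by move=> h; rewrite !inE h orbT. Qed.
Let in2 y : y \in Y2 -> y \in Y. Proof. by move=> h; rewrite !inE h !orbT. Qed.
Let ni1 y : y \in Y1 -> y != i. Proof. by apply: contraTneq => ->. Qed.
Let ni2 y : y \in Y2 -> y != i. Proof. by apply: contraTneq => ->. Qed.

Let disjC y z : y \in Y1 -> z \in Y2 -> A z y = 0.
Proof. by move=> y1 z2; apply/eqP; rewrite Aeq0 (disj y1 z2).1. Qed.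

Let Aia : A i a <= -1.
Proof. by apply: (A_leN1 Ale0); [rewrite eq_sym ni1 | rewrite Aeq0 Aa // eqxx]. Qed.

Let Aib : A i b <= -1.
Proof. by apply: (A_leN1 Ale0); [rewrite eq_sym ni2 | rewrite Aeq0 Ab // eqxx]. Qed.

Lemma join_fire mu : starts mu Y i ->
  [/\ starts (fireV i mu) Y1 a, starts (fireV i mu) Y2 b & fireV i mu i = -1].
Proof.
move=> [Gm mE]; have mi : mu i = 1 by rewrite mE ?eqxx // setU11.
split; last by rewrite /fireV Adiag mi.
  split; first exact: Gfire.
  by move=> y yY; rewrite /fireV mE ?in1 // mi (negbTE (ni1 yY)) Aa //; case: eqP.
split; first exact: Gfire.
by move=> y yY; rewrite /fireV mE ?in2 // mi (negbTE (ni2 yY)) Ab //; case: eqP.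
Qed.

(** After [i], [a] and [b] have been fired, [i] holds [-1 - A i a - A i b], which is at most 1,
    while neither entry exceeds -1. *)
Lemma join_edges : A i a = -1 /\ A i b = -1.
Proof.
have [[G1 m1] [_ m2] mi] := join_fire start_i.
move: (fireV i lam) G1 m1 m2 mi => l1 G1 m1 m2 mi.
have := Gbound i (Gfire b (Gfire a G1)).
rewrite /fireV mi m1 // m2 // !eqxx (disjC aY bY); have := Aia; have := Aib; lia.
Qed.

Lemma join_refire : refire A G Y i.
Proof.
move=> mu sm; have [[G1 m1] [_ m2] mi] := join_fire sm.
exists (fireV i (fireV b (fireV a (fireV i mu)))); first by do 3!apply: Gfire.
move=> z zY Az; have [ia ib] := join_edges.
have za : A z a = 0 by apply: Az; [apply: in1 | apply: ni1].
have zb : A z b = 0 by apply: Az; [apply: in2 | apply: ni2].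
have [_ mE] := sm; have mui : mu i = 1 by rewrite mE ?eqxx // setU11.
have ma : fireV i mu a = 1 by rewrite m1 // eqxx.
have mb : fireV i mu b = 1 by rewrite m2 // eqxx.
have l1z : fireV i mu z = mu z - A z i by rewrite /fireV mui; ring.
move: (fireV i mu) mi ma mb l1z => l1 mi ma mb l1z.
by rewrite /fireV za zb l1z mi ma mb ia ib (disjC aY bY); ring.
Qed.

(** If [a] could be fired twice within [Y1], [i] would rise from -1 to at least 1, and firing [b]
    would then push it to at least 2. *)
Lemma join_not_refire : chain_end A Y1 a \/ refire A G Y1 a -> chain_end A Y1 a.
Proof.
case=> // rf; exfalso; have [s1 [_ m2] mi] := join_fire start_i.
move: (fireV i lam) s1 m2 mi => l1 s1 m2 mi.
have [mu2 G2 m] := rf _ s1.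
have e1 : mu2 i = -1 - 2 * A i a.
  rewrite m ?mi // => y yY ya; apply/eqP; rewrite Aeq0 Aa // (negbTE ya) //.
have e2 : mu2 b = 1.
  rewrite m ?m2 ?eqxx ?(disjC aY bY) //.
    by apply/negP => b1; have [_] := disj b1 bY; rewrite eqxx.
  by move=> y yY _; apply: disjC.
have := Gbound i (Gfire b G2); rewrite /fireV e1 e2; have := Aia; have := Aib; lia.
Qed.

(** Two chains attached by their ends form one chain with [i] inside, so [i] becomes node
    [n1.+1]. *)
Lemma join_chains : chain_end A Y1 a -> chain_end A Y2 b ->
  exists X k p, rooted A Y i X k p.
Proof.
move=> [n1 [p1 [/andP[_ n10] [u1 /= s1 m1] e1 r1]]] [n2 [p2 [/andP[_ n20] [u2 /= s2 m2] e2 r2]]].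
have [ia ib] := join_edges.
pose s := rev p1 ++ i :: p2.
have ss : size s = (n1 + n2).+1 by rewrite size_cat size_rev /= s1 s2 addnS.
have nth_s v x : nth v s x = if (x < n1)%N then nth v p1 (n1 - x.+1) else
    if x == n1 then i else nth v p2 (x - n1.+1).
  rewrite nth_cat size_rev s1; case: ltnP => [lt|le]; first by rewrite nth_rev s1.
  case: eqP => [->|ne]; first by rewrite subnn.
  by rewrite (_ : x - n1 = (x - n1.+1).+1)%N //; lia.
have p1Y v x : (x < n1)%N -> nth v p1 x \in Y1 by move=> h; rewrite -e1 mem_nth ?s1.
have p2Y v x : (x < n2)%N -> nth v p2 x \in Y2 by move=> h; rewrite -e2 mem_nth ?s2.
have p1a v x : (x < n1)%N -> (nth v p1 x == a) = (x == 0%N).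
  move=> h; rewrite -[X in _ == X]r1 (set_nth_default a) ?s1 // nth_uniq ?s1 //.
have p2b v x : (x < n2)%N -> (nth v p2 x == b) = (x == 0%N).
  move=> h; rewrite -[X in _ == X]r2 (set_nth_default b) ?s2 // nth_uniq ?s2 //.
have Ai1 v x : (x < n1)%N -> A i (nth v p1 x) = if x == 0%N then - 1 else 0.
  move=> h; rewrite -(p1a v) //; case: eqP => [->//|ne].
  by apply/eqP; rewrite Aeq0 Aa ?p1Y //; move/eqP/negbTE: ne => ->.
have Ai2 v x : (x < n2)%N -> A i (nth v p2 x) = if x == 0%N then - 1 else 0.
  move=> h; rewrite -(p2b v) //; case: eqP => [->//|ne].
  by apply/eqP; rewrite Aeq0 Ab ?p2Y //; move/eqP/negbTE: ne => ->.
exists (Type_A (n1 + n2).+1), n1.+1, s; split.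
- by simpl; lia.
- split=> //.
    rewrite cat_uniq rev_uniq u1 /= u2 e2 iY2 !andbT mem_rev e1 negb_or iY1 /=.
    by apply/hasPn => y; rewrite mem_rev e1 e2 => y2; apply/negP => y1; have [_] := disj y1 y2; rewrite eqxx.
  move=> v x y; rewrite ss !nth_s => xr yr.
  case: (ltngtP x n1) => hx; case: (ltngtP y n1) => hy.
  + by rewrite m1 ?s1 ?cartan_matrixE /=; lia.
  + by rewrite (disj (p1Y _ _ _) (p2Y _ _ _)).1 ?cartan_matrixE /=; lia.
  + by rewrite Aa ?p1Y ?p1a ?cartan_matrixE ?if_int /=; lia.
  + by rewrite disjC ?p1Y ?p2Y ?cartan_matrixE /=; lia.
  + by rewrite m2 ?s2 ?cartan_matrixE /=; lia.
  + by rewrite Ab ?p2Y ?p2b ?cartan_matrixE ?if_int /=; lia.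
  + by rewrite Ai1 ?cartan_matrixE ?if_int /=; lia.
  + by rewrite Ai2 ?cartan_matrixE ?if_int /=; lia.
  by rewrite Adiag cartan_matrixE /=; lia.
- move=> v; rewrite mem_cat mem_rev !inE e1 e2.
  by rewrite orbCA.
by rewrite nth_s /= ltnn eqxx.
Qed.

End Join.

Definition edge Y : rel V := fun x y => [&& x \in Y, y \in Y & A x y != 0].

Definition connected Y := forall x y, x \in Y -> y \in Y -> connect (edge Y) x y.

Lemma edge_sym Y : symmetric (edge Y).
Proof. by move=> x y; rewrite /edge Aeq0 andbCA. Qed.

Lemma edge_csym Y : connect_sym (edge Y).
Proof. exact/connect_sym_sym/edge_sym || exact: (sym_connect_sym (edge_sym Y)). Qed.

Lemma edge_path Y x p : path (edge Y) x p -> path (fun x y => A x y != 0) x p /\ {subset p <= Y}.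
Proof.
elim: p x => //= y p IH x /andP[/and3P[_ yY xy] /IH[pp pY]]; rewrite xy; split=> // z.
by rewrite inE => /orP[/eqP->|/pY].
Qed.

Definition component Y a := [set y in Y | connect (edge Y) a y].

Lemma component_connected Y a : connected (component Y a).
Proof.
move=> x y; rewrite !inE => /andP[xY ax] /andP[yY ay].
have : connect (edge Y) x y by apply: connect_trans ay; rewrite edge_csym.
move=> /connectP[p pp ->]; apply/connectP; exists p => //.
elim: p x xY ax pp => //= z p IH x xY ax /andP[xz pp].
have az : connect (edge Y) a z by apply: connect_trans ax (connect1 xz).
have zY : z \in Y by case/and3P: xz.
rewrite IH // andbT /edge !inE xY ax zY az /=.
by case/and3P: xz.
Qed.

(** Induction on the size of [Y]. Once [i] has been fired its neighbours hold 1; each component of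
    the rest contains exactly one neighbour, and there are at most two components. *)
Theorem classify Y i : i \in Y -> connected Y -> (exists lam, starts lam Y i) -> classified Y i.
Proof.
have [N] := ubnP #|Y|; elim: N Y i => // N IH Y i ltY iY cY [lam st].
have [Gl lE] := st; have li : lam i = 1 by rewrite lE // eqxx.
pose Y' := Y :\ i; pose lam1 := fireV i lam.
have G1 : G lam1 by apply: Gfire.
have Y'Y y : y \in Y' -> y \in Y by rewrite in_setD1 => /andP[].
have Y'i y : y \in Y' -> y != i by rewrite in_setD1 => /andP[].
have l1 y : y \in Y' -> lam1 y = - A y i.
  move=> yY; rewrite /lam1 /fireV li lE ?Y'Y // (negbTE (Y'i y yY)); lia.
have Anb y : y \in Y' -> A y i != 0 -> A y i = -1.
  move=> yY h; have := Gbound y G1; rewrite l1 //.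
  by have := A_leN1 Ale0 (Y'i y yY) h; lia.
(* Two neighbours of [i] in one component both hold 1; firing along a path between them would
   produce a value above 1. *)
have sep a b : a \in Y' -> b \in Y' -> A a i != 0 -> A b i != 0 -> connect (edge Y') a b -> a = b.
  move=> aY bY ha hb /connectP[p pp lp]; apply/eqP; apply: contrapT => /negP ab.
  move: pp lp; move=> /shortenP[q pq uq _] lq.
  have [pq' qY] := edge_path pq.
  apply: (path_contra Ale0 Aeq0 Gfire Gbound pq' uq _ G1).
  - by apply: contraNneq ab => q0; rewrite lq q0.
  - by rewrite l1 // Anb.
  - by move=> v /qY vY; rewrite l1 //; have := Ale0 (Y'i v vY); lia.
  by rewrite -lq l1 // Anb.
(* A path from [y] reaches [i] for the first time from a neighbour of [i] in the component of
   [y]. *)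
have cover y : y \in Y' -> exists a, [/\ a \in Y', A a i != 0 & y \in component Y' a].
  move=> yY; have /connectP[p pp lp] := cY y i (Y'Y y yY) iY.
  elim: p y yY pp lp => [|z p IHp] y yY /=; first by move=> _ e; rewrite -e in_setD1 eqxx in yY.
  move=> /andP[/and3P[_ zY yz] pp] lp.
  have [ez|zi] := eqVneq z i.
    by exists y; split; rewrite -?ez //; rewrite inE yY connect0.
  have zY' : z \in Y' by rewrite in_setD1 zi.
  have [a [aY ha]] := IHp z zY' pp lp; rewrite inE => /andP[_ az].
  exists a; split=> //; rewrite inE yY; apply: connect_trans az (connect1 _).
  by rewrite edge_sym /edge yY zY' yz.
have compS a y : y \in component Y' a -> y \in Y' by rewrite inE => /andP[].
have compA a y : a \in Y' -> A a i != 0 -> y \in component Y' a ->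
    A y i = if y == a then - 1 else 0.
  move=> aY ha yC; case: eqP => [->|ya]; first exact: Anb.
  apply/eqP; apply: contrapT => /negP h; apply: ya; apply/esym; apply: sep => //; last first.
    by move: yC; rewrite inE => /andP[].
  exact: compS yC.
have comp_cl a : a \in Y' -> A a i != 0 -> classified (component Y' a) a.
  move=> aY ha; apply: IH.
  - apply: (@leq_trans #|Y|); last by [].
    apply: proper_card; apply/properP; split; first by apply/subsetP => y /compS/Y'Y.
    by exists i => //; apply/negP => /compS; rewrite in_setD1 eqxx.
  - by rewrite inE aY connect0.
  - exact: component_connected.
  exists lam1; split=> // y yC; have -> := l1 y (compS _ _ yC).
  by rewrite (compA a y aY ha yC); case: eqP.
have iC a : i \notin component Y' a by apply/negP => /compS; rewrite in_setD1 eqxx.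
have [a /andP[aY ha]|none] := pickP (fun a => (a \in Y') && (A a i != 0)); last first.
  have Y1 : Y = [set i].
    apply/setP => y; rewrite in_set1; apply/idP/eqP => [yY|->//].
    apply/eqP; apply: contrapT => /negP yi.
    have [|a [aY ha _]] := cover y; first by rewrite in_setD1 yi.
    by have := none a; rewrite aY ha.
  left; exists 1%N, [:: i]; split=> //; last by move=> v; rewrite Y1 !inE.
  split=> // v [|x] [|y] //= _ _; exact: Adiag.
have aC : a \in component Y' a by rewrite inE aY connect0.
have cla := comp_cl a aY ha.
have [b /and3P[bY hb ba]|none] := pickP (fun b => [&& b \in Y', A b i != 0 & b != a]); last first.
  have eY : Y = i |: component Y' a.
    apply/setP => y; rewrite in_setU1; have [->|yi] := eqVneq y i; first by rewrite iY.
    apply/idP/idP => [yY|/compS/Y'Y //].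
    have [|c [cY' hc yc]] := cover y; first by rewrite in_setD1 yi.
    suff <- : c = a by []. 
    by apply/eqP; have := none c; rewrite cY' hc /= => /negbT; rewrite negbK.
  rewrite eY in st *.
  case: cla => [ch|[rf [X [k [p rt]]]]].
    exact: (step_chain Adiag Ale0 Aeq0 Gfire Gbound (iC a) aC st (fun y => @compA a y aY ha) ch).
  right; split.
    have ei := step_refire_bound Adiag Ale0 Aeq0 Gfire Gbound (iC a) aC st (fun y => @compA a y aY ha) rf.
    exact: (step_refire Adiag Aeq0 Gfire (iC a) aC (fun y => @compA a y aY ha) rf ei).
  exact: (step_rooted Adiag Ale0 Aeq0 Gfire Gbound (iC a) aC st (fun y => @compA a y aY ha) rt rf).
have bC : b \in component Y' b by rewrite inE bY connect0.
have clb := comp_cl b bY hb.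
(* Three neighbours all hold 1, so the bound makes them pairwise non-adjacent; firing them then
   raises [i] from -1 to at least 2. *)
have [c /and5P[cY' hc ca cb _]|none] := pickP (fun c => [&& c \in Y', A c i != 0, c != a, c != b & true]).
  exfalso.
  have la : lam1 a = 1 by rewrite l1 // Anb.
  have lb : lam1 b = 1 by rewrite l1 // Anb.
  have lc : lam1 c = 1 by rewrite l1 // Anb.
  have lli : lam1 i = -1 by rewrite /lam1 /fireV Adiag li.
  have Ai y : y \in Y' -> A y i != 0 -> A i y <= -1.
    by move=> yY h; apply: (A_leN1 Ale0); [rewrite eq_sym Y'i | rewrite Aeq0].
  have Ga := Gfire a G1; have Gb := Gfire b Ga.
  have Aba : A b a = 0 by have := Gbound b Ga; rewrite /fireV la lb; have := Ale0 ba; lia.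
  have Aca : A c a = 0 by have := Gbound c Ga; rewrite /fireV la lc; have := Ale0 ca; lia.
  have Acb : A c b = 0.
    have := Gbound c Gb; rewrite /fireV.
    by rewrite lb la lc Aba Aca; have := Ale0 cb; lia.
  have := Gbound i (Gfire c Gb); rewrite /fireV lli la lb lc Aba Aca Acb.
  have := Ai a aY ha; have := Ai b bY hb; have := Ai c cY' hc; lia.
have dsj y z : y \in component Y' a -> z \in component Y' b -> A y z = 0 /\ y != z.
  move=> yC zC; have yY := compS _ _ yC; have zY := compS _ _ zC.
  have ay : connect (edge Y') a y by move: yC; rewrite inE => /andP[].
  have bz : connect (edge Y') b z by move: zC; rewrite inE => /andP[].
  have nab w : connect (edge Y') a w -> connect (edge Y') b w -> False.
    move=> aw bw; move/eqP: ba; apply; apply: sep => //; apply: connect_trans bw _.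
    by rewrite edge_csym.
  split; last by apply/eqP => e; apply: (nab y) => //; rewrite e.
  apply/eqP; apply: contrapT => /negP yz; apply: (nab z) => //.
  by apply: connect_trans ay (connect1 _); rewrite /edge yY zY yz.
have eY : Y = i |: (component Y' a :|: component Y' b).
  apply/setP => y; rewrite in_setU1 in_setU; have [->|yi] := eqVneq y i; first by rewrite iY.
  apply/idP/idP => /= [yY|/orP[] /compS/Y'Y //].
  have [|c [cY' hc yc]] := cover y; first by rewrite in_setD1 yi.
  have := none c; rewrite cY' hc /= andbT.
  by have [<-|_] := eqVneq c a; [rewrite yc | have [<-|_] := eqVneq c b => //; rewrite yc orbT].
rewrite eY in st *.
have Ja := fun y => @compA a y aY ha; have Jb := fun y => @compA b y bY hb.
have weaken Z j : classified Z j -> chain_end A Z j \/ refire A G Z j.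
  by case=> [h|[h _]]; [left|right].
have dsj' y z : y \in component Y' b -> z \in component Y' a -> A y z = 0 /\ y != z.
  by move=> yb za; have [h1 h2] := dsj z y za yb; split; [apply/eqP; rewrite Aeq0 h1 | rewrite eq_sym].
have st' : starts lam (i |: (component Y' b :|: component Y' a)) i.
  by rewrite [component Y' b :|: _]setUC.
have cha := join_not_refire (iC a) (iC b) aC bC dsj Ja Jb st (weaken _ _ cla).
have chb := join_not_refire (iC b) (iC a) bC aC dsj' Jb Ja st' (weaken _ _ clb).
right; split; first exact: join_refire (iC a) (iC b) aC bC dsj Ja Jb st.
exact: join_chains (iC a) (iC b) aC bC dsj Ja Jb st cha chb.
Qed.

End Classification.

(** * Abelian supplements *)

Section Diagram.

Variables (F : closedFieldType) (char0 : [pchar F]%R =i pred0).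
Variables (L : lieAlgType F) (simpleL : lie_simple L).
Variables (H : {vspace L}) (cartanH : cartan_subalgebra H).
Variables (Gamma Sigma Sigma1 : {fset dual H}).
Hypotheses (rootsG : root_system Gamma) (simpleS : simple_system Gamma Sigma).

(** The fundamental coweight [e0] pairs with a root to its coefficient at the node, so [good al e0]
    is the bound required by [bound_supplement]. Nodes count from 1 and ordinals from 0, hence the
    successors. *)
Lemma minuscule_supplement X i : (0 < i <= dynkin_rank X)%N -> minuscule X i ->
  type_and_node Sigma Sigma1 X i ->
  has_abelian_supplement (standard_parabolic Gamma Sigma Sigma1).
Proof.
move=> ir [O [Ofire Obound [c0 Oc0 c0E]]] [alpha [[alphaS alphaM] ->]].
set r := dynkin_rank X in ir Ofire Obound c0E alphaS alphaM.
pose al (j : 'I_r) := alpha j.+1.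
have alS : perm_eq [seq al j | j <- enum 'I_r] Sigma.
  rewrite (_ : [seq al j | j <- enum 'I_r] = [seq alpha i | i <- iota 1 r]) //.
  by rewrite (iotaDl 1 0 r) -map_comp -val_enum_ord -map_comp.
have AM j k : gcm al j k = cartan_matrix X j.+1 k.+1.
  by apply: (cint_eq char0); apply: alphaM; rewrite ltn_ord.
have [i0 ei0] : exists i0 : 'I_r, i = i0.+1.
  have lt : (i.-1 < r)%N by lia.
  by exists (Ordinal lt); rewrite /= prednK //; lia.
have -> : alpha i = al i0 by rewrite ei0.
apply: (bound_supplement char0 cartanH simpleL rootsG simpleS alS) => g rg.
pose O' (lam : 'I_r -> int) := exists2 c, O c & forall j : 'I_r, lam j = c j.+1.
pose e0 (j : 'I_r) : int := (j == i0)%:Z.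
have ge0 : good al e0.
  apply: (@orbit_good _ char0 _ _ cartanH simpleL _ _ rootsG simpleS _ _ alS O').
  - move=> lam k [c Oc lamE]; have [|c' Oc' c'E] := Ofire c k.+1 Oc; first exact: ltn_ord.
    exists c' => // j; rewrite c'E; last exact: ltn_ord.
    by rewrite /fire !lamE AM.
  - by move=> lam j [c Oc ->]; apply: Obound => //; apply: ltn_ord.
  exists c0 => // j; rewrite c0E; last exact: ltn_ord.
  by rewrite ei0 eqSS.
have eg := root_coef char0 rootsG simpleS alS rg; rewrite eg in rg.
have := ge0 _ rg; rewrite /pairing (bigD1 i0) //= /e0 eqxx mulr1.
by rewrite big1 ?addr0 // => j /negbTE->; rewrite mulr0.
Qed.

(** [Sigma] is enumerated in an arbitrary order. [classify], applied to the whole diagram, which is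
    connected by [component_full], returns the list [p] that puts it in Bourbaki order. *)
Lemma supplement_cominuscule : (Sigma1 `<=` Sigma)%fset -> Sigma1 <> fset0 ->
  maximal_subalgebra (standard_parabolic Gamma Sigma Sigma1) ->
  has_abelian_supplement (standard_parabolic Gamma Sigma Sigma1) ->
  exists X k, cominuscule X k /\ type_and_node Sigma Sigma1 X k.
Proof.
move=> sub1 S10 maxP.
pose al (j : 'I_(size Sigma)) := tnth (in_tuple Sigma) j.
have alS : perm_eq [seq al j | j <- enum 'I_(size Sigma)] Sigma by rewrite map_tnth_enum.
have [i0 ->] := maximal_parabolic_singleton char0 cartanH simpleL rootsG simpleS alS sub1 S10 maxP.
move=> /(supplement_bound char0 cartanH simpleL rootsG simpleS alS) bd.
have Adiag := gcm_diag char0 cartanH simpleL rootsG simpleS alS.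
have Ale0 := gcm_le0 char0 cartanH simpleL rootsG simpleS alS.
have Aeq0 := gcm_eq0 char0 cartanH simpleL rootsG simpleS alS.
have Gfire lam k : good al lam -> good al (fireV (gcm al) k lam).
  exact: (good_fire char0 cartanH simpleL rootsG simpleS alS).
have Gbound lam v := @good_bound _ _ _ _ _ rootsG simpleS _ _ alS lam v.
have conn : connected (gcm al) setT.
  move=> x y _ _; pose B := component (gcm al) setT x.
  have BT : B = setT.
    apply: (component_full char0 cartanH simpleL rootsG simpleS alS) => [i j|].
      rewrite !inE /= => xi xj; apply/eqP; apply: contraNT xj => ij.
      by apply: connect_trans xi (connect1 _); rewrite /edge !inE.
    by apply/set0Pn; exists x; rewrite !inE connect0.
  have yB : y \in B by rewrite BT in_setT.
  by move: yB; rewrite inE => /andP[].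
have start : exists lam, starts (good al) lam setT i0.
  exists (fun j => (j == i0)%:Z); split=> // m rm; have := bd _ rm.
  rewrite (coef_comb char0 simpleS alS) /pairing (bigD1 i0) //= eqxx mulr1.
  by rewrite big1 ?addr0 // => j /negbTE->; rewrite mulr0.
have [X [k [p [cX [up sp mp] pT nk]]]] : exists X k p, rooted (gcm al) setT i0 X k p.
  have [[n [p rp]]|[_ //]] := classify Adiag Ale0 Aeq0 Gfire Gbound (in_setT i0) conn start.
  by exists (Type_A n), 1%N, p.
exists X, k; split=> //; exists (fun t => al (nth i0 p t.-1)); split; last by rewrite nk.
split.
  apply: perm_trans alS; rewrite (iotaDl 1 0) -map_comp -sp.
  have -> : [seq ((fun t => al (nth i0 p t.-1)) \o addn 1) t | t <- iota 0 (size p)] = map al p.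
    by rewrite -[in RHS](mkseq_nth i0 p) /mkseq -map_comp.
  apply: (perm_map al); apply: uniq_perm => //; first exact: enum_uniq.
  by move=> v; rewrite pT mem_enum inE.
move=> i j ir jr; rewrite (cintP char0 cartanH simpleL); try exact: (simple_root rootsG simpleS alS).
have := mp i0 i.-1 j.-1; rewrite /gcm => -> //; rewrite ?sp; try lia.
by congr ((cartan_matrix _ _ _)%:~R); lia.
Qed.

End Diagram.

Local Close Scope ring_scope.

Theorem proposition3p3 (F : closedFieldType)
    (char0 : [pchar F]%R =i pred0)
    (L : lieAlgType F) (simpleL : lie_simple L)
    (H : {vspace L}) (cartanH : cartan_subalgebra H)
    (Gamma Sigma Sigma1 : {fset dual H})
    (rootsG : root_system Gamma) (simpleS : simple_system Gamma Sigma)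
    (subS1 : (Sigma1 `<=` Sigma)%fset) (S1_neq0 : Sigma1 <> fset0)
    (P : {vspace L}) (defP : P = standard_parabolic Gamma Sigma Sigma1)
    (maxP : maximal_subalgebra P) :
  has_abelian_supplement P <->
  ((exists n i, (1 <= i <= n)%N /\ type_and_node Sigma Sigma1 (Type_A n) i) \/
   (exists n, (2 <= n)%N /\ type_and_node Sigma Sigma1 (Type_B n) 1) \/
   (exists n, (2 <= n)%N /\ type_and_node Sigma Sigma1 (Type_C n) n) \/
   (exists n i, (4 <= n)%N /\ i \in [:: 1; n.-1; n] /\
      type_and_node Sigma Sigma1 (Type_D n) i) \/
   (exists i, i \in [:: 1; 6] /\ type_and_node Sigma Sigma1 (Type_E 6) i) \/
   type_and_node Sigma Sigma1 (Type_E 7) 7).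
Proof.
subst P; split.
  move=> /(supplement_cominuscule char0 simpleL cartanH rootsG simpleS subS1 S1_neq0 maxP).
  move=> [[n|n|n|n|n] [k [/= ck tn]]].
  - by left; exists n, k.
  - by case/andP: ck => n2 /eqP ek; subst k; right; left; exists n.
  - by case/andP: ck => n2 /eqP ek; subst k; do 2!right; left; exists n.
  - do 3!right; left; exists n, k; case/andP: ck => n4 kk; split=> //; split=> //.
    by rewrite !inE; case/orP: kk => ->; rewrite ?orbT.
  do 4!right; case/orP: ck => /andP[/eqP en /eqP ek]; subst n k; [left|right] => //.
  by exists 1%N.
have sup X i := @minuscule_supplement _ char0 _ simpleL _ cartanH _ _ Sigma1 rootsG simpleS X i.
move=> [[n [i [ni tn]]]|[[n [n2 tn]]|[[n [n2 tn]]|[[n [i [n4 [ni tn]]]]|[[i [ni tn]]|tn]]]]].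
- by apply: sup tn => //; apply: minuscule_A.
- by apply: sup tn; [simpl; lia | apply: minuscule_B].
- by apply: sup tn; [simpl; lia | apply: minuscule_C].
- apply: sup tn; first by move: ni; rewrite !inE /=; lia.
  move: ni; rewrite inE => /orP[/eqP->|ni]; first exact: minuscule_D1.
  exact: minuscule_D.
- by apply: sup tn; [move: ni; rewrite !inE /=; lia | apply: minuscule_E6].
by apply: sup tn => //; apply: minuscule_E7.
Qed.
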